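(* Let $p>1$ and let $\mathcal{M}$ be a closed maximal ideal in $F^p$. Then there exists $\lambda\in\mathbb{D}$ such that $\mathcal{M}=\mathcal{M}_\lambda:=\{f\in F^p: f(\lambda)=0\}$.
   Context: $\mathbb{D}$ denotes the open unit disk in $\mathbb{C}$. For $p>1$, $F^p$ is the space of all holomorphic functions $f$ on $\mathbb{D}$ such that $\lim_{r\to 1^-}(1-r)^{1/p}\log^+M_\infty(r,f)=0$, where $M_\infty(r,f)=\max_{|z|\le r}|f(z)|$ for $0<r<1$ and $\log^+x=\max\{\log x,0\}$. For $f(z)=\sum_{n\ge0}a_nz^n\in F^p$ and $c>0$ one has $\|f\|_{p,c}:=\sum_{n=0}^\infty |a_n|\exp(-c\,n^{1/(p+1)})<\infty$, and $F^p$ carries the locally convex topology given by the family of seminorms $\{\|\cdot\|_{p,c}\}_{c>0}$; with this topology and pointwise multiplication, $F^p$ is a commutative Fréchet algebra. ''Closed'' refers to this topology and ''maximal ideal'' means a proper ideal of the ring $F^p$ not properly contained in any other proper ideal. *)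

(* Defs.v *)
From Stdlib Require Import Reals List ClassicalEpsilon.
From Coquelicot Require Import Coquelicot.
Open Scope R_scope.

Definition disk (z : C) : Prop := Cmod z < 1.

(* A function on the disk is represented by its extension by 0 to C, so that
   Leibniz equality (up to functional extensionality) is equality on the disk. *)
Definition on_disk (f : C -> C) : Prop := forall z, ~ disk z -> f z = RtoC 0.

Definition holomorphic_on_disk (f : C -> C) : Prop :=
  forall z, disk z -> @ex_derive C_AbsRing C_NormedModule f z.

Definition fadd (f g : C -> C) : C -> C := fun z => Cplus (f z) (g z).
Definition fsub (f g : C -> C) : C -> C := fun z => Cminus (f z) (g z).
Definition fmul (f g : C -> C) : C -> C := fun z => Cmult (f z) (g z).
Definition fzero : C -> C := fun _ => RtoC 0.

(* ln is 0 on nonpositive reals, so log_plus 0 = 0. *)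
Definition log_plus (x : R) : R := Rmax (ln x) 0.

(* For f continuous on the disk and 0 < r < 1 this supremum is a maximum. *)
Definition Minf (r : R) (f : C -> C) : R :=
  real (Lub_Rbar (fun y => exists z : C, Cmod z <= r /\ y = Cmod (f z))).

Definition Fp (p : R) (f : C -> C) : Prop :=
  on_disk f /\
  holomorphic_on_disk f /\
  filterlim (fun r => Rpower (1 - r) (1 / p) * log_plus (Minf r f))
            (at_left 1) (locally 0).

Definition power_series_on_disk (a : nat -> C) (f : C -> C) : Prop :=
  forall z, disk z ->
    @is_series C_AbsRing C_NormedModule (fun n => Cmult (a n) (Cpow z n)) (f z).

(* The sequence a with f(z) = sum a_n z^n on the disk; it exists and is unique
   for every f holomorphic on the disk. *)
Definition coeffs (f : C -> C) : nat -> C :=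
  epsilon (inhabits (fun _ => RtoC 0)) (fun a => power_series_on_disk a f).

(* n^q for q > 0; Rpower 0 q is 1, hence the separate case. *)
Definition nat_rpow (n : nat) (q : R) : R :=
  match n with O => 0 | S _ => Rpower (INR n) q end.

(* The sum, in [0, +oo], of a series of nonnegative terms. *)
Definition seminorm (p c : R) (f : C -> C) : Rbar :=
  Lim_seq (sum_n (fun n =>
    Cmod (coeffs f n) * exp (- c * nat_rpow n (1 / (p + 1))))).

(* Open sets of the locally convex topology of F^p defined by the seminorms:
   basic neighbourhoods are given by finitely many c > 0 and a radius. *)
Definition Fp_open (p : R) (U : (C -> C) -> Prop) : Prop :=
  (forall f, U f -> Fp p f) /\
  forall f, U f ->
    exists (cs : list R) (eps : R),
      (forall c, In c cs -> 0 < c) /\ 0 < eps /\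
      forall g, Fp p g ->
        (forall c, In c cs -> Rbar_lt (seminorm p c (fsub g f)) (Finite eps)) ->
        U g.

Definition Fp_closed (p : R) (S : (C -> C) -> Prop) : Prop :=
  (forall f, S f -> Fp p f) /\ Fp_open p (fun f => Fp p f /\ ~ S f).

Definition Fp_ideal (p : R) (I : (C -> C) -> Prop) : Prop :=
  (forall f, I f -> Fp p f) /\
  I fzero /\
  (forall f g, I f -> I g -> I (fadd f g)) /\
  (forall f g, Fp p f -> I g -> I (fmul f g)).

Definition Fp_proper_ideal (p : R) (I : (C -> C) -> Prop) : Prop :=
  Fp_ideal p I /\ exists f, Fp p f /\ ~ I f.

Definition Fp_maximal_ideal (p : R) (I : (C -> C) -> Prop) : Prop :=
  Fp_proper_ideal p I /\
  forall J : (C -> C) -> Prop, Fp_proper_ideal p J ->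
    (forall f, I f -> J f) -> forall f, J f -> I f.

Definition M_at (p : R) (lambda : C) (f : C -> C) : Prop :=
  Fp p f /\ f lambda = RtoC 0.

(* Main.v *)
(** Suppose a closed maximal ideal M of F^p contains no z - a with |a| < 1. Then every z - a is
    invertible modulo M; let g_a be an inverse. Since M is closed there is a continuous linear
    functional phi vanishing on M with phi(1) <> 0 (orthogonal projection in a weighted l^2 norm of
    Taylor coefficients). For w in F^p the resolvent identity
    phi(w g_a) - phi(w g_b) = (a - b) phi(w g_b g_a) makes a |-> phi(w g_a) entire as soon as all these
    functions are locally bounded. F^p is not a Banach algebra, and the delicate points are |a| >= 1:
    if phi(w g_b_n) were unbounded for some b_n -> a, then for b_n converging fast enough
    u = prod (z - b_n)/(z - a) lies in F^p, is close to 1, hence has an inverse v modulo M, and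
    phi(w g_b_n) = phi(w v u/(z - b_n)) is bounded after all. So a phi(g_a) is entire, vanishes at 0
    and tends to - phi(1) at infinity, which contradicts the constancy of its circular means.

    Hence some z - a with |a| < 1 lies in M, and dividing f - f(a) by z - a gives M = M_a. *)

Require Import Defs.
From Stdlib Require Import Reals Lra Lia List Classical ClassicalEpsilon FunctionalExtensionality.
From Coquelicot Require Import Coquelicot.
Open Scope R_scope.

Lemma exp_le_compat (s t : R) : s <= t -> exp s <= exp t.
Proof. intros [H | ->]; [left; apply exp_increasing, H | right; reflexivity]. Qed.

Lemma Cmod_minus_comm (x y : C) : Cmod (x - y) = Cmod (y - x).
Proof. rewrite <- Cmod_opp. f_equal. ring. Qed.

Lemma Cmod_minus_diag (x : C) : Cmod (x - x) = 0.
Proof. unfold Cminus. rewrite Cplus_opp_r. apply Cmod_0. Qed.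

Lemma Cmod_minus_0_r (x : C) : Cmod (x - 0) = Cmod x.
Proof. f_equal. ring. Qed.

Lemma Cmod_minus_triangle (x y z : C) : Cmod (x - z) <= Cmod (x - y) + Cmod (y - z).
Proof. replace (x - z)%C with ((x - y) + (y - z))%C by ring. apply Cmod_triangle. Qed.

Lemma Cmod_minus_le (x y : C) : Cmod (x - y) <= Cmod x + Cmod y.
Proof. rewrite <- (Cmod_opp y). apply Cmod_triangle. Qed.

Lemma Cmod_minus_ge (x y : C) : Cmod x - Cmod y <= Cmod (x - y).
Proof.
  assert (Htri := Cmod_triangle (x - y) y). replace (x - y + y)%C with x in Htri by ring. lra.
Qed.

Lemma Cmod_minus_pos (x y : C) : x <> y -> 0 < Cmod (x - y).
Proof. intros N. apply Cmod_gt_0, Cminus_eq_contra, N. Qed.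

Lemma im_le_Cmod (z : C) : Rabs (Im z) <= Cmod z.
Proof. eapply Rle_trans; [apply Rmax_r | apply (Rmax_Cmod z)]. Qed.

Lemma Cmod_pair_le (a b : R) : Cmod (a, b) <= Rabs a + Rabs b.
Proof.
  replace ((a, b) : C) with (RtoC a + Ci * RtoC b)%C
    by (unfold Cplus, Cmult, Ci, RtoC; simpl; f_equal; ring).
  eapply Rle_trans; [apply Cmod_triangle|]. rewrite Cmod_mult, Cmod_Ci, !Cmod_R. lra.
Qed.

Lemma Cmod_div_le (x y : C) (m d : R) : Cmod x <= m -> 0 < d -> d <= Cmod y ->
  Cmod (x / y) <= m / d.
Proof.
  intros Hx Hd Hy. rewrite Cmod_div by (apply Cmod_gt_0; lra).
  apply Rmult_le_compat; auto using Cmod_ge_0.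
  - left. apply Rinv_0_lt_compat. lra.
  - apply Rinv_le_contravar; auto.
Qed.

Lemma Ceq_of_dist_le_eps (x y : C) : (forall eps, 0 < eps -> Cmod (x - y) <= eps) -> x = y.
Proof.
  intros H. apply Ceq_minus, Cmod_eq_0, Rle_antisym; [|apply Cmod_ge_0].
  apply le_epsilon. intros eps He. rewrite Rplus_0_l. auto.
Qed.

(** * Complex continuity and differentiability *)

Definition ccontinuous (f : C -> C) (z : C) : Prop :=
  @continuous (AbsRing_UniformSpace C_AbsRing) (AbsRing_UniformSpace C_AbsRing) f z.

Definition is_cderive (f : C -> C) (z l : C) : Prop :=
  @is_derive C_AbsRing (AbsRing_NormedModule C_AbsRing) f z l.

Definition cderivable (f : C -> C) (z : C) : Prop := exists l, is_cderive f z l.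

Lemma ccontinuous_eps (f : C -> C) (z : C) :
  ccontinuous f z <-> forall eps, 0 < eps -> exists d, 0 < d /\
    forall y, Cmod (y - z) < d -> Cmod (f y - f z) < eps.
Proof.
  split.
  - intros H eps He. destruct (proj1 (filterlim_locally _ _) H (mkposreal eps He)) as [d Hd].
    exists d. split; [apply cond_pos | exact Hd].
  - intros H. apply filterlim_locally. intros eps.
    destruct (H eps (cond_pos eps)) as (d & Hd & Hfd).
    exists (mkposreal d Hd). exact Hfd.
Qed.

Lemma is_cderive_eps (f : C -> C) (z l : C) :
  is_cderive f z l <-> forall eps, 0 < eps -> exists d, 0 < d /\
    forall y, Cmod (y - z) < d -> Cmod (f y - f z - (y - z) * l) <= eps * Cmod (y - z).
Proof.
  split.
  - intros [_ H] eps He. destruct (H z (fun P h => h) (mkposreal eps He)) as [d Hd].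
    exists d. split; [apply cond_pos | exact Hd].
  - intros H. split; [apply is_linear_scal_l|]. intros x Hx.
    apply (@is_filter_lim_locally_unique C_AbsRing (AbsRing_NormedModule C_AbsRing)) in Hx. subst x.
    intros eps. destruct (H eps (cond_pos eps)) as (d & Hd & Hfd). exists (mkposreal d Hd).
    exact Hfd.
Qed.

(* Coquelicot's [is_derive] depends on the normed structure of the target; its chain and product
   rules are only available for the structure used in [is_cderive]. *)
Lemma ex_derive_cderivable (f : C -> C) (z : C) :
  @ex_derive C_AbsRing C_NormedModule f z <-> cderivable f z.
Proof.
  split; intros [l [_ H]]; exists l; (split; [apply is_linear_scal_l | exact H]).
Qed.

Lemma cderivable_of_quadratic_remainder (f : C -> C) (z l : C) (K d : R) : 0 < d ->
  (forall y, Cmod (y - z) < d ->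
     Cmod (f y - f z - (y - z) * l) <= K * (Cmod (y - z) * Cmod (y - z))) ->
  cderivable f z.
Proof.
  intros Hd H. exists l. apply is_cderive_eps. intros eps He.
  assert (HK := Rabs_pos K). assert (HK' := Rle_abs K).
  exists (Rmin d (eps / (Rabs K + 1))). split; [apply Rmin_pos; auto; apply Rdiv_lt_0_compat; lra|].
  intros y Hy. destruct (Rmin_Rgt_l _ _ _ Hy) as [Hy1 Hy2]. assert (Hpos := Cmod_ge_0 (y - z)).
  eapply Rle_trans; [apply H, Hy1|]. rewrite <- Rmult_assoc. apply Rmult_le_compat_r; auto.
  apply Rle_trans with ((Rabs K + 1) * (eps / (Rabs K + 1))); [|right; field; lra].
  apply Rle_trans with ((Rabs K + 1) * Cmod (y - z)).
  - apply Rmult_le_compat_r; lra.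
  - apply Rmult_le_compat_l; lra.
Qed.

Lemma cderivable_ccontinuous (f : C -> C) (z : C) : cderivable f z -> ccontinuous f z.
Proof. apply (@ex_derive_continuous C_AbsRing (AbsRing_NormedModule C_AbsRing)). Qed.

Lemma cderivable_ext_near (f g : C -> C) (z : C) (r : R) : 0 < r ->
  (forall y, Cmod (y - z) < r -> f y = g y) -> cderivable f z -> cderivable g z.
Proof.
  intros Hr E. apply (@ex_derive_ext_loc C_AbsRing (AbsRing_NormedModule C_AbsRing)).
  exists (mkposreal r Hr). exact E.
Qed.

Lemma cderivable_const (k z : C) : cderivable (fun _ => k) z.
Proof. apply (@ex_derive_const C_AbsRing (AbsRing_NormedModule C_AbsRing)). Qed.

Lemma cderivable_id (z : C) : cderivable (fun y => y) z.
Proof. apply (@ex_derive_id C_AbsRing). Qed.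

Lemma cderivable_plus (f g : C -> C) (z : C) : cderivable f z -> cderivable g z ->
  cderivable (fun y => f y + g y)%C z.
Proof. apply (@ex_derive_plus C_AbsRing (AbsRing_NormedModule C_AbsRing)). Qed.

Lemma cderivable_minus (f g : C -> C) (z : C) : cderivable f z -> cderivable g z ->
  cderivable (fun y => f y - g y)%C z.
Proof. apply (@ex_derive_minus C_AbsRing (AbsRing_NormedModule C_AbsRing)). Qed.

Lemma cderivable_mult (f g : C -> C) (z : C) : cderivable f z -> cderivable g z ->
  cderivable (fun y => f y * g y)%C z.
Proof.
  intros [k Hk] [l Hl]. eexists. apply (@is_derive_mult C_AbsRing f g _ _ _ Hk Hl), Cmult_comm.
Qed.

Lemma cderivable_comp (f g : C -> C) (z : C) : cderivable f (g z) -> cderivable g z ->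
  cderivable (fun y => f (g y)) z.
Proof. apply (@ex_derive_comp C_AbsRing (AbsRing_NormedModule C_AbsRing)). Qed.

Lemma cderivable_inv (z : C) : z <> RtoC 0 -> cderivable Cinv z.
Proof.
  intros Hz. assert (Hm : 0 < Cmod z) by (apply Cmod_gt_0, Hz). set (m := Cmod z) in *.
  apply cderivable_of_quadratic_remainder
    with (l := (- (/ z * / z))%C) (K := / (m / 2) * (/ m * / m)) (d := m / 2); [lra|].
  intros y Hy.
  assert (Hym : m / 2 <= Cmod y).
  { assert (Htri := Cmod_minus_ge z y). rewrite Cmod_minus_comm in Htri. fold m in Htri. lra. }
  assert (Hy0 : y <> RtoC 0) by (apply Cmod_gt_0; lra).
  replace (/ y - / z - (y - z) * - (/ z * / z))%C
    with ((y - z) * (y - z) * (/ y * (/ z * / z)))%C by (field; auto).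
  rewrite !Cmod_mult, !Cmod_inv, Rmult_comm by auto. fold m.
  apply Rmult_le_compat_r; [apply Rmult_le_pos; apply Cmod_ge_0|].
  apply Rmult_le_compat_r; [apply Rmult_le_pos; left; apply Rinv_0_lt_compat; auto|].
  apply Rinv_le_contravar; lra.
Qed.

Lemma cderivable_div (f g : C -> C) (z : C) : cderivable f z -> cderivable g z -> g z <> RtoC 0 ->
  cderivable (fun y => f y / g y)%C z.
Proof.
  intros Hf Hg N. apply cderivable_mult; auto. apply (cderivable_comp Cinv); auto.
  apply cderivable_inv, N.
Qed.

Lemma cderivable_pow (z : C) (n : nat) : cderivable (fun y => y ^ n)%C z.
Proof.
  induction n as [|n IH]; simpl; [apply cderivable_const|].
  apply cderivable_mult; [apply cderivable_id | exact IH].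
Qed.

Lemma ccontinuous_const (k z : C) : ccontinuous (fun _ => k) z.
Proof. apply cderivable_ccontinuous, cderivable_const. Qed.

Lemma ccontinuous_id (z : C) : ccontinuous (fun y => y) z.
Proof. apply cderivable_ccontinuous, cderivable_id. Qed.

Lemma ccontinuous_plus (f g : C -> C) (z : C) : ccontinuous f z -> ccontinuous g z ->
  ccontinuous (fun y => f y + g y)%C z.
Proof.
  apply (@continuous_plus (AbsRing_UniformSpace C_AbsRing) C_AbsRing
    (AbsRing_NormedModule C_AbsRing)).
Qed.

Lemma ccontinuous_minus (f g : C -> C) (z : C) : ccontinuous f z -> ccontinuous g z ->
  ccontinuous (fun y => f y - g y)%C z.
Proof.
  apply (@continuous_minus (AbsRing_UniformSpace C_AbsRing) C_AbsRing
    (AbsRing_NormedModule C_AbsRing)).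
Qed.

Lemma ccontinuous_mult (f g : C -> C) (z : C) : ccontinuous f z -> ccontinuous g z ->
  ccontinuous (fun y => f y * g y)%C z.
Proof. apply (@continuous_mult (AbsRing_UniformSpace C_AbsRing) C_AbsRing). Qed.

Lemma ccontinuous_div (f g : C -> C) (z : C) : ccontinuous f z -> ccontinuous g z ->
  g z <> RtoC 0 -> ccontinuous (fun y => f y / g y)%C z.
Proof.
  intros Hf Hg N. apply ccontinuous_mult; auto.
  apply (@continuous_comp (AbsRing_UniformSpace C_AbsRing) (AbsRing_UniformSpace C_AbsRing)
    (AbsRing_UniformSpace C_AbsRing) g Cinv); auto.
  apply cderivable_ccontinuous, cderivable_inv, N.
Qed.

Definition slope (f : C -> C) (a l z : C) : C :=
  if Ceq_dec z a then l else ((f z - f a) / (z - a))%C.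

Lemma slope_neq (f : C -> C) (a l z : C) : z <> a -> slope f a l z = ((f z - f a) / (z - a))%C.
Proof. intros N. unfold slope. destruct (Ceq_dec z a); [contradiction | reflexivity]. Qed.

Lemma slope_eq (f : C -> C) (a l : C) : slope f a l a = l.
Proof. unfold slope. destruct (Ceq_dec a a) as [_ | N]; [reflexivity | contradiction]. Qed.

Lemma slope_spec (f : C -> C) (a l z : C) : (f z - f a = (z - a) * slope f a l z)%C.
Proof.
  destruct (Ceq_dec z a) as [-> | N]; [ring|].
  rewrite slope_neq by auto. field. apply Cminus_eq_contra, N.
Qed.

Lemma cderivable_slope (f : C -> C) (a l z : C) : cderivable f z -> z <> a ->
  cderivable (slope f a l) z.
Proof.
  intros Hf Hza. apply (cderivable_ext_near (fun y => (f y - f a) / (y - a))%C _ z (Cmod (z - a))).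
  - apply Cmod_minus_pos, Hza.
  - intros y Hy. symmetry. apply slope_neq. intros ->. rewrite Cmod_minus_comm in Hy. lra.
  - apply cderivable_div; [| | apply Cminus_eq_contra, Hza];
      (apply cderivable_minus; [exact Hf || apply cderivable_id | apply cderivable_const]).
Qed.

Lemma ccontinuous_slope (f : C -> C) (a l : C) : is_cderive f a l -> ccontinuous (slope f a l) a.
Proof.
  intros H. apply ccontinuous_eps. intros eps He. rewrite slope_eq.
  destruct (proj1 (is_cderive_eps f a l) H (eps / 2)) as (d & Hd & Hfd); [lra|].
  exists d. split; auto. intros y Hy.
  destruct (Ceq_dec y a) as [-> | N]; [rewrite slope_eq, Cmod_minus_diag; exact He|].
  rewrite slope_neq by auto. assert (N' := Cminus_eq_contra _ _ N).
  assert (Hpos := Cmod_minus_pos _ _ N).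
  replace ((f y - f a) / (y - a) - l)%C with ((f y - f a - (y - a) * l) / (y - a))%C
    by (field; auto).
  apply Rle_lt_trans with (eps / 2 * Cmod (y - a) / Cmod (y - a)).
  - apply Cmod_div_le; [apply Hfd, Hy | exact Hpos | lra].
  - replace (eps / 2 * Cmod (y - a) / Cmod (y - a)) with (eps / 2) by (field; lra). lra.
Qed.

Lemma is_cderive_cauchy_riemann (u v : R -> R -> R) (x y a b : R) :
  differentiable_pt_lim u x y a (- b) -> differentiable_pt_lim v x y b a ->
  is_cderive (fun z => (u (Re z) (Im z), v (Re z) (Im z))) (x, y) (a, b).
Proof.
  intros Hu Hv. apply is_cderive_eps. intros eps He. assert (He2 : 0 < eps / 2) by lra.
  destruct (Hu (mkposreal _ He2)) as [d1 Hd1]. destruct (Hv (mkposreal _ He2)) as [d2 Hd2].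
  exists (Rmin d1 d2). split; [apply Rmin_pos; apply cond_pos|]. intros [x' y'] Hz.
  destruct (Rmin_Rgt_l _ _ _ Hz) as [Hz1 Hz2].
  assert (Hmax := Rmax_Cmod ((x', y') - (x, y))%C). cbn -[Cmod Rmax] in Hmax.
  fold (x' - x) (y' - y) in Hmax.
  assert (Hx := Rmax_l (Rabs (x' - x)) (Rabs (y' - y))).
  assert (Hy := Rmax_r (Rabs (x' - x)) (Rabs (y' - y))).
  specialize (Hd1 x' y' ltac:(lra) ltac:(lra)). specialize (Hd2 x' y' ltac:(lra) ltac:(lra)).
  simpl pos in Hd1, Hd2. cbn -[Cmod Rmax Rminus Rplus Rmult].
  replace ((u x' y', v x' y') - (u x y, v x y) - ((x', y') - (x, y)) * (a, b))%C
    with ((u x' y' - u x y - (a * (x' - x) + - b * (y' - y)),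
           v x' y' - v x y - (b * (x' - x) + a * (y' - y))) : C)
    by (unfold Cminus, Cplus, Copp, Cmult; simpl; f_equal; ring).
  eapply Rle_trans; [apply Cmod_pair_le|].
  assert (eps / 2 * Rmax (Rabs (x' - x)) (Rabs (y' - y)) <= eps / 2 * Cmod ((x', y') - (x, y)))
    by (apply Rmult_le_compat_l; lra).
  lra.
Qed.

Definition cexp (z : C) : C := (exp (Re z) * cos (Im z), exp (Re z) * sin (Im z)).

Lemma differentiable_pt_lim_exp_mult (g : R -> R) (x y l : R) : is_derive g y l ->
  differentiable_pt_lim (fun u v => exp u * g v) x y (exp x * g y) (exp x * l).
Proof.
  intros Hg. apply filterdiff_differentiable_pt_lim.
  apply (is_derive_filterdiff (fun u v => exp u * g v) x y (fun u v => exp u * g v)).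
  - apply filter_forall. intros u. auto_derive; auto. ring.
  - apply is_derive_scal, Hg.
  - apply (@continuous_mult _ R_AbsRing).
    + apply (continuous_comp fst exp); [apply continuous_fst | apply continuous_exp].
    + apply (continuous_comp snd g); [apply continuous_snd|]. apply (ex_derive_continuous g).
      exists l. exact Hg.
Qed.

Lemma is_cderive_cexp (z : C) : is_cderive cexp z (cexp z).
Proof.
  destruct z as [x y].
  apply (is_cderive_cauchy_riemann (fun u v => exp u * cos v) (fun u v => exp u * sin v));
    simpl; [rewrite Ropp_mult_distr_r|]; apply differentiable_pt_lim_exp_mult.
  - auto_derive; auto. ring.
  - auto_derive; auto. ring.
Qed.

(** * Integrals of complex-valued functions of a real variable *)

Notation Cint := (@RInt C_R_CompleteNormedModule).
Notation is_Cint := (@is_RInt C_R_NormedModule).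

Definition path_continuous (G : R -> C) (t : R) : Prop :=
  @continuous R_UniformSpace (AbsRing_UniformSpace C_AbsRing) G t.

Definition path_continuous_on (G : R -> C) (a b : R) : Prop :=
  forall t, a <= t <= b -> path_continuous G t.

Lemma path_continuous_eps (G : R -> C) (t : R) :
  path_continuous G t <-> forall eps, 0 < eps -> exists d, 0 < d /\
    forall s, Rabs (s - t) < d -> Cmod (G s - G t) < eps.
Proof.
  split.
  - intros H eps He. destruct (proj1 (filterlim_locally _ _) H (mkposreal eps He)) as [d Hd].
    exists d. split; [apply cond_pos | exact Hd].
  - intros H. apply filterlim_locally. intros eps.
    destruct (H eps (cond_pos eps)) as (d & Hd & Hfd).
    exists (mkposreal d Hd). exact Hfd.
Qed.

Lemma path_continuous_comp (f : C -> C) (G : R -> C) (t : R) :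
  path_continuous G t -> ccontinuous f (G t) -> path_continuous (fun s => f (G s)) t.
Proof.
  apply (@continuous_comp R_UniformSpace (AbsRing_UniformSpace C_AbsRing)
    (AbsRing_UniformSpace C_AbsRing)).
Qed.

Lemma path_continuous_minus (F G : R -> C) (t : R) : path_continuous F t -> path_continuous G t ->
  path_continuous (fun s => F s - G s)%C t.
Proof. apply (@continuous_minus R_UniformSpace C_AbsRing (AbsRing_NormedModule C_AbsRing)). Qed.

Lemma is_Cint_path_continuous (G : R -> C) (a b : R) : a <= b -> path_continuous_on G a b ->
  is_Cint G a b (Cint G a b).
Proof.
  intros Hab H. apply (@RInt_correct C_R_CompleteNormedModule), ex_RInt_continuous.
  rewrite Rmin_left, Rmax_right by auto. intros t Ht P HP. apply (H t Ht), locally_C, HP.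
Qed.

Lemma is_Cint_mult (k : C) (G : R -> C) (a b : R) (I : C) :
  is_Cint G a b I -> is_Cint (fun t => k * G t)%C a b (k * I)%C.
Proof.
  intros H.
  assert (HRe := is_RInt_fct_extend_fst _ _ _ _ H).
  assert (HIm := is_RInt_fct_extend_snd _ _ _ _ H).
  apply is_RInt_fct_extend_pair; simpl.
  - apply (@is_RInt_minus R_NormedModule); apply (@is_RInt_scal R_NormedModule); assumption.
  - apply (@is_RInt_plus R_NormedModule); apply (@is_RInt_scal R_NormedModule); assumption.
Qed.

Lemma Cint_minus (F G : R -> C) (a b : R) : a <= b -> path_continuous_on F a b ->
  path_continuous_on G a b -> Cint (fun t => F t - G t)%C a b = (Cint F a b - Cint G a b)%C.
Proof.
  intros Hab HF HG. apply (@is_RInt_unique C_R_CompleteNormedModule).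
  apply (@is_RInt_minus C_R_NormedModule); apply is_Cint_path_continuous; auto.
Qed.

Lemma Cint_scal (k : C) (G : R -> C) (a b : R) : a <= b -> path_continuous_on G a b ->
  Cint (fun t => k * G t)%C a b = (k * Cint G a b)%C.
Proof.
  intros Hab HG.
  apply (@is_RInt_unique C_R_CompleteNormedModule), is_Cint_mult, is_Cint_path_continuous; auto.
Qed.

Lemma Cint_Chasles (G : R -> C) (a b c : R) : a <= b -> b <= c -> path_continuous_on G a c ->
  (Cint G a b + Cint G b c)%C = Cint G a c.
Proof.
  intros Hab Hbc HG. symmetry. apply (@is_RInt_unique C_R_CompleteNormedModule).
  apply (@is_RInt_Chasles C_R_NormedModule) with b; apply is_Cint_path_continuous; auto;
    intros t Ht; apply HG; lra.
Qed.

Lemma Cint_ext (F G : R -> C) (a b : R) : a <= b -> (forall t, a <= t <= b -> F t = G t) ->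
  Cint F a b = Cint G a b.
Proof.
  intros Hab E. apply RInt_ext. rewrite Rmin_left, Rmax_right by auto. intros t Ht. apply E. lra.
Qed.

Lemma Cint_const (k : C) (a b : R) : Cint (fun _ => k) a b = (RtoC (b - a) * k)%C.
Proof. rewrite RInt_const. apply scal_R_Cmult. Qed.

Lemma Cmod_Cint_le (G : R -> C) (a b m : R) : a <= b -> path_continuous_on G a b ->
  (forall t, a <= t <= b -> Cmod (G t) <= m) -> Cmod (Cint G a b) <= (b - a) * m.
Proof.
  intros Hab HG Hm. rewrite Cmod_norm. apply (norm_RInt_le_const G a b _ m Hab).
  - intros t Ht. rewrite <- Cmod_norm. apply Hm, Ht.
  - apply is_Cint_path_continuous; auto.
Qed.

(** * Goursat's lemma for rectangles *)

Definition rect_Cint (F : C -> C) (a b c d : R) : C :=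
  (Cint (fun x => F (x, c)) a b - Cint (fun x => F (x, d)) a b
   + Ci * (Cint (fun y => F (b, y)) c d - Cint (fun y => F (a, y)) c d))%C.

Definition ccontinuous_on_rect (F : C -> C) (a b c d : R) : Prop :=
  forall x y, a <= x <= b -> c <= y <= d -> ccontinuous F (x, y).

Lemma ccontinuous_horizontal (F : C -> C) (x y : R) :
  ccontinuous F (x, y) -> path_continuous (fun s => F (s, y)) x.
Proof.
  intros H. apply (path_continuous_comp F (fun s => (s, y))); auto.
  apply path_continuous_eps. intros eps He. exists eps. split; auto. intros s Hs.
  replace ((s, y) - (x, y))%C with (RtoC (s - x))
    by (unfold Cminus, Cplus, Copp, RtoC; simpl; f_equal; ring).
  rewrite Cmod_R. exact Hs.
Qed.

Lemma ccontinuous_vertical (F : C -> C) (x y : R) :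
  ccontinuous F (x, y) -> path_continuous (fun s => F (x, s)) y.
Proof.
  intros H. apply (path_continuous_comp F (fun s => (x, s))); auto.
  apply path_continuous_eps. intros eps He. exists eps. split; auto. intros s Hs.
  replace ((x, s) - (x, y))%C with (Ci * RtoC (s - y))%C
    by (unfold Cminus, Cplus, Copp, Cmult, Ci, RtoC; simpl; f_equal; ring).
  rewrite Cmod_mult, Cmod_Ci, Cmod_R. lra.
Qed.

Lemma Cmod_rect_Cint_le (F : C -> C) (a b c d m : R) : a <= b -> c <= d ->
  ccontinuous_on_rect F a b c d ->
  (forall x y, a <= x <= b -> c <= y <= d -> Cmod (F (x, y)) <= m) ->
  Cmod (rect_Cint F a b c d) <= 2 * m * ((b - a) + (d - c)).
Proof.
  intros Hab Hcd HC Hm. unfold rect_Cint.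
  assert (Hhor : forall y, c <= y <= d -> Cmod (Cint (fun x => F (x, y)) a b) <= (b - a) * m).
  { intros y Hy. apply Cmod_Cint_le; auto. intros t Ht. apply ccontinuous_horizontal, HC; auto. }
  assert (Hver : forall x, a <= x <= b -> Cmod (Cint (fun y => F (x, y)) c d) <= (d - c) * m).
  { intros x Hx. apply Cmod_Cint_le; auto. intros t Ht. apply ccontinuous_vertical, HC; auto. }
  eapply Rle_trans; [apply Cmod_triangle|]. rewrite Cmod_mult, Cmod_Ci.
  assert (Hhoriz := Cmod_minus_le (Cint (fun x => F (x, c)) a b) (Cint (fun x => F (x, d)) a b)).
  assert (Hvert := Cmod_minus_le (Cint (fun y => F (b, y)) c d) (Cint (fun y => F (a, y)) c d)).
  assert (Hc := Hhor c ltac:(lra)). assert (Hd := Hhor d ltac:(lra)).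
  assert (Hb := Hver b ltac:(lra)). assert (Ha := Hver a ltac:(lra)). lra.
Qed.

Lemma rect_Cint_minus (F G : C -> C) (a b c d : R) : a <= b -> c <= d ->
  ccontinuous_on_rect F a b c d -> ccontinuous_on_rect G a b c d ->
  rect_Cint (fun z => F z - G z)%C a b c d = (rect_Cint F a b c d - rect_Cint G a b c d)%C.
Proof.
  intros Hab Hcd HF HG. unfold rect_Cint.
  assert (Hhor : forall y, c <= y <= d -> Cint (fun x => F (x, y) - G (x, y))%C a b =
      (Cint (fun x => F (x, y)) a b - Cint (fun x => G (x, y)) a b)%C).
  { intros y Hy.
    apply Cint_minus; auto; intros t Ht; apply ccontinuous_horizontal; [apply HF | apply HG]; auto. }
  assert (Hver : forall x, a <= x <= b -> Cint (fun y => F (x, y) - G (x, y))%C c d =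
      (Cint (fun y => F (x, y)) c d - Cint (fun y => G (x, y)) c d)%C).
  { intros x Hx.
    apply Cint_minus; auto; intros t Ht; apply ccontinuous_vertical; [apply HF | apply HG]; auto. }
  rewrite (Hhor c), (Hhor d), (Hver b), (Hver a) by lra. ring.
Qed.

Lemma rect_Cint_split_x (F : C -> C) (a m b c d : R) : a <= m <= b -> c <= d ->
  ccontinuous_on_rect F a b c d ->
  rect_Cint F a b c d = (rect_Cint F a m c d + rect_Cint F m b c d)%C.
Proof.
  intros Hm Hcd HC. unfold rect_Cint.
  rewrite <- !(Cint_Chasles (fun x => F (x, _)) a m b); try lra;
    try (intros t Ht; apply ccontinuous_horizontal, HC; lra).
  ring.
Qed.

Lemma rect_Cint_split_y (F : C -> C) (a b c m d : R) : a <= b -> c <= m <= d ->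
  ccontinuous_on_rect F a b c d ->
  rect_Cint F a b c d = (rect_Cint F a b c m + rect_Cint F a b m d)%C.
Proof.
  intros Hab Hm HC. unfold rect_Cint.
  rewrite <- !(Cint_Chasles (fun y => F (_, y)) c m d); try lra;
    try (intros t Ht; apply ccontinuous_vertical, HC; lra).
  ring.
Qed.

Lemma is_RInt_id (a b : R) : is_RInt (fun t => t) a b ((b * b - a * a) / 2).
Proof.
  replace ((b * b - a * a) / 2) with (minus (b * b / 2) (a * a / 2))
    by (unfold minus, plus, opp; simpl; field).
  apply (is_RInt_derive (fun t => t * t / 2) (fun t => t)); intros t _.
  - auto_derive; auto. field.
  - apply continuous_id.
Qed.

Lemma Cint_affine_horizontal (k l : C) (a b y : R) :
  Cint (fun x => k + l * (x, y))%C a b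
    = (RtoC (b - a) * k + l * ((b * b - a * a) / 2, (b - a) * y)%R)%C.
Proof.
  apply (@is_RInt_unique C_R_CompleteNormedModule).
  apply (@is_RInt_plus C_R_NormedModule (fun _ => k) (fun x => l * (x, y))%C).
  - rewrite <- scal_R_Cmult. apply (@is_RInt_const C_R_NormedModule).
  - apply is_Cint_mult, is_RInt_fct_extend_pair;
      [apply is_RInt_id | apply (@is_RInt_const R_NormedModule)].
Qed.

Lemma Cint_affine_vertical (k l : C) (c d x : R) :
  Cint (fun y => k + l * (x, y))%C c d
    = (RtoC (d - c) * k + l * ((d - c) * x, (d * d - c * c) / 2)%R)%C.
Proof.
  apply (@is_RInt_unique C_R_CompleteNormedModule).
  apply (@is_RInt_plus C_R_NormedModule (fun _ => k) (fun y => l * (x, y))%C).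
  - rewrite <- scal_R_Cmult. apply (@is_RInt_const C_R_NormedModule).
  - apply is_Cint_mult, is_RInt_fct_extend_pair;
      [apply (@is_RInt_const R_NormedModule) | apply is_RInt_id].
Qed.

Lemma rect_Cint_affine (k l : C) (a b c d : R) : rect_Cint (fun z => k + l * z)%C a b c d = RtoC 0.
Proof.
  unfold rect_Cint. rewrite !Cint_affine_horizontal, !Cint_affine_vertical.
  destruct k as [k1 k2], l as [l1 l2].
  unfold Cminus, Copp, Cmult, Cplus, Ci, RtoC; simpl. f_equal; field.
Qed.

Lemma nested_intervals_point (a w : nat -> R) :
  (forall n, a n <= a (S n)) -> (forall n, a (S n) + w (S n) <= a n + w n) -> is_lim_seq w 0 ->
  exists x, forall n, a n <= x <= a n + w n.
Proof.
  intros Ha Hb Hw.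
  destruct (ex_lim_seq_adj a (fun n => a n + w n)) as (Ca & Cb & E); auto.
  { apply (is_lim_seq_ext w); [intros n; ring | exact Hw]. }
  exists (real (Lim_seq a)). intros n. split.
  - apply (is_lim_seq_incr_compare a); [apply Lim_seq_correct'; exact Ca | exact Ha].
  - rewrite E.
    apply (is_lim_seq_decr_compare (fun n => a n + w n));
      [apply Lim_seq_correct'; exact Cb | exact Hb].
Qed.

Lemma dependent_sequence (X : Type) (Q : nat -> X -> Prop) (Step : nat -> X -> X -> Prop) (x0 : X) :
  Q 0%nat x0 -> (forall n x, Q n x -> exists y, Step n x y /\ Q (S n) y) ->
  exists s, s 0%nat = x0 /\ forall n, Q n (s n) /\ Step n (s n) (s (S n)).
Proof.
  intros H0 HS.
  set (s := nat_rect (fun _ => X) x0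
    (fun n x => epsilon (inhabits x) (fun y => Step n x y /\ Q (S n) y))).
  assert (Hs : forall n, Q n (s n) -> Step n (s n) (s (S n)) /\ Q (S n) (s (S n)))
    by (intros n Hn; exact (epsilon_spec (inhabits (s n)) _ (HS n (s n) Hn))).
  assert (HQ : forall n, Q n (s n)) by (induction n as [|n IH]; [exact H0 | apply Hs, IH]).
  exists s. split; [reflexivity|]. intros n. split; [apply HQ | apply Hs, HQ].
Qed.

Lemma half_pow_pos (n : nat) : 0 < (/ 2) ^ n.
Proof. apply pow_lt. lra. Qed.

Lemma half_pow_antitone (m n : nat) : (m <= n)%nat -> (/ 2) ^ n <= (/ 2) ^ m.
Proof.
  intros H. rewrite !pow_inv.
  apply Rinv_le_contravar; [apply pow_lt; lra | apply Rle_pow; [lra | exact H]].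
Qed.

Lemma half_pow_eventually_lt (eps : R) : 0 < eps -> exists N, forall n, (N <= n)%nat ->
  (/ 2) ^ n < eps.
Proof.
  intros He.
  destruct (pow_lt_1_zero (/ 2)) with (y := eps) as [N HN]; [rewrite Rabs_pos_eq; lra | exact He |].
  exists N. intros n Hn. eapply Rle_lt_trans; [apply Rle_abs | apply HN, Hn].
Qed.

Lemma is_lim_seq_half_pow_mult (k : R) : is_lim_seq (fun n => (/ 2) ^ n * k) 0.
Proof.
  replace (Finite 0) with (Rbar_mult 0 k) by (simpl; f_equal; ring).
  apply is_lim_seq_scal_r, is_lim_seq_geom. rewrite Rabs_pos_eq; lra.
Qed.

(* [P x y h] stands for a property of the rectangle [x, x + h A] * [y, y + h B]. *)
Lemma rectangle_bisection (A B a c : R) (P : R -> R -> R -> Prop) : 0 <= A -> 0 <= B ->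
  (forall x y h, 0 < h -> P x y (h / 2) -> P (x + h / 2 * A) y (h / 2) ->
     P x (y + h / 2 * B) (h / 2) -> P (x + h / 2 * A) (y + h / 2 * B) (h / 2) -> P x y h) ->
  (forall u v, a <= u <= a + A -> c <= v <= c + B -> exists d, 0 < d /\
     forall x y h, 0 < h < d -> x <= u <= x + h * A -> y <= v <= y + h * B -> P x y h) ->
  P a c 1.
Proof.
  intros HA HB Hsplit Hloc. apply NNPP. intros HN.
  set (h := fun n => (/ 2) ^ n).
  assert (Hh : forall n, 0 < h n) by (intros n; apply half_pow_pos).
  assert (HhS : forall n, h (S n) = h n / 2) by (intros n; unfold h; simpl; field).
  set (half := fun (w k x x' : R) => x <= x' /\ x' + k / 2 * w <= x + k * w).
  destruct (dependent_sequence (R * R) (fun n r => ~ P (fst r) (snd r) (h n))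
      (fun n r r' => half A (h n) (fst r) (fst r') /\ half B (h n) (snd r) (snd r')) (a, c))
    as (s & Hs0 & Hs); [exact HN | |].
  { intros n [x y] NP; simpl in NP. rewrite HhS. apply NNPP. intros Hall. apply NP.
    specialize (Hh n).
    assert (PA : 0 <= h n / 2 * A) by (apply Rmult_le_pos; lra).
    assert (PB : 0 <= h n / 2 * B) by (apply Rmult_le_pos; lra).
    apply Hsplit; auto; apply NNPP; intros NQ; apply Hall.
    - exists (x, y). unfold half; simpl. repeat split; auto; lra.
    - exists (x + h n / 2 * A, y). unfold half; simpl. repeat split; auto; lra.
    - exists (x, y + h n / 2 * B). unfold half; simpl. repeat split; auto; lra.
    - exists (x + h n / 2 * A, y + h n / 2 * B). unfold half; simpl. repeat split; auto; lra. }
  destruct (nested_intervals_point (fun n => fst (s n)) (fun n => h n * A)) as [u Hu];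
    [apply Hs | intros n; rewrite HhS; apply Hs | apply is_lim_seq_half_pow_mult |].
  destruct (nested_intervals_point (fun n => snd (s n)) (fun n => h n * B)) as [v Hv];
    [apply Hs | intros n; rewrite HhS; apply Hs | apply is_lim_seq_half_pow_mult |].
  assert (Hu0 := Hu 0%nat). assert (Hv0 := Hv 0%nat). rewrite Hs0 in Hu0, Hv0.
  unfold h in Hu0, Hv0; simpl in Hu0, Hv0.
  destruct (Hloc u v ltac:(lra) ltac:(lra)) as (d & Hd & HPd).
  destruct (half_pow_eventually_lt d Hd) as [N HdN].
  apply (Hs N), HPd; auto.
Qed.

Lemma rect_Cint_quarters_le (F : C -> C) (a m b c n d q : R) : a <= m <= b -> c <= n <= d ->
  ccontinuous_on_rect F a b c d ->
  Cmod (rect_Cint F a m c n) <= q -> Cmod (rect_Cint F m b c n) <= q ->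
  Cmod (rect_Cint F a m n d) <= q -> Cmod (rect_Cint F m b n d) <= q ->
  Cmod (rect_Cint F a b c d) <= 4 * q.
Proof.
  intros Hm Hn HC Hll Hlr Hul Hur.
  rewrite (rect_Cint_split_x F a m) by (auto; lra).
  rewrite (rect_Cint_split_y F a m c n), (rect_Cint_split_y F m b c n)
    by (try lra; intros x y Hx Hy; apply HC; lra).
  assert (Hleft := Cmod_triangle (rect_Cint F a m c n) (rect_Cint F a m n d)).
  assert (Hright := Cmod_triangle (rect_Cint F m b c n) (rect_Cint F m b n d)).
  eapply Rle_trans; [apply Cmod_triangle | lra].
Qed.

Lemma rect_Cint_near_cderivable (F : C -> C) (A B u v eps : R) :
  0 <= A -> 0 <= B -> 0 < eps -> cderivable F (u, v) ->
  exists d, 0 < d /\ forall x y h, 0 < h < d -> x <= u <= x + h * A -> y <= v <= y + h * B ->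
    ccontinuous_on_rect F x (x + h * A) y (y + h * B) ->
    Cmod (rect_Cint F x (x + h * A) y (y + h * B)) <= eps * (h * h).
Proof.
  intros HA HB He [l Hl]. set (S := 1 + A + B). set (e := eps / (2 * S * S)).
  assert (HS : 0 < 2 * S * S) by (unfold S; repeat apply Rmult_lt_0_compat; lra).
  assert (He' : 0 < e) by (apply Rdiv_lt_0_compat; auto).
  destruct (proj1 (is_cderive_eps _ _ _) Hl e He') as (d & Hd & HF).
  exists (d / S). split; [apply Rdiv_lt_0_compat; unfold S; lra|].
  intros x y h [Hh Hhd] Hu Hv HC.
  assert (Hsmall : h * S < d).
  { apply Rlt_le_trans with (d / S * S);
      [apply Rmult_lt_compat_r; unfold S in *; lra | right; field; unfold S; lra]. }
  set (G := fun z => (F (u, v) - l * (u, v) + l * z)%C).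
  assert (HG : ccontinuous_on_rect G x (x + h * A) y (y + h * B)).
  { intros x' y' _ _. apply ccontinuous_plus; [apply ccontinuous_const|].
    apply ccontinuous_mult; [apply ccontinuous_const | apply ccontinuous_id]. }
  replace (rect_Cint F x (x + h * A) y (y + h * B))
    with (rect_Cint (fun z => F z - G z)%C x (x + h * A) y (y + h * B))
    by (unfold G; rewrite rect_Cint_minus, rect_Cint_affine by (auto; lra); ring).
  eapply Rle_trans; [apply Cmod_rect_Cint_le with (m := e * (h * A + h * B)); try lra|].
  - intros x' y' Hx' Hy'. apply ccontinuous_minus; [apply HC | apply HG]; auto.
  - intros x' y' Hx' Hy'.
    assert (Hdist : Cmod ((x', y') - (u, v)) <= h * A + h * B).
    { eapply Rle_trans; [apply Cmod_pair_le|]. simpl.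
      apply Rplus_le_compat; apply Rabs_le; lra. }
    replace (F (x', y') - G (x', y'))%C with (F (x', y') - F (u, v) - ((x', y') - (u, v)) * l)%C
      by (unfold G; ring).
    eapply Rle_trans; [apply HF; unfold S in Hsmall; lra | apply Rmult_le_compat_l; lra].
  - replace (2 * (e * (h * A + h * B)) * (x + h * A - x + (y + h * B - y)))
      with (2 * e * (A + B) * (A + B) * (h * h)) by ring.
    replace eps with (2 * e * S * S) at 1 by (unfold e; field; unfold S; lra).
    assert (0 <= (A + B)) by lra.
    apply Rmult_le_compat_r; [apply Rle_0_sqr|].
    apply Rmult_le_compat; try apply Rmult_le_pos; try apply Rmult_le_compat; unfold S; lra.
Qed.

Lemma goursat (F : C -> C) (a b c d : R) : a <= b -> c <= d ->
  (forall x y, a <= x <= b -> c <= y <= d -> cderivable F (x, y)) ->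
  rect_Cint F a b c d = RtoC 0.
Proof.
  intros Hab Hcd HD.
  assert (HC : ccontinuous_on_rect F a b c d)
    by (intros x y Hx Hy; apply cderivable_ccontinuous, HD; auto).
  apply Ceq_of_dist_le_eps. intros eps He. rewrite Cmod_minus_0_r.
  set (A := b - a). set (B := d - c).
  assert (Bis := rectangle_bisection A B a c (fun x y h =>
    ccontinuous_on_rect F x (x + h * A) y (y + h * B) ->
    Cmod (rect_Cint F x (x + h * A) y (y + h * B)) <= eps * (h * h))
    ltac:(unfold A; lra) ltac:(unfold B; lra)).
  cbv beta in Bis. replace (a + 1 * A) with b in Bis by (unfold A; ring).
  replace (c + 1 * B) with d in Bis by (unfold B; ring).
  replace (eps * (1 * 1)) with eps in Bis by ring.
  apply Bis; auto; clear Bis.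
  - intros x y h Hh Hll Hlr Hul Hur Hcont.
    assert (PA : 0 <= h / 2 * A) by (apply Rmult_le_pos; unfold A; lra).
    assert (PB : 0 <= h / 2 * B) by (apply Rmult_le_pos; unfold B; lra).
    replace (x + h / 2 * A + h / 2 * A) with (x + h * A) in Hlr, Hur by field.
    replace (y + h / 2 * B + h / 2 * B) with (y + h * B) in Hul, Hur by field.
    replace (eps * (h * h)) with (4 * (eps * (h / 2 * (h / 2)))) by field.
    apply (rect_Cint_quarters_le F _ (x + h / 2 * A) _ _ (y + h / 2 * B));
      [lra | lra | exact Hcont | apply Hll | apply Hlr | apply Hul | apply Hur];
      intros u v Hu Hv; apply Hcont; lra.
  - intros u v Hu Hv.
    destruct (rect_Cint_near_cderivable F A B u v eps) as (e & He' & H); try (unfold A, B; lra).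
    { apply HD; unfold A, B in *; lra. }
    exists e. split; auto.
Qed.

(** * Means over circles centred at the origin *)

Definition circle (r t : R) : C := (r * cos t, r * sin t).

Lemma Cmod_circle (r t : R) : 0 <= r -> Cmod (circle r t) = r.
Proof.
  intros Hr. unfold Cmod, circle; simpl.
  replace (r * cos t * (r * cos t * 1) + r * sin t * (r * sin t * 1))
    with (r * r * (Rsqr (sin t) + Rsqr (cos t))) by (unfold Rsqr; ring).
  rewrite sin2_cos2, Rmult_1_r. apply sqrt_square, Hr.
Qed.

Lemma Cmod_circle_minus_radius (r s t : R) : Cmod (circle r t - circle s t) = Rabs (r - s).
Proof.
  replace (circle r t - circle s t)%C with (RtoC (r - s) * circle 1 t)%C
    by (unfold circle, Cminus, Cplus, Copp, Cmult, RtoC; simpl; f_equal; ring).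
  rewrite Cmod_mult, Cmod_R, Cmod_circle by lra. ring.
Qed.

Lemma cexp_ln (r t : R) : 0 < r -> cexp (ln r, t) = circle r t.
Proof. intros Hr. unfold cexp; simpl. rewrite exp_ln by auto. reflexivity. Qed.

Lemma path_continuous_circle (r t : R) : path_continuous (circle r) t.
Proof.
  apply path_continuous_eps. intros eps He.
  assert (Hc : continuous (fun s => r * cos s) t)
    by (apply (ex_derive_continuous (fun s => r * cos s)); auto_derive; auto).
  assert (Hs : continuous (fun s => r * sin s) t)
    by (apply (ex_derive_continuous (fun s => r * sin s)); auto_derive; auto).
  assert (He2 : 0 < eps / 2) by lra.
  destruct (proj1 (filterlim_locally _ _) Hc (mkposreal _ He2)) as [d1 Hd1].
  destruct (proj1 (filterlim_locally _ _) Hs (mkposreal _ He2)) as [d2 Hd2].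
  exists (Rmin d1 d2). split; [apply Rmin_pos; apply cond_pos|]. intros s Hst.
  destruct (Rmin_Rgt_l _ _ _ Hst) as [Hst1 Hst2]. specialize (Hd1 s Hst1). specialize (Hd2 s Hst2).
  eapply Rle_lt_trans; [apply Cmod_pair_le|].
  replace eps with (eps / 2 + eps / 2) by field. exact (Rplus_lt_compat _ _ _ _ Hd1 Hd2).
Qed.

Definition circle_mean (f : C -> C) (r : R) : C :=
  (/ RtoC (2 * PI) * Cint (fun t => f (circle r t)) 0 (2 * PI))%C.

Definition ccontinuous_on_circle (f : C -> C) (r : R) : Prop :=
  forall z, Cmod z = r -> ccontinuous f z.

Lemma ccontinuous_on_circle_path (f : C -> C) (r a b : R) : 0 <= r -> ccontinuous_on_circle f r ->
  path_continuous_on (fun t => f (circle r t)) a b.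
Proof.
  intros Hr Hf t _.
  apply path_continuous_comp; [apply path_continuous_circle | apply Hf, Cmod_circle, Hr].
Qed.

Lemma two_PI_neq_0 : RtoC (2 * PI) <> RtoC 0.
Proof. intros E. apply RtoC_inj in E. assert (HPI := PI_RGT_0). lra. Qed.

Lemma circle_mean_ext (f g : C -> C) (r : R) : 0 <= r -> (forall z, Cmod z = r -> f z = g z) ->
  circle_mean f r = circle_mean g r.
Proof.
  intros Hr E. assert (HPI := PI_RGT_0). unfold circle_mean. f_equal. apply Cint_ext; [lra|].
  intros t _. apply E, Cmod_circle, Hr.
Qed.

Lemma circle_mean_const (k : C) (r : R) : circle_mean (fun _ => k) r = k.
Proof.
  unfold circle_mean. rewrite Cint_const, Rminus_0_r. field. apply two_PI_neq_0.
Qed.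

Lemma circle_mean_minus (f g : C -> C) (r : R) : 0 <= r ->
  ccontinuous_on_circle f r -> ccontinuous_on_circle g r ->
  circle_mean (fun z => f z - g z)%C r = (circle_mean f r - circle_mean g r)%C.
Proof.
  intros Hr Hf Hg. assert (HPI := PI_RGT_0). unfold circle_mean.
  rewrite Cint_minus by (lra || (apply ccontinuous_on_circle_path; auto)). ring.
Qed.

Lemma circle_mean_scal (k : C) (f : C -> C) (r : R) : 0 <= r -> ccontinuous_on_circle f r ->
  circle_mean (fun z => k * f z)%C r = (k * circle_mean f r)%C.
Proof.
  intros Hr Hf. assert (HPI := PI_RGT_0). unfold circle_mean.
  rewrite Cint_scal by (lra || (apply ccontinuous_on_circle_path; auto)). ring.
Qed.

Lemma circle_mean_plus (f g : C -> C) (r : R) : 0 <= r ->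
  ccontinuous_on_circle f r -> ccontinuous_on_circle g r ->
  circle_mean (fun z => f z + g z)%C r = (circle_mean f r + circle_mean g r)%C.
Proof.
  intros Hr Hf Hg.
  assert (Hg' : ccontinuous_on_circle (fun z => - RtoC 1 * g z)%C r)
    by (intros z Hz; apply ccontinuous_mult; [apply ccontinuous_const | apply Hg, Hz]).
  transitivity (circle_mean (fun z => f z - - RtoC 1 * g z)%C r).
  - apply circle_mean_ext; auto. intros z _. ring.
  - rewrite circle_mean_minus, circle_mean_scal by auto. ring.
Qed.

Lemma circle_mean_dist_le (f g : C -> C) (r s m : R) : 0 <= r -> 0 <= s ->
  ccontinuous_on_circle f r -> ccontinuous_on_circle g s ->
  (forall t, 0 <= t <= 2 * PI -> Cmod (f (circle r t) - g (circle s t)) <= m) ->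
  Cmod (circle_mean f r - circle_mean g s) <= m.
Proof.
  intros Hr Hs Hf Hg Hm. assert (HPI := PI_RGT_0).
  assert (Pf := ccontinuous_on_circle_path f r 0 (2 * PI) Hr Hf).
  assert (Pg := ccontinuous_on_circle_path g s 0 (2 * PI) Hs Hg).
  replace (circle_mean f r - circle_mean g s)%C
    with (/ RtoC (2 * PI) * Cint (fun t => f (circle r t) - g (circle s t)) 0 (2 * PI))%C
    by (rewrite Cint_minus by (auto; lra); unfold circle_mean; ring).
  rewrite Cmod_mult, Cmod_inv, Cmod_R, Rabs_pos_eq by (apply two_PI_neq_0 || lra).
  replace m with (/ (2 * PI) * ((2 * PI - 0) * m)) by (field; lra).
  apply Rmult_le_compat_l; [left; apply Rinv_0_lt_compat; lra|].
  apply Cmod_Cint_le; auto; [lra|]. intros t Ht. apply path_continuous_minus; auto.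
Qed.

Lemma Cmod_circle_mean_le (f : C -> C) (r m : R) : 0 <= r -> ccontinuous_on_circle f r ->
  (forall t, 0 <= t <= 2 * PI -> Cmod (f (circle r t)) <= m) -> Cmod (circle_mean f r) <= m.
Proof.
  intros Hr Hf Hm. rewrite <- (Cmod_minus_0_r (circle_mean f r)), <- (circle_mean_const 0 r) at 1.
  apply circle_mean_dist_le; auto; [intros z _; apply ccontinuous_const|].
  intros t Ht. rewrite Cmod_minus_0_r. auto.
Qed.

Lemma Cmod_circle_mean_minus_le (f : C -> C) (l : C) (r m : R) : 0 <= r ->
  ccontinuous_on_circle f r ->
  (forall z, Cmod z = r -> Cmod (f z - l) <= m) -> Cmod (circle_mean f r - l) <= m.
Proof.
  intros Hr Hf Hm. rewrite <- (circle_mean_const l r) at 1.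
  apply circle_mean_dist_le; auto; [intros z _; apply ccontinuous_const|].
  intros t _. apply Hm, Cmod_circle, Hr.
Qed.

Lemma ccontinuous_on_circle_bounded (f : C -> C) (r : R) : 0 <= r -> ccontinuous_on_circle f r ->
  exists m, 0 <= m /\ forall t, 0 <= t <= 2 * PI -> Cmod (f (circle r t)) <= m.
Proof.
  intros Hr Hf.
  destruct (@bounded_continuity C_AbsRing (AbsRing_NormedModule C_AbsRing)
    (fun t => f (circle r t)) 0 (2 * PI))
    as [m Hm]; [exact (ccontinuous_on_circle_path f r 0 (2 * PI) Hr Hf)|].
  exists (Rabs m). split; [apply Rabs_pos|]. intros t Ht. left.
  apply Rlt_le_trans with m; [exact (Hm t Ht) | apply Rle_abs].
Qed.

(* In logarithmic polar coordinates the annulus is a rectangle whose horizontal sides cancel. *)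
Lemma circle_mean_annulus (f : C -> C) (r1 r2 : R) : 0 < r1 <= r2 ->
  (forall z, r1 <= Cmod z <= r2 -> cderivable f z) -> circle_mean f r1 = circle_mean f r2.
Proof.
  intros [Hr1 Hr12] HD. assert (HPI := PI_RGT_0).
  set (F := fun z => f (cexp z)).
  assert (Hside : forall r, 0 < r ->
    Cint (fun y => F (ln r, y)) 0 (2 * PI) = Cint (fun t => f (circle r t)) 0 (2 * PI)).
  { intros r Hr. apply Cint_ext; [lra|]. intros t _. unfold F. rewrite cexp_ln; auto. }
  assert (Hgoursat : rect_Cint F (ln r1) (ln r2) 0 (2 * PI) = RtoC 0).
  { apply goursat; [apply ln_le; lra | lra|]. intros x y [Hx1 Hx2] _.
    apply (cderivable_comp f cexp).
    - apply HD. change (r1 <= Cmod (circle (exp x) y) <= r2).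
      rewrite Cmod_circle by (left; apply exp_pos).
      rewrite <- (exp_ln r1), <- (exp_ln r2) by lra. split; apply exp_le_compat; auto.
    - eexists. apply is_cderive_cexp. }
  unfold rect_Cint in Hgoursat. rewrite !Hside in Hgoursat by lra.
  assert (Hper :
    Cint (fun x => F (x, 2 * PI)) (ln r1) (ln r2) = Cint (fun x => F (x, 0)) (ln r1) (ln r2)).
  { apply Cint_ext; [apply ln_le; lra|]. intros x _. unfold F, cexp; simpl.
    rewrite cos_2PI, sin_2PI, cos_0, sin_0. reflexivity. }
  rewrite Hper in Hgoursat. unfold circle_mean. f_equal. symmetry. apply Ceq_minus.
  apply NNPP. intros N. apply (Cmult_neq_0 _ _ Ci_nz N). rewrite <- Hgoursat. ring.
Qed.

Lemma circle_mean_continuous (f : C -> C) (r eps : R) : 0 < r -> ccontinuous_on_circle f r ->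
  0 < eps ->
  exists d, 0 < d /\ forall r', 0 <= r' -> Rabs (r' - r) < d -> ccontinuous_on_circle f r' ->
    Cmod (circle_mean f r' - circle_mean f r) <= eps.
Proof.
  intros Hr Hf He.
  assert (Hloc : forall s, exists d : posreal, forall r' t, Rabs (r' - r) < d -> Rabs (t - s) < d ->
     0 <= r' -> Cmod (f (circle r' t) - f (circle r s)) < eps / 2).
  { intros s.
    destruct (proj1 (ccontinuous_eps f (circle r s)) (Hf _ (Cmod_circle r s ltac:(lra)))
      (eps / 2)) as (e & He' & Hfe); [lra|].
    destruct (proj1 (path_continuous_eps (circle r) s) (path_continuous_circle r s) (e / 2)) as
      (d & Hd & Hcd); [lra|].
    assert (Hm : 0 < Rmin d (e / 2)) by (apply Rmin_pos; lra).
    exists (mkposreal _ Hm). simpl. intros r' t Hr' Ht Hr0. apply Hfe.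
    eapply Rle_lt_trans; [apply (Cmod_minus_triangle _ (circle r t))|].
    rewrite Cmod_circle_minus_radius.
    destruct (Rmin_Rgt_l _ _ _ Hr') as [_ Hr2]. destruct (Rmin_Rgt_l _ _ _ Ht) as [Ht1 _].
    specialize (Hcd t Ht1). lra. }
  set (del := fun s => proj1_sig (constructive_indefinite_description _ (Hloc s))).
  assert (Hdel := fun s => proj2_sig (constructive_indefinite_description _ (Hloc s))).
  destruct (compactness_value_1d 0 (2 * PI) del) as [d Hd].
  exists d. split; [apply cond_pos|]. intros r' Hr0 Hr' Hf'.
  apply circle_mean_dist_le; auto; [lra|]. intros t Ht. apply Rnot_lt_le. intros Hlt.
  apply (Hd t Ht). intros (s & _ & Hts & Hds).
  assert (Hr's := Hdel s r' t ltac:(eapply Rlt_le_trans; eauto) Hts Hr0).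
  assert (Hrs := Hdel s r t ltac:(rewrite Rminus_diag, Rabs_R0; apply cond_pos) Hts ltac:(lra)).
  assert (Htri := Cmod_minus_triangle (f (circle r' t)) (f (circle r s)) (f (circle r t))).
  rewrite (Cmod_minus_comm (f (circle r s))) in Htri. lra.
Qed.

(* The mean is constant on both sides of [r0] and continuous across it. *)
Lemma circle_mean_annulus_except (f : C -> C) (r1 r0 r2 : R) : 0 < r1 -> r1 < r0 < r2 ->
  (forall z, r1 <= Cmod z <= r2 -> ccontinuous f z) ->
  (forall z, r1 <= Cmod z <= r2 -> Cmod z <> r0 -> cderivable f z) ->
  circle_mean f r1 = circle_mean f r2.
Proof.
  intros Hr1 Hr0 HC HD. apply Ceq_of_dist_le_eps. intros eps He.
  assert (HC' : forall r, r1 <= r <= r2 -> ccontinuous_on_circle f r)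
    by (intros r Hr z Hz; apply HC; lra).
  destruct (circle_mean_continuous f r0 (eps / 2)) as (d & Hd & Hcont);
    [lra | apply HC'; lra | lra |].
  set (e := Rmin (d / 2) (Rmin (r0 - r1) (r2 - r0))).
  assert (He0 : 0 < e) by (repeat apply Rmin_pos; lra).
  assert (He1 : e <= d / 2) by apply Rmin_l.
  assert (He2 : e <= r0 - r1) by (eapply Rle_trans; [apply Rmin_r | apply Rmin_l]).
  assert (He3 : e <= r2 - r0) by (eapply Rle_trans; [apply Rmin_r | apply Rmin_r]).
  rewrite (circle_mean_annulus f r1 (r0 - e)), <- (circle_mean_annulus f (r0 + e) r2)
    by (lra || (intros z Hz; apply HD; lra)).
  assert (Al := Hcont (r0 - e) ltac:(lra) ltac:(apply Rabs_lt_between'; lra)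
    (HC' (r0 - e) ltac:(lra))).
  assert (Ar := Hcont (r0 + e) ltac:(lra) ltac:(apply Rabs_lt_between'; lra)
    (HC' (r0 + e) ltac:(lra))).
  eapply Rle_trans; [apply (Cmod_minus_triangle _ (circle_mean f r0))|].
  rewrite (Cmod_minus_comm (circle_mean f r0)). lra.
Qed.

Lemma circle_mean_center (f : C -> C) (r0 r : R) : 0 < r -> r0 < r ->
  (forall z, Cmod z <= r -> ccontinuous f z) ->
  (forall z, 0 < Cmod z <= r -> Cmod z <> r0 -> cderivable f z) ->
  circle_mean f r = f 0.
Proof.
  intros Hr Hr0 HC HD. apply Ceq_of_dist_le_eps. intros eps He.
  destruct (proj1 (ccontinuous_eps f 0) (HC 0 ltac:(rewrite Cmod_0; lra)) eps He) as (d & Hd & Hf).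
  set (m := if Rlt_dec 0 r0 then r0 else r).
  assert (Hm : 0 < m <= r) by (unfold m; destruct (Rlt_dec 0 r0); lra).
  set (rho := Rmin m d / 2).
  assert (Hrho : 0 < rho) by (apply Rdiv_lt_0_compat; [apply Rmin_pos|]; lra).
  assert (Hrm : rho < m) by (assert (Hmin := Rmin_l m d); unfold rho in *; lra).
  assert (Hrd : rho < d) by (assert (Hmin := Rmin_r m d); unfold rho in *; lra).
  assert (Hsame : circle_mean f rho = circle_mean f r).
  { unfold m in *. destruct (Rlt_dec 0 r0) as [Hpos | Hneg].
    - apply circle_mean_annulus_except with r0; try lra; intros z Hz;
        [apply HC; lra | apply HD; lra].
    - apply circle_mean_annulus; [lra|]. intros z Hz. apply HD; lra. }
  rewrite <- Hsame. apply Cmod_circle_mean_minus_le; [lra | intros z Hz; apply HC; lra |].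
  intros z Hz. left. apply Hf. rewrite Cmod_minus_0_r. lra.
Qed.

Lemma circle_mean_infinity (f : C -> C) (r : R) (l : C) : 0 < r ->
  (forall z, r <= Cmod z -> cderivable f z) ->
  (forall eps, 0 < eps -> exists rho, forall z, rho <= Cmod z -> Cmod (f z - l) <= eps) ->
  circle_mean f r = l.
Proof.
  intros Hr HD Hl. apply Ceq_of_dist_le_eps. intros eps He. destruct (Hl eps He) as [rho Hrho].
  assert (Hm1 := Rmax_l r rho). assert (Hm2 := Rmax_r r rho).
  rewrite (circle_mean_annulus f r (Rmax r rho)) by (lra || (intros z Hz; apply HD; lra)).
  apply Cmod_circle_mean_minus_le; [lra | |]; intros z Hz.
  - apply cderivable_ccontinuous, HD. lra.
  - apply Hrho. lra.
Qed.

Lemma entire_limit_at_infinity (f : C -> C) (l : C) : (forall z, cderivable f z) ->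
  (forall eps, 0 < eps -> exists rho, forall z, rho <= Cmod z -> Cmod (f z - l) <= eps) ->
  f 0 = l.
Proof.
  intros HD Hl. rewrite <- (circle_mean_center f 0 1); try lra; auto.
  - apply circle_mean_infinity; auto. lra.
  - intros z _. apply cderivable_ccontinuous, HD.
Qed.

(** * Cauchy's integral formula *)

Lemma cderivable_kernel (a z : C) : z <> a -> cderivable (fun y => y / (y - a))%C z.
Proof.
  intros N. apply cderivable_div; [apply cderivable_id | | apply Cminus_eq_contra, N].
  apply cderivable_minus; [apply cderivable_id | apply cderivable_const].
Qed.

Lemma ccontinuous_on_circle_kernel (a : C) (r : R) : Cmod a < r ->
  ccontinuous_on_circle (fun z => z / (z - a))%C r.
Proof. intros Ha z Hz. apply cderivable_ccontinuous, cderivable_kernel. intros ->. lra. Qed.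

Lemma circle_mean_kernel (a : C) (r : R) : Cmod a < r -> circle_mean (fun z => z / (z - a))%C r = 1.
Proof.
  intros Ha. assert (Ha0 := Cmod_ge_0 a). apply circle_mean_infinity; [lra | |].
  - intros z Hz. apply cderivable_kernel. intros ->. lra.
  - intros eps He. exists (r + Cmod a + Cmod a / eps). intros z Hz.
    assert (Hq : 0 <= Cmod a / eps)
      by (apply Rmult_le_pos; [lra | left; apply Rinv_0_lt_compat, He]).
    assert (Hneq : (z - a)%C <> RtoC 0) by (apply Cminus_eq_contra; intros ->; lra).
    replace (z / (z - a) - 1)%C with (a / (z - a))%C by (field; auto).
    assert (Htri := Cmod_minus_ge z a).
    rewrite Cmod_div by auto. apply Rle_div_l; [lra|].
    replace (Cmod a) with (eps * (Cmod a / eps)) at 1 by (field; lra).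
    apply Rmult_le_compat_l; lra.
Qed.

Lemma holomorphic_on_disk_cderivable (f : C -> C) :
  holomorphic_on_disk f <-> forall z, disk z -> cderivable f z.
Proof. split; intros H z Hz; apply ex_derive_cderivable, H, Hz. Qed.

Lemma holomorphic_ccontinuous (f : C -> C) (z : C) : holomorphic_on_disk f -> disk z ->
  ccontinuous f z.
Proof. intros Hf Hz. apply cderivable_ccontinuous, holomorphic_on_disk_cderivable; auto. Qed.

Lemma holomorphic_ccontinuous_on_circle (f : C -> C) (r : R) : holomorphic_on_disk f -> r < 1 ->
  ccontinuous_on_circle f r.
Proof. intros Hf Hr z Hz. apply holomorphic_ccontinuous; auto. unfold disk. lra. Qed.

Definition div_minus (G : C -> C) (a z : C) : C := (G z / (z - a))%C.

Definition cauchy_transform (G : C -> C) (r : R) (a : C) : C := circle_mean (div_minus G a) r.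

Lemma ccontinuous_on_circle_div_minus (G : C -> C) (a : C) (r : R) : ccontinuous_on_circle G r ->
  Cmod a < r -> ccontinuous_on_circle (div_minus G a) r.
Proof.
  intros HG Ha z Hz.
  apply ccontinuous_div; [apply HG, Hz | | apply Cminus_eq_contra; intros ->; lra].
  apply ccontinuous_minus; [apply ccontinuous_id | apply ccontinuous_const].
Qed.

Lemma Cmod_div_minus_circle_le (G : C -> C) (a : C) (r s m t : R) : Cmod a <= s -> s < r ->
  Cmod (G (circle r t)) <= m -> Cmod (div_minus G a (circle r t)) <= m / (r - s).
Proof.
  intros Ha Hs Hm. assert (Ha0 := Cmod_ge_0 a). assert (Htri := Cmod_minus_ge (circle r t) a).
  rewrite Cmod_circle in Htri by lra. apply Cmod_div_le; lra || auto.
Qed.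

Lemma Cmod_cauchy_transform_le (G : C -> C) (r s m : R) (a : C) : ccontinuous_on_circle G r ->
  (forall t, 0 <= t <= 2 * PI -> Cmod (G (circle r t)) <= m) -> Cmod a <= s -> s < r ->
  Cmod (cauchy_transform G r a) <= m / (r - s).
Proof.
  intros HG Hm Ha Hs. assert (Ha0 := Cmod_ge_0 a).
  apply Cmod_circle_mean_le; [lra | apply ccontinuous_on_circle_div_minus; auto; lra|].
  intros t Ht. apply Cmod_div_minus_circle_le; auto.
Qed.

Lemma cauchy_transform_minus (F G : C -> C) (r : R) (a : C) : Cmod a < r ->
  ccontinuous_on_circle F r -> ccontinuous_on_circle G r ->
  (cauchy_transform F r a - cauchy_transform G r a)%C = cauchy_transform (fun z => F z - G z)%C r a.
Proof.
  intros Ha HF HG. assert (Ha0 := Cmod_ge_0 a). unfold cauchy_transform. symmetry.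
  rewrite <- (circle_mean_minus (div_minus F a) (div_minus G a));
    try apply ccontinuous_on_circle_div_minus; auto; try lra.
  apply circle_mean_ext; [lra|]. intros z Hz. unfold div_minus. field.
  apply Cminus_eq_contra. intros ->. lra.
Qed.

Lemma cauchy_transform_resolvent (G : C -> C) (r : R) (a b : C) : ccontinuous_on_circle G r ->
  Cmod a < r -> Cmod b < r ->
  (cauchy_transform G r a - cauchy_transform G r b)%C
    = ((a - b) * cauchy_transform (div_minus G b) r a)%C.
Proof.
  intros HG Ha Hb. assert (Ha0 := Cmod_ge_0 a). unfold cauchy_transform.
  assert (Ca := ccontinuous_on_circle_div_minus G a r HG Ha).
  assert (Cb := ccontinuous_on_circle_div_minus G b r HG Hb).
  rewrite <- (circle_mean_scal (a - b) (div_minus (div_minus G b) a)),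
    <- (circle_mean_minus (div_minus G a) (div_minus G b)); auto; try lra.
  - apply circle_mean_ext; [lra|]. intros z Hz. unfold div_minus. field.
    split; apply Cminus_eq_contra; intros ->; lra.
  - apply ccontinuous_on_circle_div_minus; auto.
Qed.

Lemma cderivable_cauchy_transform (G : C -> C) (r : R) (a : C) : ccontinuous_on_circle G r ->
  Cmod a < r -> cderivable (cauchy_transform G r) a.
Proof.
  intros HG Ha. assert (Ha0 := Cmod_ge_0 a).
  destruct (ccontinuous_on_circle_bounded G r) as (m & Hm & HGm); [lra | auto |].
  set (s := (r + Cmod a) / 2). assert (Hs : Cmod a < s < r) by (unfold s; lra).
  assert (CGa := ccontinuous_on_circle_div_minus G a r HG Ha).
  assert (CGaa := ccontinuous_on_circle_div_minus (div_minus G a) a r CGa Ha).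
  apply cderivable_of_quadratic_remainder with (l := cauchy_transform (div_minus G a) r a)
    (K := m / (r - s) / (r - s) / (r - s)) (d := s - Cmod a); [lra|].
  intros y Hy. assert (Hys : Cmod y <= s) by (assert (Htri := Cmod_minus_ge y a); lra).
  replace (cauchy_transform G r y - cauchy_transform G r a
      - (y - a) * cauchy_transform (div_minus G a) r a)%C
    with ((y - a) * ((y - a) * cauchy_transform (div_minus (div_minus G a) a) r y))%C.
  - rewrite !Cmod_mult, <- Rmult_assoc, Rmult_comm.
    apply Rmult_le_compat_r; [apply Rmult_le_pos; apply Cmod_ge_0|].
    apply Cmod_cauchy_transform_le; auto; [|lra]. intros t Ht.
    repeat (apply Cmod_div_minus_circle_le; try lra). auto.
  - rewrite <- (cauchy_transform_resolvent (div_minus G a)), (cauchy_transform_resolvent G)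
      by (auto; lra). ring.
Qed.

Lemma holomorphic_mult_id_ccontinuous_on_circle (f : C -> C) (r : R) : holomorphic_on_disk f ->
  r < 1 -> ccontinuous_on_circle (fun z => f z * z)%C r.
Proof.
  intros Hf Hr z Hz. apply ccontinuous_mult; [|apply ccontinuous_id].
  apply (holomorphic_ccontinuous_on_circle f r); auto.
Qed.

Lemma cauchy_formula (f : C -> C) (r : R) (a : C) : holomorphic_on_disk f -> r < 1 -> Cmod a < r ->
  cauchy_transform (fun z => f z * z)%C r a = f a.
Proof.
  intros Hf Hr Ha. assert (Ha0 := Cmod_ge_0 a).
  assert (Hd : forall z, Cmod z <= r -> cderivable f z)
    by (intros z Hz; apply holomorphic_on_disk_cderivable; auto; unfold disk; lra).
  destruct (Hd a ltac:(lra)) as [l Hl].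
  set (h := fun z => (z * slope f a l z)%C).
  assert (Ch : forall z, Cmod z <= r -> ccontinuous h z).
  { intros z Hz. apply ccontinuous_mult; [apply ccontinuous_id|].
    destruct (Ceq_dec z a) as [-> | N]; [apply ccontinuous_slope, Hl|].
    apply cderivable_ccontinuous, cderivable_slope; auto. }
  assert (Hmean : circle_mean h r = 0).
  { rewrite (circle_mean_center h (Cmod a)); [unfold h; ring | lra | lra | exact Ch |].
    intros z Hz N. apply cderivable_mult; [apply cderivable_id|].
    apply cderivable_slope; [apply Hd; lra | intros ->; lra]. }
  assert (Ck := ccontinuous_on_circle_kernel a r Ha).
  transitivity (circle_mean (fun z => h z + f a * (z / (z - a)))%C r).
  - apply circle_mean_ext; [lra|]. intros z Hz. assert (Hneq : z <> a) by (intros ->; lra).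
    unfold div_minus, h. rewrite slope_neq by auto. field. apply Cminus_eq_contra, Hneq.
  - rewrite circle_mean_plus, circle_mean_scal, circle_mean_kernel, Hmean; auto; try lra;
      [ring | |].
    + intros z Hz. apply Ch. lra.
    + intros z Hz. apply ccontinuous_mult; [apply ccontinuous_const | apply Ck, Hz].
Qed.

Lemma cauchy_difference (f : C -> C) (r : R) (a b : C) : holomorphic_on_disk f -> r < 1 ->
  Cmod a < r -> Cmod b < r ->
  (f a - f b = (a - b) * cauchy_transform (div_minus (fun z => f z * z) b) r a)%C.
Proof.
  intros Hf Hr Ha Hb.
  rewrite <- cauchy_transform_resolvent, !cauchy_formula
    by (auto using holomorphic_mult_id_ccontinuous_on_circle).
  reflexivity.
Qed.

Lemma holomorphic_lipschitz (f : C -> C) (s : R) : holomorphic_on_disk f -> s < 1 ->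
  exists L, 0 <= L /\ forall z w, Cmod z <= s -> Cmod w <= s ->
    Cmod (f z - f w) <= L * Cmod (z - w).
Proof.
  intros Hf Hs. destruct (Rlt_le_dec s 0) as [Hneg | Hs0].
  { exists 0. split; [lra|]. intros z w Hz. assert (Hpos := Cmod_ge_0 z). lra. }
  set (r := (1 + s) / 2). assert (Hr : s < r < 1) by (unfold r; lra).
  assert (Cf := holomorphic_mult_id_ccontinuous_on_circle f r Hf ltac:(lra)).
  destruct (ccontinuous_on_circle_bounded _ r ltac:(lra) Cf) as (m & Hm & Hfm).
  assert (Hi : 0 <= / (r - s)) by (left; apply Rinv_0_lt_compat; lra).
  exists (m / (r - s) / (r - s)). split; [repeat apply Rmult_le_pos; auto|].
  intros z w Hz Hw. rewrite (cauchy_difference f r z w), Cmod_mult, Rmult_comm by (auto; lra).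
  apply Rmult_le_compat_r; [apply Cmod_ge_0|].
  apply Cmod_cauchy_transform_le; auto; try lra.
  - apply ccontinuous_on_circle_div_minus; auto. lra.
  - intros t Ht. apply Cmod_div_minus_circle_le; auto. lra.
Qed.

Lemma holomorphic_bounded (f : C -> C) (s : R) : holomorphic_on_disk f -> s < 1 ->
  exists m, 0 <= m /\ forall z, Cmod z <= s -> Cmod (f z) <= m.
Proof.
  intros Hf Hs. destruct (holomorphic_lipschitz f s Hf Hs) as (L & HL & H).
  assert (Hpos0 := Cmod_ge_0 (f 0)). exists (Cmod (f 0) + L). split; [lra|]. intros z Hz.
  assert (Hpos := Cmod_ge_0 z). specialize (H z 0 Hz ltac:(rewrite Cmod_0; lra)).
  rewrite Cmod_minus_0_r in H.
  assert (L * Cmod z <= L * 1) by (apply Rmult_le_compat_l; lra).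
  assert (Htri := Cmod_minus_ge (f z) (f 0)). lra.
Qed.

Lemma holomorphic_slope (f : C -> C) (a : C) : holomorphic_on_disk f -> disk a ->
  exists l, holomorphic_on_disk (slope f a l).
Proof.
  intros Hf Ha. unfold disk in Ha.
  set (r := (1 + Cmod a) / 2). assert (Hr : Cmod a < r < 1) by (unfold r; lra).
  set (G := div_minus (fun z => f z * z)%C a).
  assert (CG : ccontinuous_on_circle G r)
    by (apply ccontinuous_on_circle_div_minus;
      [apply holomorphic_mult_id_ccontinuous_on_circle; auto|]; lra).
  exists (cauchy_transform G r a). apply holomorphic_on_disk_cderivable. intros z Hz.
  destruct (Ceq_dec z a) as [-> | N].
  - apply (cderivable_ext_near (cauchy_transform G r) _ a (r - Cmod a)); [lra | |].
    + intros y Hy. destruct (Ceq_dec y a) as [-> | N]; [rewrite slope_eq; reflexivity|].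
      assert (Htri := Cmod_minus_ge y a).
      rewrite slope_neq, (cauchy_difference f r y a) by (auto; lra). fold G. field.
      apply Cminus_eq_contra, N.
    + apply cderivable_cauchy_transform; auto. lra.
  - apply cderivable_slope; auto. apply holomorphic_on_disk_cderivable; auto.
Qed.

Lemma ccontinuous_of_uniform_approx (f : C -> C) (z : C) :
  (forall eps, 0 < eps -> exists g d, 0 < d /\ ccontinuous g z /\
     forall y, Cmod (y - z) < d -> Cmod (f y - g y) <= eps) ->
  ccontinuous f z.
Proof.
  intros Happ. apply ccontinuous_eps. intros eps He.
  destruct (Happ (eps / 3)) as (g & d & Hd & Hg & Hfg); [lra|].
  destruct (proj1 (ccontinuous_eps g z) Hg (eps / 3)) as (e & He' & Hge); [lra|].
  exists (Rmin d e). split; [apply Rmin_pos; auto|]. intros y Hy.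
  destruct (Rmin_Rgt_l _ _ _ Hy) as [Hyd Hye]. specialize (Hge y Hye).
  assert (By := Hfg y Hyd). assert (Bz := Hfg z ltac:(rewrite Cmod_minus_diag; auto)).
  assert (Htri1 := Cmod_minus_triangle (f y) (g y) (f z)).
  assert (Htri2 := Cmod_minus_triangle (g y) (g z) (f z)).
  rewrite (Cmod_minus_comm (g z)) in Htri2. lra.
Qed.

(* By Cauchy's formula the limit is again a Cauchy transform. *)
Lemma holomorphic_of_uniform_approx (f : C -> C) :
  (forall r eps, r < 1 -> 0 < eps -> exists g, holomorphic_on_disk g /\
     forall z, Cmod z <= r -> Cmod (f z - g z) <= eps) ->
  holomorphic_on_disk f.
Proof.
  intros Happ.
  assert (Hc : forall z, disk z -> ccontinuous f z).
  { intros z Hz. unfold disk in Hz. apply ccontinuous_of_uniform_approx. intros eps He.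
    destruct (Happ ((1 + Cmod z) / 2) eps) as (g & Hg & Hfg); [lra | lra |].
    exists g, ((1 - Cmod z) / 2). split; [lra|]. split; [apply holomorphic_ccontinuous; auto|].
    intros y Hy. apply Hfg. assert (Htri := Cmod_minus_ge y z). lra. }
  apply holomorphic_on_disk_cderivable. intros a Ha. assert (Ha0 := Cmod_ge_0 a). unfold disk in Ha.
  set (r := (1 + Cmod a) / 2). assert (Hr : Cmod a < r < 1) by (unfold r; lra).
  assert (Cf : ccontinuous_on_circle (fun z => f z * z)%C r).
  { intros z Hz. apply ccontinuous_mult; [apply Hc; unfold disk; lra | apply ccontinuous_id]. }
  apply (cderivable_ext_near (cauchy_transform (fun z => f z * z)%C r) _ a (r - Cmod a)); [lra | |].
  - intros z Hz. assert (Hzr : Cmod z < r) by (assert (Htri := Cmod_minus_ge z a); lra).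
    apply Ceq_of_dist_le_eps. intros eps He. set (k := 1 + / (r - Cmod z)).
    assert (Hi : 0 < / (r - Cmod z)) by (apply Rinv_0_lt_compat; lra).
    destruct (Happ r (eps / k)) as (g & Hg & Hfg); [lra | apply Rdiv_lt_0_compat; unfold k; lra |].
    assert (Cg := holomorphic_mult_id_ccontinuous_on_circle g r Hg ltac:(lra)).
    eapply Rle_trans; [apply (Cmod_minus_triangle _ (g z))|].
    rewrite <- (cauchy_formula g r z) at 1 by (auto; lra). rewrite cauchy_transform_minus by auto.
    assert (Bz := Hfg z ltac:(lra)). rewrite (Cmod_minus_comm (g z)).
    assert (Bt : Cmod (cauchy_transform (fun y => f y * y - g y * y)%C r z)
      <= eps / k / (r - Cmod z)).
    { apply Cmod_cauchy_transform_le; [| | lra | lra].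
      - intros y Hy. apply ccontinuous_minus; [apply Cf, Hy | apply Cg, Hy].
      - intros t _. set (y := circle r t). assert (Ey : Cmod y = r) by (apply Cmod_circle; lra).
        replace (f y * y - g y * y)%C with (y * (f y - g y))%C by ring. rewrite Cmod_mult.
        specialize (Hfg y ltac:(lra)). assert (Hpos := Cmod_ge_0 (f y - g y)).
        apply Rle_trans with (1 * Cmod (f y - g y)); [apply Rmult_le_compat_r; lra | lra]. }
    replace eps with (eps / k / (r - Cmod z) + eps / k) at 1; [lra|].
    unfold k. field. split; [|lra]. lra.
  - apply cderivable_cauchy_transform; auto. lra.
Qed.

(** * Taylor coefficients *)

Definition taylor_coeff (f : C -> C) (r : R) (n : nat) : C :=
  circle_mean (fun z => f z / z ^ n)%C r.

Lemma cderivable_div_pow (f : C -> C) (z : C) (n : nat) : cderivable f z -> z <> 0 ->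
  cderivable (fun y => f y / y ^ n)%C z.
Proof. intros Hf N. apply cderivable_div; auto using cderivable_pow, Cpow_nz. Qed.

Lemma Cmod_pos_neq_0 (z : C) (r : R) : 0 < r -> Cmod z = r -> z <> 0.
Proof. intros Hr Hz. apply Cmod_gt_0. lra. Qed.

Lemma ccontinuous_on_circle_div_pow (f : C -> C) (r : R) (n : nat) : holomorphic_on_disk f ->
  0 < r < 1 -> ccontinuous_on_circle (fun z => f z / z ^ n)%C r.
Proof.
  intros Hf Hr z Hz. apply cderivable_ccontinuous, cderivable_div_pow.
  - apply holomorphic_on_disk_cderivable; auto. unfold disk. lra.
  - apply (Cmod_pos_neq_0 z r); lra.
Qed.

Lemma taylor_coeff_radius (f : C -> C) (r s : R) (n : nat) : holomorphic_on_disk f -> 0 < r < 1 ->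
  0 < s < 1 -> taylor_coeff f r n = taylor_coeff f s n.
Proof.
  intros Hf.
  assert (Hordered : forall r s, 0 < r <= s -> s < 1 -> taylor_coeff f r n = taylor_coeff f s n).
  { intros u v Huv Hv. apply circle_mean_annulus; [lra|]. intros z Hz. apply cderivable_div_pow.
    - apply holomorphic_on_disk_cderivable; auto. unfold disk. lra.
    - apply Cmod_gt_0. lra. }
  intros Hr Hs. destruct (Rle_lt_dec r s); [|symmetry]; apply Hordered; lra.
Qed.

Lemma Cmod_taylor_coeff_le (f : C -> C) (r m : R) (n : nat) : holomorphic_on_disk f -> 0 < r < 1 ->
  (forall z, Cmod z = r -> Cmod (f z) <= m) -> Cmod (taylor_coeff f r n) <= m / r ^ n.
Proof.
  intros Hf Hr Hm. apply Cmod_circle_mean_le; [lra | apply ccontinuous_on_circle_div_pow; auto|].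
  intros t _. assert (Ht := Cmod_circle r t ltac:(lra)).
  apply Cmod_div_le; [auto | apply pow_lt; lra | rewrite Cmod_pow, Ht; lra].
Qed.

Lemma taylor_coeff_plus (f g : C -> C) (r : R) (n : nat) : holomorphic_on_disk f ->
  holomorphic_on_disk g -> 0 < r < 1 ->
  taylor_coeff (fadd f g) r n = (taylor_coeff f r n + taylor_coeff g r n)%C.
Proof.
  intros Hf Hg Hr. unfold taylor_coeff.
  rewrite <- circle_mean_plus by (lra || apply ccontinuous_on_circle_div_pow; auto).
  apply circle_mean_ext; [lra|]. intros z _. unfold fadd, Cdiv. ring.
Qed.

Lemma taylor_coeff_scal (k : C) (f : C -> C) (r : R) (n : nat) : holomorphic_on_disk f ->
  0 < r < 1 -> taylor_coeff (fun z => k * f z)%C r n = (k * taylor_coeff f r n)%C.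
Proof.
  intros Hf Hr. unfold taylor_coeff.
  rewrite <- circle_mean_scal by (lra || apply ccontinuous_on_circle_div_pow; auto).
  apply circle_mean_ext; [lra|]. intros z _. unfold Cdiv. ring.
Qed.

Lemma cauchy_transform_mult_id (G : C -> C) (r : R) (a : C) : ccontinuous_on_circle G r ->
  Cmod a < r ->
  cauchy_transform (fun z => G z * z)%C r a = (circle_mean G r + a * cauchy_transform G r a)%C.
Proof.
  intros HG Ha. assert (Ha0 := Cmod_ge_0 a).
  assert (Ca := ccontinuous_on_circle_div_minus G a r HG Ha). unfold cauchy_transform.
  rewrite <- (circle_mean_scal a (div_minus G a)), <- (circle_mean_plus G); auto; try lra.
  - apply circle_mean_ext; [lra|]. intros z Hz. unfold div_minus. field. apply Cminus_eq_contra.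
    intros ->. lra.
  - intros z Hz. apply ccontinuous_mult; [apply ccontinuous_const | apply Ca, Hz].
Qed.

Lemma taylor_remainder (f : C -> C) (r : R) (a : C) (N : nat) : holomorphic_on_disk f ->
  0 < r < 1 -> Cmod a < r ->
  (f a - sum_n (fun n => taylor_coeff f r n * a ^ n) N)%C =
  (a ^ S N * cauchy_transform (fun z => f z / z ^ N) r a)%C.
Proof.
  intros Hf Hr Ha.
  assert (Cn := fun n => ccontinuous_on_circle_div_pow f r n Hf Hr).
  assert (Hshift := fun n => cauchy_transform_mult_id _ r a (Cn n) Ha).
  induction N as [|N IH].
  - rewrite sum_O, <- (cauchy_formula f r a) by (auto; lra).
    transitivity (cauchy_transform (fun z => f z / z ^ 0 * z) r a - taylor_coeff f r 0 * a ^ 0)%C.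
    + f_equal. apply circle_mean_ext; [lra|]. intros z Hz. unfold div_minus. simpl. field.
      apply Cminus_eq_contra. intros ->. lra.
    + rewrite Hshift. unfold taylor_coeff. simpl. ring.
  - rewrite sum_Sn. change plus with Cplus.
    replace (f a -
      (sum_n (fun n => taylor_coeff f r n * a ^ n) N + taylor_coeff f r (S N) * a ^ S N))%C
      with (f a - sum_n (fun n => taylor_coeff f r n * a ^ n) N
        - taylor_coeff f r (S N) * a ^ S N)%C by (simpl; ring).
    rewrite IH. replace (cauchy_transform (fun z => f z / z ^ N)%C r a)
      with (cauchy_transform (fun z => f z / z ^ S N * z)%C r a).
    + rewrite Hshift. unfold taylor_coeff. simpl. ring.
    + apply circle_mean_ext; [lra|]. intros z Hz. assert (Nz := Cmod_pos_neq_0 z r ltac:(lra) Hz).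
      unfold div_minus. rewrite Cpow_S. field.
      repeat split; auto using Cpow_nz. apply Cminus_eq_contra. intros ->. lra.
Qed.

Lemma taylor_series (f : C -> C) (r : R) : holomorphic_on_disk f -> 0 < r < 1 ->
  power_series_on_disk (taylor_coeff f r) f.
Proof.
  intros Hf Hr a Ha. assert (Ha0 := Cmod_ge_0 a). unfold disk in Ha.
  set (s := (1 + Cmod a) / 2). assert (Hs : Cmod a < s < 1) by (unfold s; lra).
  destruct (ccontinuous_on_circle_bounded f s) as (m & Hm & Hfm); [lra | |].
  { apply holomorphic_ccontinuous_on_circle; auto. lra. }
  set (x := Cmod a / s). set (B := m / (s - Cmod a) * Cmod a).
  assert (Hx : Rabs x < 1).
  { unfold x. rewrite Rabs_div, !Rabs_pos_eq by lra. apply Rlt_div_l; lra. }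
  assert (Hrem :
    forall n, Cmod (sum_n (fun n => taylor_coeff f r n * a ^ n)%C n - f a) <= x ^ n * B).
  { intros n. rewrite Cmod_minus_comm.
    replace (fun k => taylor_coeff f r k * a ^ k)%C with (fun k => taylor_coeff f s k * a ^ k)%C
      by (apply functional_extensionality; intros k; rewrite (taylor_coeff_radius f r s)
        by (auto; lra); reflexivity).
    rewrite taylor_remainder, Cmod_mult, Cmod_pow by (auto; lra).
    assert (Hsn : 0 < s ^ n) by (apply pow_lt; lra).
    replace (x ^ n * B) with (Cmod a ^ S n * (m / s ^ n / (s - Cmod a)))
      by (unfold x, B, Rdiv; rewrite Rpow_mult_distr, pow_inv; simpl; field; lra).
    apply Rmult_le_compat_l; [apply pow_le; auto|].
    apply Cmod_cauchy_transform_le; [apply ccontinuous_on_circle_div_pow; auto; lra | | lra | lra].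
    intros t Ht. apply Cmod_div_le; auto. rewrite Cmod_pow, Cmod_circle; lra. }
  apply filterlim_locally. intros eps.
  assert (HB : 0 <= B)
    by (apply Rmult_le_pos; auto; apply Rmult_le_pos; auto; left; apply Rinv_0_lt_compat; lra).
  destruct (pow_lt_1_zero x Hx (eps / (B + 1))) as [N HN];
    [apply Rdiv_lt_0_compat; [apply cond_pos | lra]|].
  exists N. intros n Hn. apply C_NormedModule_mixin_compat1.
  eapply Rle_lt_trans; [apply Hrem|]. specialize (HN n Hn). apply Rabs_lt_between in HN.
  apply Rle_lt_trans with (eps / (B + 1) * B); [apply Rmult_le_compat_r; lra|].
  replace (pos eps) with (eps / (B + 1) * (B + 1)) at 2 by (field; lra).
  apply Rmult_lt_compat_l; lra.
Qed.

Lemma real_power_series_unique (a b : nat -> R) (g : R -> R) :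
  (forall x, Rabs x < 1 -> is_series (fun n => a n * x ^ n) (g x)) ->
  (forall x, Rabs x < 1 -> is_series (fun n => b n * x ^ n) (g x)) -> forall n, a n = b n.
Proof.
  intros Ha Hb n.
  assert (CV : forall c, (forall x, Rabs x < 1 -> is_series (fun n => c n * x ^ n) (g x)) ->
     Rbar_lt 0 (CV_radius c)).
  { intros c Hc. apply Rbar_not_le_lt. intros Hle.
    apply (CV_disk_outside c (/ 2)).
    - apply Rbar_le_lt_trans with (Finite 0); auto. simpl. rewrite Rabs_pos_eq; lra.
    - apply ex_series_lim_0. exists (g (/ 2)). apply Hc. rewrite Rabs_pos_eq; lra. }
  apply PSeries_ext_recip; [apply CV, Ha | apply CV, Hb|].
  exists (mkposreal 1 Rlt_0_1). intros x Hx. change (Rabs (x - 0) < 1) in Hx.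
  rewrite Rminus_0_r in Hx.
  unfold PSeries. rewrite (is_series_unique _ _ (Ha x Hx)), (is_series_unique _ _ (Hb x Hx)).
  reflexivity.
Qed.

Lemma is_series_additive (L : C -> R) (u : nat -> C) (l : C) :
  (forall x y, L (x + y)%C = L x + L y) -> (forall z, Rabs (L z) <= Cmod z) ->
  @is_series C_AbsRing C_NormedModule u l -> is_series (fun n => L (u n)) (L l).
Proof.
  intros Hadd Hle H. apply filterlim_locally. intros eps.
  assert (Hsum : forall n, L (sum_n u n) = sum_n (fun k => L (u k)) n).
  { induction n as [|n IH]; [rewrite !sum_O; reflexivity|]. rewrite !sum_Sn, <- IH. apply Hadd. }
  assert (Hminus : forall x y, L (x - y)%C = L x - L y).
  { intros x y. assert (Hsplit := Hadd (x - y)%C y). replace (x - y + y)%C with x in Hsplit by ring.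
    lra. }
  assert (Hev := H (fun z => Rabs (L z - L l) < eps)). unfold filtermap in Hev.
  destruct Hev as [N HN].
  - apply locally_C. exists eps. intros z Hz. rewrite <- Hminus.
    eapply Rle_lt_trans; [apply Hle | exact Hz].
  - exists N. intros n Hn. specialize (HN n Hn). rewrite Hsum in HN. exact HN.
Qed.

Lemma power_series_unique (f : C -> C) (a b : nat -> C) (n : nat) :
  power_series_on_disk a f -> power_series_on_disk b f -> a n = b n.
Proof.
  intros Ha Hb.
  assert (Hpart : forall L : C -> R, (forall x y, L (x + y)%C = L x + L y) ->
    (forall z, Rabs (L z) <= Cmod z) -> (forall z (x : R), L (z * x)%C = L z * x) ->
    L (a n) = L (b n)).
  { intros L Ladd Lle Lscal.
    assert (Hreal : forall c, power_series_on_disk c f ->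
        forall x, Rabs x < 1 -> is_series (fun k => L (c k) * x ^ k) (L (f x))).
    { intros c Hc x Hx. apply (is_series_ext (fun k => L (c k * RtoC x ^ k)%C)).
      - intros k. rewrite <- RtoC_pow. apply Lscal.
      - apply is_series_additive; auto. apply Hc. unfold disk. rewrite Cmod_R. exact Hx. }
    apply (real_power_series_unique (fun k => L (a k)) (fun k => L (b k)) (fun x => L (f x))); auto. }
  apply injective_projections.
  - apply (Hpart Re); [apply re_plus | apply re_le_Cmod | apply re_scal_r].
  - apply (Hpart Im); [apply im_plus | apply im_le_Cmod | apply im_scal_r].
Qed.

Lemma coeffs_taylor_coeff (f : C -> C) (r : R) (n : nat) : holomorphic_on_disk f -> 0 < r < 1 ->
  coeffs f n = taylor_coeff f r n.
Proof.
  intros Hf Hr. assert (Hseries := taylor_series f r Hf Hr). apply (power_series_unique f); auto.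
  apply (epsilon_spec (inhabits (fun _ => RtoC 0)) (fun a => power_series_on_disk a f)).
  exists (taylor_coeff f r). exact Hseries.
Qed.

(** * Growth conditions and the algebra F^p *)

Definition growth_rate (p r : R) : R := Rpower (1 - r) (- (1 / p)).

Definition growth_le (p eps A : R) (f : C -> C) : Prop :=
  forall z, disk z -> Cmod (f z) <= A * exp (eps * growth_rate p (Cmod z)).

Definition slow_growth (p : R) (f : C -> C) : Prop :=
  forall eps, 0 < eps -> exists A, 0 <= A /\ growth_le p eps A f.

Lemma growth_rate_pos (p r : R) : 0 < growth_rate p r.
Proof. apply exp_pos. Qed.

Lemma exp_growth_rate_ge_1 (p eps r : R) : 0 <= eps -> 1 <= exp (eps * growth_rate p r).
Proof.
  intros H. rewrite <- exp_0. apply exp_le_compat, Rmult_le_pos; auto. left. apply growth_rate_pos.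
Qed.

Lemma Rpower_growth_rate (p r : R) : Rpower (1 - r) (1 / p) * growth_rate p r = 1.
Proof.
  unfold growth_rate. rewrite Rpower_Ropp. apply Rinv_r, Rgt_not_eq, exp_pos.
Qed.

Lemma growth_rate_le (p r s : R) : 0 < p -> r <= s -> s < 1 -> growth_rate p r <= growth_rate p s.
Proof.
  intros Hp Hrs Hs. unfold growth_rate. rewrite !Rpower_Ropp.
  apply Rinv_le_contravar; [apply exp_pos|].
  apply Rle_Rpower_l; [left; apply Rdiv_lt_0_compat|]; lra.
Qed.

Lemma growth_le_bounded (p eps A : R) (f : C -> C) : 0 <= eps -> 0 <= A ->
  (forall z, disk z -> Cmod (f z) <= A) -> growth_le p eps A f.
Proof.
  intros He HA H z Hz. specialize (H z Hz). assert (Hexp := exp_growth_rate_ge_1 p eps (Cmod z) He).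
  assert (A * 1 <= A * exp (eps * growth_rate p (Cmod z))) by (apply Rmult_le_compat_l; lra). lra.
Qed.

Lemma growth_le_add (p eps A B : R) (f g : C -> C) : growth_le p eps A f -> growth_le p eps B g ->
  growth_le p eps (A + B) (fadd f g).
Proof.
  intros Hf Hg z Hz. eapply Rle_trans; [apply Cmod_triangle|].
  rewrite Rmult_plus_distr_r. apply Rplus_le_compat; auto.
Qed.

Lemma growth_le_mul (p d e A B : R) (f g : C -> C) : growth_le p d A f -> growth_le p e B g ->
  growth_le p (d + e) (A * B) (fmul f g).
Proof.
  intros Hf Hg z Hz. unfold fmul. rewrite Cmod_mult, Rmult_plus_distr_r, exp_plus.
  replace (A * B * (exp (d * growth_rate p (Cmod z)) * exp (e * growth_rate p (Cmod z))))
    with (A * exp (d * growth_rate p (Cmod z)) * (B * exp (e * growth_rate p (Cmod z)))) by ring.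
  apply Rmult_le_compat; auto using Cmod_ge_0.
Qed.

Lemma Minf_bounds (f : C -> C) (r m : R) : 0 <= r -> (forall z, Cmod z <= r -> Cmod (f z) <= m) ->
  Minf r f <= m /\ forall z, Cmod z <= r -> Cmod (f z) <= Minf r f.
Proof.
  intros Hr Hm. unfold Minf. set (E := fun y => exists z : C, Cmod z <= r /\ y = Cmod (f z)).
  destruct (Lub_Rbar_correct E) as [Hub Hlub].
  assert (Hle : Rbar_le (Lub_Rbar E) m) by (apply Hlub; intros y (w & Hw & ->); apply Hm, Hw).
  assert (Hge : forall z, Cmod z <= r -> Rbar_le (Cmod (f z)) (Lub_Rbar E))
    by (intros z Hz; apply Hub; exists z; auto).
  assert (Hge0 := Hge 0 ltac:(rewrite Cmod_0; auto)).
  destruct (Lub_Rbar E); simpl in *; contradiction || auto.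
Qed.

Lemma ln_nonneg (x : R) : 1 <= x -> 0 <= ln x.
Proof. intros H. rewrite <- ln_1. apply ln_le; lra. Qed.

Lemma le_exp_log_plus (x : R) : x <= exp (log_plus x).
Proof.
  unfold log_plus. destruct (Rle_lt_dec x 0) as [H | H].
  - assert (Hexp := exp_pos (Rmax (ln x) 0)). lra.
  - rewrite <- (exp_ln x H) at 1. apply exp_le_compat, Rmax_l.
Qed.

Lemma log_plus_le (x y : R) : 0 <= y -> x <= exp y -> log_plus x <= y.
Proof.
  intros Hy H. unfold log_plus. apply Rmax_lub; auto. destruct (Rle_lt_dec x 0) as [Hx | Hx].
  - unfold ln. destruct (Rlt_dec 0 x) as [Hpos | _]; [exfalso; lra | exact Hy].
  - rewrite <- (ln_exp y). apply ln_le; auto.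
Qed.

Lemma Fp_slow_growth (p : R) (f : C -> C) : Fp p f -> slow_growth p f.
Proof.
  intros (_ & Hf & Hlim) eps He.
  destruct (proj1 (filterlim_locally _ _) Hlim (mkposreal eps He)) as [d Hd].
  assert (Hd0 := cond_pos d).
  destruct (holomorphic_bounded f (1 - d) Hf) as (m & Hm & Hfm); [lra|].
  exists (m + 1). split; [lra|]. intros z Hz. set (r := Cmod z).
  assert (Hr0 : 0 <= r) by apply Cmod_ge_0.
  assert (Hexp := exp_growth_rate_ge_1 p eps r (Rlt_le _ _ He)).
  assert (Hstep : Cmod (f z) <= m \/ Cmod (f z) <= exp (eps * growth_rate p r)).
  { unfold disk in Hz. fold r in Hz.
    destruct (Rle_lt_dec r (1 - d)) as [H | H]; [left; auto | right].
    assert (Hball : ball 1 d r) by (change (Rabs (r - 1) < d); rewrite Rabs_left; lra).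
    assert (Hlog : Rpower (1 - r) (1 / p) * log_plus (Minf r f) <= eps).
    { specialize (Hd r Hball Hz).
      change (Rabs (Rpower (1 - r) (1 / p) * log_plus (Minf r f) - 0) < eps) in Hd.
      apply Rabs_lt_between in Hd. lra. }
    destruct (holomorphic_bounded f r Hf Hz) as (k & _ & Hk).
    apply Rle_trans with (Minf r f); [apply (Minf_bounds f r k); auto; unfold r; lra|].
    eapply Rle_trans; [apply le_exp_log_plus|]. apply exp_le_compat.
    replace (log_plus (Minf r f))
      with (Rpower (1 - r) (1 / p) * log_plus (Minf r f) * growth_rate p r)
      by (rewrite (Rmult_comm (Rpower _ _)), Rmult_assoc, Rpower_growth_rate; ring).
    apply Rmult_le_compat_r; auto. left. apply growth_rate_pos. }
  assert (Hmul : (m + 1) * 1 <= (m + 1) * exp (eps * growth_rate p r))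
    by (apply Rmult_le_compat_l; lra).
  assert (1 * exp (eps * growth_rate p r) <= (m + 1) * exp (eps * growth_rate p r))
    by (apply Rmult_le_compat_r; lra).
  fold r. destruct Hstep; lra.
Qed.

Lemma log_plus_Minf_le (p eps A r : R) (f : C -> C) : 0 < p -> 0 <= eps -> 0 <= A ->
  growth_le p eps A f -> 0 <= r < 1 -> log_plus (Minf r f) <= ln (A + 1) + eps * growth_rate p r.
Proof.
  intros Hp He HA Hf Hr. assert (Hrate := growth_rate_pos p r).
  assert (HlA := ln_nonneg (A + 1) ltac:(lra)).
  assert (Hexp : 0 <= eps * growth_rate p r) by (apply Rmult_le_pos; lra).
  apply log_plus_le; [lra|]. rewrite exp_plus, exp_ln by lra.
  apply (Minf_bounds f r); [lra|]. intros z Hz.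
  eapply Rle_trans; [apply Hf; unfold disk; lra|].
  apply Rmult_le_compat; [lra | left; apply exp_pos | lra |].
  apply exp_le_compat, Rmult_le_compat_l; auto. apply growth_rate_le; lra.
Qed.

Lemma Rpower_lt_near_0 (a eta : R) : 0 < a -> 0 < eta ->
  exists d, 0 < d /\ forall t, 0 < t < d -> Rpower t a < eta.
Proof.
  intros Ha He. exists (Rpower eta (/ a)). split; [apply exp_pos|]. intros t Ht.
  replace eta with (Rpower (Rpower eta (/ a)) a)
    by (rewrite Rpower_mult, Rinv_l by lra; apply Rpower_1, He).
  apply Rlt_Rpower_l; auto.
Qed.

Lemma Fp_of_slow_growth (p : R) (f : C -> C) : 0 < p -> on_disk f -> holomorphic_on_disk f ->
  slow_growth p f -> Fp p f.
Proof.
  intros Hp Hd Hf Hg. repeat split; auto. apply filterlim_locally. intros eps.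
  assert (He := cond_pos eps).
  destruct (Hg (eps / 2)) as (A & HA & HfA); [lra|].
  assert (HlA := ln_nonneg (A + 1) ltac:(lra)).
  destruct (Rpower_lt_near_0 (1 / p) (eps / 2 / (1 + ln (A + 1)))) as (d & Hd0 & Hpow);
    [apply Rdiv_lt_0_compat; lra | apply Rdiv_lt_0_compat; lra|].
  exists (mkposreal (Rmin 1 d) (Rmin_pos _ _ Rlt_0_1 Hd0)). intros r Hr Hr1.
  change (Rabs (r - 1) < Rmin 1 d) in Hr. rewrite Rabs_left in Hr by lra.
  destruct (Rmin_Rgt_l _ _ _ Hr) as [Hr2 Hr3].
  specialize (Hpow (1 - r) ltac:(lra)). assert (HP : 0 < Rpower (1 - r) (1 / p)) by apply exp_pos.
  change (Rabs (Rpower (1 - r) (1 / p) * log_plus (Minf r f) - 0) < eps).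
  rewrite Rminus_0_r, Rabs_pos_eq by (apply Rmult_le_pos; [lra | apply Rmax_r]).
  apply Rle_lt_trans with (Rpower (1 - r) (1 / p) * (ln (A + 1) + eps / 2 * growth_rate p r)).
  - apply Rmult_le_compat_l; [lra | apply log_plus_Minf_le; lra || auto].
  - replace (Rpower (1 - r) (1 / p) * (ln (A + 1) + eps / 2 * growth_rate p r))
      with (Rpower (1 - r) (1 / p) * ln (A + 1)
        + eps / 2 * (Rpower (1 - r) (1 / p) * growth_rate p r)) by ring.
    rewrite Rpower_growth_rate. apply Rlt_div_r in Hpow; lra.
Qed.

Definition restr (h : C -> C) (z : C) : C := if Rlt_dec (Cmod z) 1 then h z else RtoC 0.

Lemma restr_in (h : C -> C) (z : C) : disk z -> restr h z = h z.
Proof.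
  intros H. unfold restr. destruct (Rlt_dec (Cmod z) 1) as [_ | N]; [reflexivity | contradiction].
Qed.

Lemma restr_out (h : C -> C) (z : C) : ~ disk z -> restr h z = RtoC 0.
Proof.
  intros H. unfold restr. destruct (Rlt_dec (Cmod z) 1) as [N | _]; [contradiction | reflexivity].
Qed.

Lemma eq_on_disk (f g : C -> C) : on_disk f -> on_disk g -> (forall z, disk z -> f z = g z) ->
  f = g.
Proof.
  intros Hf Hg H. apply functional_extensionality. intros z.
  destruct (classic (disk z)) as [Hz | Hz]; [auto|]. rewrite Hf, Hg; auto.
Qed.

Lemma disk_open (z : C) : disk z -> exists r, 0 < r /\ forall y, Cmod (y - z) < r -> disk y.
Proof.
  unfold disk. intros H. exists (1 - Cmod z). split; [lra|].
  intros y Hy. assert (Htri := Cmod_minus_ge y z). lra.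
Qed.

Lemma holomorphic_restr (h : C -> C) : (forall z, disk z -> cderivable h z) ->
  holomorphic_on_disk (restr h).
Proof.
  intros Hh. apply holomorphic_on_disk_cderivable. intros z Hz.
  destruct (disk_open z Hz) as (r & Hr & Hdisk).
  apply (cderivable_ext_near h _ z r); auto. intros y Hy. symmetry. apply restr_in, Hdisk, Hy.
Qed.

Lemma Fp_restr (p : R) (h : C -> C) : 0 < p -> (forall z, disk z -> cderivable h z) ->
  slow_growth p h -> Fp p (restr h).
Proof.
  intros Hp Hh Hg. apply Fp_of_slow_growth; auto using holomorphic_restr.
  - intros z. apply restr_out.
  - intros eps He. destruct (Hg eps He) as (A & HA & H). exists A. split; auto.
    intros z Hz. rewrite restr_in; auto.
Qed.

Definition fscal (k : C) (f : C -> C) : C -> C := fun z => (k * f z)%C.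

Definition fone : C -> C := restr (fun _ => RtoC 1).

Ltac fun_ring := apply functional_extensionality; intros ?;
  unfold fsub, fadd, fmul, fscal, fzero; ring.

Lemma holomorphic_fadd (f g : C -> C) : holomorphic_on_disk f -> holomorphic_on_disk g ->
  holomorphic_on_disk (fadd f g).
Proof.
  rewrite !holomorphic_on_disk_cderivable. intros Hf Hg z Hz. apply cderivable_plus; auto.
Qed.

Lemma holomorphic_fmul (f g : C -> C) : holomorphic_on_disk f -> holomorphic_on_disk g ->
  holomorphic_on_disk (fmul f g).
Proof.
  rewrite !holomorphic_on_disk_cderivable. intros Hf Hg z Hz. apply cderivable_mult; auto.
Qed.

Lemma holomorphic_fscal (k : C) (f : C -> C) : holomorphic_on_disk f ->
  holomorphic_on_disk (fscal k f).
Proof.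
  rewrite !holomorphic_on_disk_cderivable. intros Hf z Hz.
  apply cderivable_mult; [apply cderivable_const | auto].
Qed.

Section FpAlgebra.

Variable p : R.
Hypothesis p_pos : 0 < p.

Lemma Fp_add (f g : C -> C) : Fp p f -> Fp p g -> Fp p (fadd f g).
Proof.
  intros Hf Hg. apply Fp_of_slow_growth; auto.
  - intros z Hz. unfold fadd. rewrite (proj1 Hf z Hz), (proj1 Hg z Hz). ring.
  - apply holomorphic_fadd; [apply Hf | apply Hg].
  - intros eps He. destruct (Fp_slow_growth p f Hf eps He) as (A & HA & HfA).
    destruct (Fp_slow_growth p g Hg eps He) as (B & HB & HgB).
    exists (A + B). split; [lra | apply growth_le_add; auto].
Qed.

Lemma Fp_mul (f g : C -> C) : Fp p f -> Fp p g -> Fp p (fmul f g).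
Proof.
  intros Hf Hg. apply Fp_of_slow_growth; auto.
  - intros z Hz. unfold fmul. rewrite (proj1 Hf z Hz). ring.
  - apply holomorphic_fmul; [apply Hf | apply Hg].
  - intros eps He. destruct (Fp_slow_growth p f Hf (eps / 2)) as (A & HA & HfA); [lra|].
    destruct (Fp_slow_growth p g Hg (eps / 2)) as (B & HB & HgB); [lra|].
    exists (A * B). split; [apply Rmult_le_pos; auto|].
    replace eps with (eps / 2 + eps / 2) by field. apply growth_le_mul; auto.
Qed.

Lemma Fp_bounded (h : C -> C) (A : R) : (forall z, disk z -> cderivable h z) ->
  (forall z, disk z -> Cmod (h z) <= A) -> Fp p (restr h).
Proof.
  intros Hh HA. assert (HA0 : 0 <= A).
  { eapply Rle_trans; [apply Cmod_ge_0 | apply (HA 0)]. unfold disk. rewrite Cmod_0. lra. }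
  apply Fp_restr; auto. intros eps He. exists A. split; auto. apply growth_le_bounded; lra || auto.
Qed.

Lemma Fp_const (k : C) : Fp p (restr (fun _ => k)).
Proof. apply Fp_bounded with (Cmod k); intros z _; [apply cderivable_const | lra]. Qed.

Lemma Fp_one : Fp p fone.
Proof. apply Fp_const. Qed.

Lemma fscal_fmul (k : C) (f : C -> C) : on_disk f -> fscal k f = fmul (restr (fun _ => k)) f.
Proof.
  intros Hf. apply eq_on_disk; unfold fscal, fmul; intros z Hz.
  - rewrite Hf by auto. ring.
  - rewrite Hf by auto. ring.
  - rewrite restr_in; auto.
Qed.

Lemma Fp_scal (k : C) (f : C -> C) : Fp p f -> Fp p (fscal k f).
Proof. intros Hf. rewrite fscal_fmul by apply Hf. apply Fp_mul; auto. apply Fp_const. Qed.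

Lemma fsub_fadd_fscal (f g : C -> C) : fsub f g = fadd f (fscal (- RtoC 1) g).
Proof. fun_ring. Qed.

Lemma Fp_sub (f g : C -> C) : Fp p f -> Fp p g -> Fp p (fsub f g).
Proof. intros Hf Hg. rewrite fsub_fadd_fscal. apply Fp_add; auto. apply Fp_scal; auto. Qed.

Lemma fmul_one (f : C -> C) : on_disk f -> fmul f fone = f.
Proof.
  intros Hf. apply eq_on_disk; auto; unfold fmul, fone; intros z Hz.
  - rewrite Hf by auto. ring.
  - rewrite restr_in by auto. ring.
Qed.

End FpAlgebra.

(** * Coefficient growth *)

Definition weight (p c : R) (n : nat) : R := exp (- c * nat_rpow n (1 / (p + 1))).

Lemma weight_pos (p c : R) (n : nat) : 0 < weight p c n.
Proof. apply exp_pos. Qed.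

Lemma weight_plus (p c d : R) (n : nat) : weight p (c + d) n = weight p c n * weight p d n.
Proof. unfold weight. rewrite <- exp_plus. f_equal. ring. Qed.

Lemma nat_rpow_nonneg (n : nat) (q : R) : 0 <= nat_rpow n q.
Proof. destruct n; simpl; [lra | left; apply exp_pos]. Qed.

Lemma weight_antitone (p c d : R) (n : nat) : c <= d -> weight p d n <= weight p c n.
Proof.
  intros H. apply exp_le_compat. assert (Hnpos := nat_rpow_nonneg n (1 / (p + 1))).
  assert (c * nat_rpow n (1 / (p + 1)) <= d * nat_rpow n (1 / (p + 1)))
    by (apply Rmult_le_compat_r; lra). lra.
Qed.

Lemma exp_ge_Rpower (y a : R) : 0 < y -> 0 < a -> Rpower (y / a) a <= exp y.
Proof.
  intros Hy Ha. assert (Hya : 0 < y / a) by (apply Rdiv_lt_0_compat; auto).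
  replace (exp y) with (Rpower (exp (y / a)) a)
    by (unfold Rpower; rewrite ln_exp; f_equal; field; lra).
  apply Rle_Rpower_l; [lra|]. split; auto. assert (Hexp := exp_ineq1 (y / a) ltac:(lra)). lra.
Qed.

Lemma ex_series_nonneg_bounded (u : nat -> R) (B : R) : (forall n, 0 <= u n) ->
  (forall N, sum_n u N <= B) -> ex_series u.
Proof.
  intros Hu HB. destruct (ex_finite_lim_seq_incr (sum_n u) B) as [l Hl]; auto.
  - intros n. rewrite sum_Sn. specialize (Hu (S n)). unfold plus; simpl. lra.
  - exists l. exact Hl.
Qed.

Lemma sum_n_le_Series (u : nat -> R) (N : nat) : (forall n, 0 <= u n) -> ex_series u ->
  sum_n u N <= Series u.
Proof.
  intros Hu He. apply (is_lim_seq_incr_compare (sum_n u)); [exact (Series_correct u He)|].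
  intros n. rewrite sum_Sn. specialize (Hu (S n)). unfold plus; simpl. lra.
Qed.

Lemma sum_n_nonneg (u : nat -> R) (N : nat) : (forall n, 0 <= u n) -> 0 <= sum_n u N.
Proof.
  intros Hu. induction N as [|N IH]; [rewrite sum_O; auto|].
  rewrite sum_Sn. specialize (Hu (S N)). unfold plus; simpl. lra.
Qed.

Lemma term_le_Series (u : nat -> R) (n : nat) : (forall n, 0 <= u n) -> ex_series u ->
  u n <= Series u.
Proof.
  intros Hu He. apply Rle_trans with (sum_n u n); [|apply sum_n_le_Series; auto].
  destruct n as [|n]; [rewrite sum_O; lra|]. rewrite sum_Sn.
  assert (Hpos := sum_n_nonneg u n Hu). unfold plus; simpl. lra.
Qed.

Lemma Series_nonneg (u : nat -> R) : (forall n, 0 <= u n) -> ex_series u -> 0 <= Series u.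
Proof. intros Hu He. eapply Rle_trans; [apply (Hu 0%nat) | apply (term_le_Series u 0); auto]. Qed.

Lemma ex_series_inv_consecutive : ex_series (fun n => / ((INR n + 1) * (INR n + 2))).
Proof.
  apply ex_series_nonneg_bounded with 1; intros N; assert (HN := pos_INR N).
  - left. apply Rinv_0_lt_compat, Rmult_lt_0_compat; lra.
  - assert (Htelescope : sum_n (fun n => / ((INR n + 1) * (INR n + 2))) N = 1 - / (INR N + 2)).
    { clear HN. induction N as [|N IH]; [rewrite sum_O; simpl; field|].
      rewrite sum_Sn, IH, S_INR. assert (HN := pos_INR N). unfold plus; simpl. field. lra. }
    rewrite Htelescope. assert (0 < / (INR N + 2)) by (apply Rinv_0_lt_compat; lra). lra.
Qed.

(* [exp y] dominates the power of [y] for which the terms decay like [/ n ^ 2]. *)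
Lemma ex_series_weight (p c : R) : 0 < p -> 0 < c -> ex_series (weight p c).
Proof.
  intros Hp Hc. apply ex_series_incr_1. set (q := 1 / (p + 1)). set (a := 2 * (p + 1)).
  set (K := Rpower (c / a) a).
  assert (Hca : 0 < c / a) by (apply Rdiv_lt_0_compat; unfold a; lra).
  assert (HK : 0 < K) by apply exp_pos.
  apply (@ex_series_le R_AbsRing R_CompleteNormedModule)
    with (b := fun n => 2 / K * / ((INR n + 1) * (INR n + 2)));
    [|apply (@ex_series_scal R_AbsRing R_NormedModule), ex_series_inv_consecutive].
  intros n. change (Rabs (weight p c (S n)) <= 2 / K * / ((INR n + 1) * (INR n + 2))).
  rewrite Rabs_pos_eq by (left; apply weight_pos).
  assert (Hn := pos_INR n). set (x := INR (S n)). assert (Ex : x = INR n + 1) by apply S_INR.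
  assert (Hlower : K * (x * x) <= exp (c * Rpower x q)).
  { assert (Hexp := exp_ge_Rpower (c * Rpower x q) a
      ltac:(apply Rmult_lt_0_compat; auto; apply exp_pos) ltac:(unfold a; lra)).
    replace (c * Rpower x q / a) with (c / a * Rpower x q) in Hexp by (field; unfold a; lra).
    rewrite <- Rpower_mult_distr, Rpower_mult in Hexp by (auto; apply exp_pos).
    replace (q * a) with (INR 2) in Hexp by (simpl; unfold q, a; field; lra).
    rewrite Rpower_pow in Hexp by lra. simpl in Hexp. rewrite Rmult_1_r in Hexp. exact Hexp. }
  assert (Hweight : weight p c (S n) = / exp (c * Rpower x q)).
  { unfold weight. change (nat_rpow (S n) (1 / (p + 1))) with (Rpower x q). rewrite <- exp_Ropp.
    f_equal. ring. }
  rewrite Hweight. apply Rle_trans with (/ (K * (x * x))).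
  - apply Rinv_le_contravar; auto. repeat apply Rmult_lt_0_compat; lra.
  - rewrite Ex. replace (2 / K * / ((INR n + 1) * (INR n + 2)))
      with (/ (K * ((INR n + 1) * (INR n + 1))) * (2 * (INR n + 1) / (INR n + 2))) by (field; lra).
    rewrite <- (Rmult_1_r (/ (K * _))) at 1. apply Rmult_le_compat_l.
    + left. apply Rinv_0_lt_compat. repeat apply Rmult_lt_0_compat; lra.
    + apply Rle_div_r; lra.
Qed.

Lemma Cmod_coeffs_le (p eps A r : R) (f : C -> C) (n : nat) : holomorphic_on_disk f ->
  growth_le p eps A f -> 0 < r < 1 -> Cmod (coeffs f n) <= A * exp (eps * growth_rate p r) / r ^ n.
Proof.
  intros Hf HA Hr. rewrite (coeffs_taylor_coeff f r) by auto. apply Cmod_taylor_coeff_le; auto.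
  intros z Hz. rewrite <- Hz. apply HA. unfold disk. lra.
Qed.

Lemma inv_pow_le_exp (d : R) (n : nat) : 0 < d <= 1 / 2 -> / (1 - d) ^ n <= exp (2 * (INR n * d)).
Proof.
  intros Hd. induction n as [|n IH].
  - simpl. rewrite Rmult_0_l, Rmult_0_r, exp_0. lra.
  - replace (2 * (INR (S n) * d)) with (2 * d + 2 * (INR n * d)) by (rewrite S_INR; ring).
    rewrite exp_plus. simpl. rewrite Rinv_mult.
    apply Rmult_le_compat; auto; try (left; apply Rinv_0_lt_compat, pow_lt; lra);
      [left; apply Rinv_0_lt_compat; lra|].
    apply Rle_trans with (1 + 2 * d); [|left; apply exp_ineq1; lra].
    apply Rmult_le_reg_l with (1 - d); [lra|]. rewrite Rinv_r by lra.
    assert (0 <= d * (1 - 2 * d)) by (apply Rmult_le_pos; lra). lra.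
Qed.

(* The radius [1 - d] with [d = k * n ^ (- p / (p + 1))] balances [INR n * d] against the growth rate:
   both are of order [n ^ (1 / (p + 1))]. *)
Lemma exists_cauchy_radius (p k : R) (n : nat) : 0 < p -> 0 < k ->
  exists d, 0 < d <= k /\ INR n * d = k * nat_rpow n (1 / (p + 1)) /\
    growth_rate p (1 - d) <= growth_rate p (1 - k) * (1 + nat_rpow n (1 / (p + 1))).
Proof.
  intros Hp Hk. assert (HR : 0 < growth_rate p (1 - k)) by apply growth_rate_pos.
  destruct n as [|n]; [exists k; simpl; repeat split; lra|].
  set (x := INR (S n)). change (nat_rpow (S n) (1 / (p + 1))) with (Rpower x (1 / (p + 1))).
  assert (Hx : 1 <= x) by (apply (le_INR 1); lia).
  exists (k * Rpower x (- (p / (p + 1)))). repeat split.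
  - apply Rmult_lt_0_compat; [auto | apply exp_pos].
  - rewrite <- (Rmult_1_r k) at 2. apply Rmult_le_compat_l; [lra|].
    apply Rle_trans with (Rpower x 0); [|rewrite Rpower_O; lra]. apply Rle_Rpower; [auto|].
    assert (0 < p / (p + 1)) by (apply Rdiv_lt_0_compat; lra). lra.
  - replace (1 / (p + 1)) with (1 + - (p / (p + 1))) by (field; lra).
    rewrite Rpower_plus, Rpower_1 by lra. ring.
  - unfold growth_rate in *. replace (1 - (1 - k)) with k in * by ring.
    replace (1 - (1 - k * Rpower x (- (p / (p + 1))))) with (k * Rpower x (- (p / (p + 1))))
      by ring.
    rewrite <- Rpower_mult_distr, Rpower_mult by (auto; apply exp_pos).
    replace (- (p / (p + 1)) * - (1 / p)) with (1 / (p + 1)) by (field; lra).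
    apply Rmult_le_compat_l; lra.
Qed.

Lemma coeffs_weight_le (p c : R) : 0 < p -> 0 < c ->
  exists eps K, 0 < eps /\ 0 < K /\ forall A f n, holomorphic_on_disk f -> 0 <= A ->
    growth_le p eps A f ->
    Cmod (coeffs f n) * weight p c n <= K * A.
Proof.
  intros Hp Hc. set (k := Rmin (c / 4) (1 / 2)).
  assert (Hk0 : 0 < k) by (apply Rmin_pos; lra).
  assert (Hk1 : k <= c / 4) by apply Rmin_l. assert (Hk2 : k <= 1 / 2) by apply Rmin_r.
  assert (HR : 0 < growth_rate p (1 - k)) by apply growth_rate_pos.
  set (eps := c / 2 / growth_rate p (1 - k)).
  assert (He : 0 < eps) by (unfold eps; repeat apply Rdiv_lt_0_compat; lra).
  exists eps, (exp (c / 2)). repeat split; [auto | apply exp_pos|]. intros A f n Hf HA HfA.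
  destruct (exists_cauchy_radius p k n Hp Hk0) as (d & Hd & Hnd & Hrate).
  set (N := nat_rpow n (1 / (p + 1))) in *. assert (HN : 0 <= N) by apply nat_rpow_nonneg.
  assert (Hcoef : Cmod (coeffs f n) <= A * exp (c / 2 * (1 + N)) * exp (c / 2 * N)).
  { eapply Rle_trans; [apply (Cmod_coeffs_le p eps A (1 - d)); auto; lra|].
    apply Rmult_le_compat.
    - apply Rmult_le_pos; [auto | left; apply exp_pos].
    - left. apply Rinv_0_lt_compat, pow_lt. lra.
    - apply Rmult_le_compat_l; auto. apply exp_le_compat.
      apply Rle_trans with (eps * (growth_rate p (1 - k) * (1 + N)));
        [apply Rmult_le_compat_l; lra|].
      right. unfold eps. field. lra.
    - eapply Rle_trans; [apply inv_pow_le_exp; lra|]. rewrite Hnd. apply exp_le_compat.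
      assert (k * N <= c / 4 * N) by (apply Rmult_le_compat_r; auto). lra. }
  replace (exp (c / 2) * A) with (A * exp (c / 2 * (1 + N)) * exp (c / 2 * N) * weight p c n).
  - apply Rmult_le_compat_r; [left; apply weight_pos | exact Hcoef].
  - unfold weight. fold N. rewrite !Rmult_assoc, <- !exp_plus, Rmult_comm. f_equal. f_equal. field.
Qed.

Lemma coeffs_fadd (f g : C -> C) (n : nat) : holomorphic_on_disk f -> holomorphic_on_disk g ->
  coeffs (fadd f g) n = (coeffs f n + coeffs g n)%C.
Proof.
  intros Hf Hg. assert (Hr : 0 < 1 / 2 < 1) by lra.
  rewrite !(coeffs_taylor_coeff _ (1 / 2)), taylor_coeff_plus; auto using holomorphic_fadd.
Qed.

Lemma coeffs_fscal (k : C) (f : C -> C) (n : nat) : holomorphic_on_disk f ->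
  coeffs (fscal k f) n = (k * coeffs f n)%C.
Proof.
  intros Hf. assert (Hr : 0 < 1 / 2 < 1) by lra.
  rewrite !(coeffs_taylor_coeff _ (1 / 2)); auto using holomorphic_fscal.
  apply taylor_coeff_scal; auto.
Qed.

Section WeightedInnerProduct.

Variables p c : R.
Hypothesis p_pos : 0 < p.
Hypothesis c_pos : 0 < c.

Definition inner_term (f g : C -> C) (n : nat) : R :=
  Re (coeffs f n * Cconj (coeffs g n)) * weight p c n.

Definition inner (f g : C -> C) : R := Series (inner_term f g).

Lemma Fp_coeffs_weight_bounded (f : C -> C) (d : R) : 0 < d -> Fp p f ->
  exists A, 0 <= A /\ forall n, Cmod (coeffs f n) * weight p d n <= A.
Proof.
  intros Hd Hf. destruct (coeffs_weight_le p d p_pos Hd) as (eps & K & He & HK & H).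
  destruct (Fp_slow_growth p f Hf eps He) as (A & HA & HfA).
  exists (K * A). split; [apply Rmult_le_pos; lra|]. intros n. apply H; auto. apply Hf.
Qed.

Lemma Rabs_inner_term_le (f g : C -> C) (A B : R) (n : nat) :
  Cmod (coeffs f n) * weight p (c / 4) n <= A -> Cmod (coeffs g n) * weight p (c / 4) n <= B ->
  Rabs (inner_term f g n) <= A * B * weight p (c / 2) n.
Proof.
  intros Hf Hg. unfold inner_term.
  rewrite Rabs_mult, (Rabs_pos_eq (weight p c n)) by (left; apply weight_pos).
  assert (Hw4 := weight_pos p (c / 4) n). assert (Hw2 := weight_pos p (c / 2) n).
  replace c with (c / 4 + c / 4 + c / 2) at 1 by field. rewrite !weight_plus.
  rewrite <- Rmult_assoc. apply Rmult_le_compat_r; [lra|].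
  apply Rle_trans
    with (Cmod (coeffs f n) * weight p (c / 4) n * (Cmod (coeffs g n) * weight p (c / 4) n)).
  - replace (Cmod (coeffs f n) * weight p (c / 4) n * (Cmod (coeffs g n) * weight p (c / 4) n))
      with (Cmod (coeffs f n) * Cmod (coeffs g n) * (weight p (c / 4) n * weight p (c / 4) n))
        by ring.
    apply Rmult_le_compat_r; [apply Rmult_le_pos; lra|].
    eapply Rle_trans; [apply re_le_Cmod|]. rewrite Cmod_mult, Cmod_conj. lra.
  - apply Rmult_le_compat; auto; (apply Rmult_le_pos; [apply Cmod_ge_0 | lra]).
Qed.

Lemma ex_series_inner (f g : C -> C) : Fp p f -> Fp p g -> ex_series (inner_term f g).
Proof.
  intros Hf Hg.
  destruct (Fp_coeffs_weight_bounded f (c / 4)) as (A & HA & HfA); [lra | auto |].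
  destruct (Fp_coeffs_weight_bounded g (c / 4)) as (B & HB & HgB); [lra | auto |].
  apply (@ex_series_le R_AbsRing R_CompleteNormedModule)
    with (b := fun n => A * B * weight p (c / 2) n).
  - intros n. apply Rabs_inner_term_le; auto.
  - apply (@ex_series_scal R_AbsRing R_NormedModule), ex_series_weight; lra.
Qed.

Lemma inner_add_l (f g h : C -> C) : Fp p f -> Fp p g -> Fp p h ->
  inner (fadd f g) h = inner f h + inner g h.
Proof.
  intros Hf Hg Hh. unfold inner. rewrite <- Series_plus by (apply ex_series_inner; auto).
  apply Series_ext. intros n. unfold inner_term.
  rewrite coeffs_fadd, Cmult_plus_distr_r, re_plus by (apply Hf || apply Hg). ring.
Qed.

Lemma inner_scal_l (t : R) (f g : C -> C) : Fp p f -> inner (fscal t f) g = t * inner f g.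
Proof.
  intros Hf. unfold inner. rewrite <- Series_scal_l. apply Series_ext. intros n. unfold inner_term.
  rewrite coeffs_fscal, <- Cmult_assoc, re_scal_l by apply Hf. ring.
Qed.

Lemma inner_sym (f g : C -> C) : inner f g = inner g f.
Proof.
  apply Series_ext. intros n. unfold inner_term. rewrite !re_mult, !re_conj, !im_conj. ring.
Qed.

Lemma inner_term_self (f : C -> C) (n : nat) :
  inner_term f f n = Cmod (coeffs f n) ^ 2 * weight p c n.
Proof. unfold inner_term. rewrite <- Cmod2_conj, re_RtoC. reflexivity. Qed.

Lemma inner_term_self_nonneg (f : C -> C) (n : nat) : 0 <= inner_term f f n.
Proof. rewrite inner_term_self. apply Rmult_le_pos; [apply pow2_ge_0 | left; apply weight_pos]. Qed.

Lemma inner_self_nonneg (f : C -> C) : Fp p f -> 0 <= inner f f.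
Proof.
  intros Hf. apply Series_nonneg; [apply inner_term_self_nonneg | apply ex_series_inner; auto].
Qed.

Definition weight_sum : R := Series (weight p (c / 2)).

Lemma weight_sum_nonneg : 0 <= weight_sum.
Proof. apply Series_nonneg; [intros n; left; apply weight_pos | apply ex_series_weight; lra]. Qed.

Lemma seminorm_le_sqrt_inner (d : R) (f : C -> C) : c <= d -> Fp p f ->
  Rbar_le (seminorm p d f) (sqrt (inner f f) * weight_sum).
Proof.
  intros Hcd Hf. assert (He := ex_series_inner f f Hf Hf).
  assert (Hw : ex_series (weight p (c / 2))) by (apply ex_series_weight; lra).
  assert (Hterm :
    forall n, Cmod (coeffs f n) * weight p d n <= sqrt (inner f f) * weight p (c / 2) n).
  { intros n. assert (Hwpos := weight_pos p (c / 2) n). assert (Hpos := Cmod_ge_0 (coeffs f n)).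
    apply Rle_trans with (Cmod (coeffs f n) * weight p (c / 2) n * weight p (c / 2) n).
    - rewrite Rmult_assoc, <- weight_plus. apply Rmult_le_compat_l; auto. apply weight_antitone.
      lra.
    - apply Rmult_le_compat_r; [lra|].
      rewrite <- (sqrt_square (Cmod (coeffs f n) * weight p (c / 2) n))
        by (apply Rmult_le_pos; lra).
      apply sqrt_le_1_alt.
      eapply Rle_trans; [|apply (term_le_Series _ n (inner_term_self_nonneg f) He)].
      rewrite inner_term_self. right. replace c with (c / 2 + c / 2) at 3 by field.
      rewrite weight_plus. ring. }
  unfold seminorm. rewrite <- (Lim_seq_const (sqrt (inner f f) * weight_sum)).
  apply Lim_seq_le_loc. exists 0%nat. intros N _.
  apply Rle_trans with (sum_n (fun n => scal (sqrt (inner f f)) (weight p (c / 2) n)) N).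
  - apply sum_n_m_le. exact Hterm.
  - rewrite (sum_n_scal_l (K := R_AbsRing) (V := R_NormedModule)).
    apply Rmult_le_compat_l; [apply sqrt_pos|].
    apply sum_n_le_Series; auto. intros n. left. apply weight_pos.
Qed.

Lemma inner_self_le_growth : exists eps K, 0 < eps /\ 0 <= K /\
  forall A f, Fp p f -> 0 <= A -> growth_le p eps A f -> inner f f <= K * (A * A).
Proof.
  destruct (coeffs_weight_le p (c / 4) p_pos ltac:(lra)) as (eps & K & He & HK & H).
  assert (HW := weight_sum_nonneg).
  exists eps, (K * K * weight_sum). split; auto. split; [repeat apply Rmult_le_pos; lra|].
  intros A f Hf HA HfA.
  replace (K * K * weight_sum * (A * A)) with (K * A * (K * A) * weight_sum) by ring.
  unfold inner, weight_sum. rewrite <- Series_scal_l. apply Series_le.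
  - intros n. split; [apply inner_term_self_nonneg|].
    eapply Rle_trans; [apply Rle_abs | apply Rabs_inner_term_le]; apply H; auto; apply Hf.
  - apply (@ex_series_scal R_AbsRing R_NormedModule), ex_series_weight; lra.
Qed.

End WeightedInnerProduct.

(** * Orthogonal projection in a semi-inner product space *)

Lemma quadratic_nonneg_discriminant (a b c : R) : 0 <= a ->
  (forall t, 0 <= a * (t * t) + 2 * t * b + c) -> b * b <= a * c.
Proof.
  intros [Ha | <-] H.
  - specialize (H (- b / a)). apply (Rmult_le_compat_l a) in H; [|lra].
    replace (a * (a * (- b / a * (- b / a)) + 2 * (- b / a) * b + c)) with (a * c - b * b) in H
      by (field; lra). lra.
  - destruct (Req_dec b 0) as [-> | Hb]; [lra|]. specialize (H ((- c - 1) / (2 * b))).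
    replace (0 * ((- c - 1) / (2 * b) * ((- c - 1) / (2 * b))) + 2 * ((- c - 1) / (2 * b)) * b + c)
      with (- (1)) in H by (field; lra).
    lra.
Qed.

Lemma is_lim_seq_eq (u : nat -> R) (a b : R) : is_lim_seq u a -> is_lim_seq u b -> a = b.
Proof. intros Ha Hb. apply is_lim_seq_unique in Ha. apply is_lim_seq_unique in Hb. congruence. Qed.

Record subspace (V : Type) (add : V -> V -> V) (scal : R -> V -> V) (F : V -> Prop) : Prop := {
  subspace_inhabited : exists x, F x;
  subspace_add : forall x y, F x -> F y -> F (add x y);
  subspace_scal : forall t x, F x -> F (scal t x) }.

Record semi_inner_product (V : Type) (add : V -> V -> V) (scal : R -> V -> V) (F : V -> Prop)
    (B : V -> V -> R) : Prop := {
  sip_add_l : forall x y z, F x -> F y -> F z -> B (add x y) z = B x z + B y z;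
  sip_scal_l : forall t x y, F x -> F y -> B (scal t x) y = t * B x y;
  sip_sym : forall x y, F x -> F y -> B x y = B y x;
  sip_nonneg : forall x, F x -> 0 <= B x x }.

Section OrthogonalProjection.

Variables (V : Type) (add : V -> V -> V) (scal : R -> V -> V) (F : V -> Prop) (B : V -> V -> R).
Hypothesis F_subspace : subspace V add scal F.
Hypothesis B_sip : semi_inner_product V add scal F B.

Let F_add := subspace_add V add scal F F_subspace.
Let F_scal := subspace_scal V add scal F F_subspace.
Let B_add_l := sip_add_l V add scal F B B_sip.
Let B_scal_l := sip_scal_l V add scal F B B_sip.
Let B_sym := sip_sym V add scal F B B_sip.
Let B_nonneg := sip_nonneg V add scal F B B_sip.

Lemma sip_add_r (x y z : V) : F x -> F y -> F z -> B x (add y z) = B x y + B x z.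
Proof. intros Fx Fy Fz. rewrite B_sym, B_add_l, (B_sym y), (B_sym z); auto. Qed.

Lemma sip_scal_r (t : R) (x y : V) : F x -> F y -> B x (scal t y) = t * B x y.
Proof. intros Fx Fy. rewrite B_sym, B_scal_l, (B_sym y); auto. Qed.

Lemma sip_add_scal_self (t : R) (x y : V) : F x -> F y ->
  B (add y (scal t x)) (add y (scal t x)) = B x x * (t * t) + 2 * t * B x y + B y y.
Proof.
  intros Fx Fy. rewrite sip_add_r, !B_add_l, !sip_scal_r, !B_scal_l, (B_sym y x) by auto. ring.
Qed.

Lemma sip_cauchy_schwarz (x y : V) : F x -> F y -> B x y * B x y <= B x x * B y y.
Proof.
  intros Fx Fy. apply quadratic_nonneg_discriminant; auto. intros t.
  rewrite <- sip_add_scal_self by auto. auto.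
Qed.

Variables (M : V -> Prop) (e : V) (D : R).
Hypothesis M_subspace : subspace V add scal M.
Hypothesis M_sub_F : forall m, M m -> F m.
Hypothesis F_e : F e.
Hypothesis D_le : forall m, M m -> D <= B (add e m) (add e m).

Let M_add := subspace_add V add scal M M_subspace.
Let M_scal := subspace_scal V add scal M M_subspace.

Lemma near_minimizer_almost_orthogonal (m n : V) (delta : R) : M m -> M n ->
  B (add e n) (add e n) <= D + delta -> B m (add e n) * B m (add e n) <= B m m * delta.
Proof.
  intros Mm Mn Hn.
  apply quadratic_nonneg_discriminant; auto. intros t.
  assert (Hexpand : B (add e (add n (scal t m))) (add e (add n (scal t m)))
      = B m m * (t * t) + 2 * t * B m (add e n) + B (add e n) (add e n)).
  { rewrite <- sip_add_scal_self by auto.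
    rewrite !sip_add_r, !B_add_l by auto. ring. }
  assert (Hdist := D_le (add n (scal t m)) ltac:(auto)). lra.
Qed.

Lemma near_minimizers_close (m n : V) (delta : R) : M m -> M n ->
  B (add e m) (add e m) <= D + delta -> B (add e n) (add e n) <= D + delta ->
  B (add m (scal (-1) n)) (add m (scal (-1) n)) <= 4 * delta.
Proof.
  intros Mm Mn Hm Hn.
  set (k := add m (scal (-1) n)). assert (Mk : M k) by (unfold k; auto).
  assert (Fk := M_sub_F k Mk).
  assert (Om := near_minimizer_almost_orthogonal k m delta Mk Mm Hm).
  assert (On := near_minimizer_almost_orthogonal k n delta Mk Mn Hn).
  assert (Hself : B k k = B k (add e m) - B k (add e n)).
  { rewrite !sip_add_r by auto. unfold k at 2. rewrite sip_add_r, sip_scal_r by auto. ring. }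
  assert (Pk := B_nonneg k Fk). set (u := B k (add e m)) in *. set (v := B k (add e n)) in *.
  assert (Hsq : B k k * B k k <= B k k * (4 * delta)).
  { rewrite Hself at 1 2. assert (0 <= (u + v) * (u + v)) by apply Rle_0_sqr. lra. }
  destruct Pk as [Pk | Pk]; [apply Rmult_le_reg_l with (B k k); auto|].
  rewrite <- Pk. assert (Hdist := D_le m Mm). lra.
Qed.

Lemma exists_near_minimizer (delta : R) : 0 < delta ->
  (forall t, (forall m, M m -> t <= B (add e m) (add e m)) -> t <= D) ->
  exists m, M m /\ B (add e m) (add e m) <= D + delta.
Proof.
  intros Hd Hglb. apply NNPP. intros HN.
  assert (Hle : D + delta <= D); [|lra]. apply Hglb. intros m Mm. apply Rnot_lt_le. intros Hlt.
  apply HN. exists m. split; auto. lra.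
Qed.

Variable s : nat -> V.
Hypothesis s_minimizing : forall k, M (s k) /\ B (add e (s k)) (add e (s k)) <= D + (/ 2) ^ k.

Let M_s (k : nat) : M (s k) := proj1 (s_minimizing k).
Let F_s (k : nat) : F (s k) := M_sub_F (s k) (M_s k).

Lemma minimizing_close (N k l : nat) : (N <= k)%nat -> (N <= l)%nat ->
  B (add (s k) (scal (-1) (s l))) (add (s k) (scal (-1) (s l))) <= 4 * (/ 2) ^ N.
Proof.
  intros Hk Hl.
  assert (Hle : forall j, (N <= j)%nat -> B (add e (s j)) (add e (s j)) <= D + (/ 2) ^ N).
  { intros j Hj. eapply Rle_trans; [apply s_minimizing|].
    apply Rplus_le_compat_l, half_pow_antitone, Hj. }
  apply near_minimizers_close; auto.
Qed.

Definition projection_functional (x : V) : R := real (Lim_seq (fun k => B x (add e (s k)))).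

Lemma is_lim_seq_projection_functional (x : V) : F x ->
  is_lim_seq (fun k => B x (add e (s k))) (projection_functional x).
Proof.
  intros Fx. apply Lim_seq_correct'. apply ex_lim_seq_cauchy_corr.
  intros eps. assert (He := cond_pos eps). assert (Bx := B_nonneg x Fx).
  assert (Hq : 0 < eps * eps / (4 * (B x x + 1)))
    by (apply Rdiv_lt_0_compat; [apply Rmult_lt_0_compat|]; lra).
  destruct (half_pow_eventually_lt _ Hq) as [N HN]. exists N. intros k l Hk Hl.
  specialize (HN N (Nat.le_refl N)). set (n := add (s k) (scal (-1) (s l))).
  assert (Fn : F n) by (unfold n; auto).
  replace (B x (add e (s k)) - B x (add e (s l))) with (B x n)
    by (unfold n; rewrite !sip_add_r, sip_scal_r by auto; ring).
  rewrite <- (Rabs_pos_eq eps) by lra. apply Rsqr_lt_abs_0. unfold Rsqr.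
  eapply Rle_lt_trans; [apply sip_cauchy_schwarz; auto|].
  apply Rle_lt_trans with (B x x * (4 * (/ 2) ^ N)).
  - apply Rmult_le_compat_l; auto. apply minimizing_close; auto.
  - apply Rle_lt_trans with ((B x x + 1) * (4 * (/ 2) ^ N)).
    + apply Rmult_le_compat_r; [|lra]. assert (Hhalf := half_pow_pos N). lra.
    + apply Rlt_div_r in HN; lra.
Qed.

Lemma projection_functional_add (x y : V) : F x -> F y ->
  projection_functional (add x y) = projection_functional x + projection_functional y.
Proof.
  intros Fx Fy. apply (is_lim_seq_eq (fun k => B (add x y) (add e (s k)))).
  - apply is_lim_seq_projection_functional. auto.
  - apply (is_lim_seq_ext (fun k => B x (add e (s k)) + B y (add e (s k)))).
    + intros k. rewrite B_add_l; auto.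
    + apply is_lim_seq_plus'; apply is_lim_seq_projection_functional; auto.
Qed.

Lemma projection_functional_scal (t : R) (x : V) : F x ->
  projection_functional (scal t x) = t * projection_functional x.
Proof.
  intros Fx. apply (is_lim_seq_eq (fun k => B (scal t x) (add e (s k)))).
  - apply is_lim_seq_projection_functional. auto.
  - apply (is_lim_seq_ext (fun k => t * B x (add e (s k)))).
    + intros k. rewrite B_scal_l; auto.
    + apply (is_lim_seq_scal_l _ t (projection_functional x)), is_lim_seq_projection_functional, Fx.
Qed.

Lemma projection_functional_sqr_le (x : V) : F x ->
  projection_functional x * projection_functional x <= (D + 1) * B x x.
Proof.
  intros Fx. assert (Hlim := is_lim_seq_projection_functional x Fx).
  apply (is_lim_seq_le (fun k => B x (add e (s k)) * B x (add e (s k))) (fun _ => (D + 1) * B x x)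
           (projection_functional x * projection_functional x) ((D + 1) * B x x)).
  - intros k. eapply Rle_trans; [apply sip_cauchy_schwarz; auto|]. rewrite Rmult_comm.
    apply Rmult_le_compat_r; auto. eapply Rle_trans; [apply s_minimizing|].
    assert (Hhalf := half_pow_antitone 0 k ltac:(lia)). simpl in Hhalf. lra.
  - apply is_lim_seq_mult'; exact Hlim.
  - apply is_lim_seq_const.
Qed.

Lemma projection_functional_annihilates (m : V) : M m -> projection_functional m = 0.
Proof.
  intros Mm. assert (Hlim := is_lim_seq_projection_functional m (M_sub_F m Mm)).
  apply Rsqr_eq_0, Rle_antisym; [|apply Rle_0_sqr].
  apply (is_lim_seq_le (fun k => B m (add e (s k)) * B m (add e (s k))) (fun k => (/ 2) ^ k * B m m)
           (projection_functional m * projection_functional m) 0).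
  - intros k. rewrite (Rmult_comm (_ ^ k)). apply near_minimizer_almost_orthogonal; auto.
    apply s_minimizing.
  - apply is_lim_seq_mult'; exact Hlim.
  - apply is_lim_seq_half_pow_mult.
Qed.

(* The functional does not change when [e] is replaced by [e + m] with [m] in [M]; for a nearly
   minimal [e + m] it is nearly the limit of the squared distances. *)
Lemma projection_functional_pos : 0 < D -> 0 < projection_functional e.
Proof.
  intros HD. destruct (half_pow_eventually_lt (D / 8) ltac:(lra)) as [N HN].
  specialize (HN N (Nat.le_refl N)).
  apply Rlt_le_trans with (D / 2); [lra|].
  replace (projection_functional e) with (projection_functional (add e (s N)))
    by (rewrite projection_functional_add, (projection_functional_annihilates (s N)) by auto; ring).
  apply (is_lim_seq_le_loc (fun _ => D / 2) (fun k => B (add e (s N)) (add e (s k)))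
           (D / 2) (projection_functional (add e (s N)))).
  - exists N. intros k Hk. assert (Hclose := minimizing_close N N k (Nat.le_refl N) Hk).
    assert (Hpolar : B (add (s N) (scal (-1) (s k))) (add (s N) (scal (-1) (s k)))
      = B (add e (s N)) (add e (s N)) + B (add e (s k)) (add e (s k))
        - 2 * B (add e (s N)) (add e (s k))).
    { rewrite !sip_add_r, !B_add_l, !sip_scal_r, !B_scal_l by auto.
      rewrite (B_sym (s N) e), (B_sym (s k) e), (B_sym (s k) (s N)) by auto. ring. }
    assert (HsN := D_le (s N) ltac:(auto)). assert (Hsk := D_le (s k) ltac:(auto)). lra.
  - apply is_lim_seq_const.
  - apply is_lim_seq_projection_functional. auto.
Qed.

End OrthogonalProjection.

Lemma exists_glb (E : R -> Prop) (d : R) : (exists x, E x) -> (forall x, E x -> d <= x) ->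
  exists D, d <= D /\ (forall x, E x -> D <= x) /\ forall t, (forall x, E x -> t <= x) -> t <= D.
Proof.
  intros [x0 Ex0] Hd. destruct (completeness (fun y => E (- y))) as [b [Hub Hlub]].
  - exists (- d). intros y Ey. specialize (Hd _ Ey). lra.
  - exists (- x0). rewrite Ropp_involutive. exact Ex0.
  - exists (- b).
    assert (Hglb : forall t, (forall x, E x -> t <= x) -> t <= - b).
    { intros t Ht. assert (b <= - t) by (apply Hlub; intros y Ey; specialize (Ht _ Ey); lra). lra. }
    split; [apply Hglb, Hd|]. split; [|exact Hglb]. intros x Ex.
    assert (- x <= b) by (apply Hub; rewrite Ropp_involutive; exact Ex). lra.
Qed.

Lemma separating_functional (V : Type) (add : V -> V -> V) (scal : R -> V -> V) (F M : V -> Prop)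
  (B : V -> V -> R) (e : V) (d : R) :
  subspace V add scal F -> semi_inner_product V add scal F B -> subspace V add scal M ->
  (forall m, M m -> F m) -> F e -> 0 < d -> (forall m, M m -> d <= B (add e m) (add e m)) ->
  exists rho : V -> R,
    (forall x y, F x -> F y -> rho (add x y) = rho x + rho y) /\
    (forall t x, F x -> rho (scal t x) = t * rho x) /\
    (forall m, M m -> rho m = 0) /\ 0 < rho e /\
    exists K, 0 <= K /\ forall x, F x -> rho x * rho x <= K * B x x.
Proof.
  intros HF HB HM MF Fe Hd Hdist.
  destruct (exists_glb (fun v => exists m, M m /\ v = B (add e m) (add e m)) d) as
    (D & HdD & Hle & Hglb).
  { destruct HM as [[m Mm] _ _]. exists (B (add e m) (add e m)), m. auto. }
  { intros v (m & Mm & ->). auto. }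
  assert (D_le : forall m, M m -> D <= B (add e m) (add e m))
    by (intros m Mm; apply Hle; exists m; auto).
  assert (Hmin : forall k : nat, exists m, M m /\ B (add e m) (add e m) <= D + (/ 2) ^ k).
  { intros k. apply (exists_near_minimizer V add B M e D); [apply half_pow_pos|].
    intros t Ht. apply Hglb. intros v (m & Mm & ->). auto. }
  set (s := fun k => proj1_sig (constructive_indefinite_description _ (Hmin k))).
  assert (Hs : forall k, M (s k) /\ B (add e (s k)) (add e (s k)) <= D + (/ 2) ^ k)
    by (intros k; exact (proj2_sig (constructive_indefinite_description _ (Hmin k)))).
  exists (projection_functional V add B e s). repeat split.
  - apply (projection_functional_add V add scal F B HF HB M e D); auto.
  - apply (projection_functional_scal V add scal F B HF HB M e D); auto.
  - apply (projection_functional_annihilates V add scal F B HF HB M e D); auto.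
  - apply (projection_functional_pos V add scal F B HF HB M e D); auto. lra.
  - exists (D + 1). split; [lra|].
    apply (projection_functional_sqr_le V add scal F B HF HB M e D); auto.
Qed.

(** * A continuous functional annihilating a closed ideal *)

Record annihilating_functional (p : R) (M : (C -> C) -> Prop) (phi : (C -> C) -> C) : Prop := {
  functional_add : forall f g, Fp p f -> Fp p g -> phi (fadd f g) = (phi f + phi g)%C;
  functional_scal : forall k f, Fp p f -> phi (fscal k f) = (k * phi f)%C;
  functional_annihilates : forall m, M m -> phi m = RtoC 0;
  functional_one : phi fone <> RtoC 0;
  functional_bounded : exists eps K, 0 < eps /\ 0 <= K /\
    forall A f, Fp p f -> 0 <= A -> growth_le p eps A f -> Cmod (phi f) <= K * A }.

Lemma list_pos_lower_bound (l : list R) : (forall c, In c l -> 0 < c) ->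
  exists m, 0 < m /\ forall c, In c l -> m <= c.
Proof.
  induction l as [|x l IH]; intros H.
  - exists 1. split; [lra|]. intros c [].
  - destruct IH as (m & Hm & Hml); [intros c Hc; apply H; right; auto|].
    exists (Rmin x m). split; [apply Rmin_pos; auto; apply H; left; auto|].
    intros c [<- | Hc]; [apply Rmin_l | eapply Rle_trans; [apply Rmin_r | auto]].
Qed.

Definition complexification (rho : (C -> C) -> R) (f : C -> C) : C := (rho f, - rho (fscal Ci f)).

Section Functional.

Variable p : R.
Hypothesis p_pos : 0 < p.

Section Complexification.

Variable rho : (C -> C) -> R.
Hypothesis rho_add : forall f g, Fp p f -> Fp p g -> rho (fadd f g) = rho f + rho g.
Hypothesis rho_scal : forall (t : R) f, Fp p f -> rho (fscal t f) = t * rho f.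

Lemma complexification_add (f g : C -> C) : Fp p f -> Fp p g ->
  complexification rho (fadd f g) = (complexification rho f + complexification rho g)%C.
Proof.
  intros Hf Hg. unfold complexification, Cplus; simpl.
  replace (fscal Ci (fadd f g)) with (fadd (fscal Ci f) (fscal Ci g)) by fun_ring.
  rewrite !rho_add by (auto; apply Fp_scal; auto). f_equal. ring.
Qed.

Lemma complexification_scal (k : C) (f : C -> C) : Fp p f ->
  complexification rho (fscal k f) = (k * complexification rho f)%C.
Proof.
  intros Hf. assert (Hscal : forall l, Fp p (fscal l f)) by (intros l; apply Fp_scal; auto).
  assert (Hrho : forall u v : R, rho (fscal (u, v) f) = u * rho f + v * rho (fscal Ci f)).
  { intros u v. rewrite <- !rho_scal, <- rho_add by (auto; apply Fp_scal; auto).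
    f_equal. apply functional_extensionality. intros z. unfold fadd, fscal.
    replace ((u, v) : C) with (RtoC u + RtoC v * Ci)%C
      by (unfold Cplus, Cmult, Ci, RtoC; simpl; f_equal; ring).
    ring. }
  destruct k as [x y]. unfold complexification.
  replace (fscal Ci (fscal (x, y) f)) with (fscal (- y, x)%R f).
  - rewrite !Hrho. unfold Cmult; simpl. f_equal; ring.
  - apply functional_extensionality. intros z. unfold fscal. rewrite Cmult_assoc. f_equal.
    unfold Cmult, Ci; simpl. f_equal; ring.
Qed.

End Complexification.

Lemma closed_far_from_complement (M : (C -> C) -> Prop) (e : C -> C) : Fp_closed p M ->
  (forall m, M m -> M (fscal (- RtoC 1) m)) -> Fp p e -> ~ M e ->
  exists c d, 0 < c /\ 0 < d /\ forall m, M m -> d <= inner p c (fadd e m) (fadd e m).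
Proof.
  intros [HMF [_ Hopen]] HN Fe NMe.
  destruct (Hopen e (conj Fe NMe)) as (cs & eps & Hcs & He & Hball).
  destruct (list_pos_lower_bound cs Hcs) as (c & Hc & Hccs).
  set (S := weight_sum p c). assert (HS : 0 <= S) by (apply weight_sum_nonneg; auto).
  set (d := eps / (2 * (S + 1))). assert (Hd : 0 < d) by (apply Rdiv_lt_0_compat; lra).
  exists c, (d * d). repeat split; [auto | apply Rmult_lt_0_compat; auto|].
  intros m Hm. apply Rnot_lt_le. intros Hlt.
  assert (Fm := HMF m Hm). assert (Fem := Fp_add p p_pos e m Fe Fm).
  assert (Mg := HN m Hm). assert (Fg := HMF _ Mg).
  apply (Hball _ Fg); auto. intros c' Hc'.
  replace (fsub (fscal (- RtoC 1) m) e) with (fscal (- RtoC 1) (fadd e m)) by fun_ring.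
  eapply Rbar_le_lt_trans; [apply (seminorm_le_sqrt_inner p c); auto; apply Fp_scal; auto|].
  rewrite <- (RtoC_opp 1), inner_scal_l, inner_sym, inner_scal_l
    by (apply Fem || (apply Fp_scal; auto)).
  simpl.
  replace (- (1) * (- (1) * inner p c (fadd e m) (fadd e m))) with (inner p c (fadd e m) (fadd e m))
    by ring.
  fold S. apply Rle_lt_trans with (d * (S + 1)).
  - apply Rmult_le_compat; [apply sqrt_pos | auto | | lra].
    rewrite <- (sqrt_square d) by lra. apply sqrt_le_1_alt. lra.
  - unfold d. replace (eps / (2 * (S + 1)) * (S + 1)) with (eps / 2) by (field; lra). lra.
Qed.

Lemma ideal_fscal (M : (C -> C) -> Prop) (k : C) (f : C -> C) : Fp_ideal p M -> M f ->
  M (fscal k f).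
Proof.
  intros (HF & _ & _ & HM) Hf. rewrite fscal_fmul by apply (HF f Hf). apply HM; auto.
  apply Fp_const; auto.
Qed.

Lemma Fp_semi_inner_product (c : R) : 0 < c ->
  semi_inner_product (C -> C) fadd (fun t => fscal (RtoC t)) (Fp p) (inner p c).
Proof.
  intros Hc. split.
  - apply inner_add_l; auto.
  - intros t f g Hf _. apply (inner_scal_l p c); auto.
  - intros f g _ _. apply inner_sym.
  - apply inner_self_nonneg; auto.
Qed.

Lemma exists_annihilating_functional (M : (C -> C) -> Prop) : Fp_ideal p M -> Fp_closed p M ->
  ~ M fone -> exists phi, annihilating_functional p M phi.
Proof.
  intros HI Hcl Hone. assert (Fone := Fp_one p p_pos).
  assert (Mscal := fun k f => ideal_fscal M k f HI).
  destruct (closed_far_from_complement M fone Hcl (Mscal _) Fone Hone) as (c & d & Hc & Hd & Hfar).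
  destruct HI as (MF & M0 & Madd & _).
  destruct (separating_functional (C -> C) fadd (fun t => fscal (RtoC t)) (Fp p) M
    (inner p c) fone d)
    as (rho & rho_add & rho_scal & rho_M & rho_1 & K & HK & Hbound); auto.
  { split; [exists fone | apply Fp_add | intros; apply Fp_scal]; auto. }
  { apply Fp_semi_inner_product, Hc. }
  { split; [exists fzero | |]; auto. }
  exists (complexification rho). split.
  - apply complexification_add; auto.
  - apply complexification_scal; auto.
  - intros m Mm. unfold complexification. rewrite !rho_M, Ropp_0 by auto. reflexivity.
  - intros E. apply (f_equal fst) in E. simpl in E. lra.
  - destruct (inner_self_le_growth p c p_pos Hc) as (eps & K' & He & HK' & Hgrowth).
    set (L := sqrt (K * K')). assert (HKK : 0 <= K * K') by (apply Rmult_le_pos; auto).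
    exists eps, (2 * L). split; auto. split; [apply Rmult_le_pos; [lra | apply sqrt_pos]|].
    assert (Hrho : forall A f, Fp p f -> 0 <= A -> growth_le p eps A f -> Rabs (rho f) <= L * A).
    { intros A f Hf HA HfA. rewrite <- sqrt_Rsqr_abs. unfold L.
      rewrite <- (sqrt_square A), <- sqrt_mult_alt by auto. apply sqrt_le_1_alt.
      eapply Rle_trans; [apply Hbound, Hf|]. rewrite Rmult_assoc. apply Rmult_le_compat_l; auto. }
    intros A f Hf HA HfA. eapply Rle_trans; [apply Cmod_pair_le|]. rewrite Rabs_Ropp.
    assert (HfCi : growth_le p eps A (fscal Ci f)).
    { intros z Hz. unfold fscal. rewrite Cmod_mult, Cmod_Ci, Rmult_1_l. auto. }
    assert (HRe := Hrho A f Hf HA HfA). assert (HIm := Hrho A _ (Fp_scal p p_pos Ci f Hf) HA HfCi).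
    lra.
Qed.

End Functional.

(** * Infinite products *)

Definition Clim_seq (u : nat -> C) : C :=
  (real (Lim_seq (fun n => Re (u n))), real (Lim_seq (fun n => Im (u n)))).

Lemma Clim_seq_cauchy (u : nat -> C) :
  (forall eps, 0 < eps -> exists N, forall m n, (N <= m)%nat -> (N <= n)%nat ->
    Cmod (u m - u n) < eps) ->
  forall eps, 0 < eps -> exists N, forall n, (N <= n)%nat -> Cmod (Clim_seq u - u n) < eps.
Proof.
  intros HC.
  assert (Hpart : forall L : C -> R, (forall x y, L (x - y)%C = L x - L y) ->
    (forall z, Rabs (L z) <= Cmod z) ->
      is_lim_seq (fun n => L (u n)) (real (Lim_seq (fun n => L (u n))))).
  { intros L Lminus Lle. apply Lim_seq_correct'. apply ex_lim_seq_cauchy_corr. intros eps.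
    destruct (HC eps (cond_pos eps)) as [N HN]. exists N. intros n m Hn Hm.
    rewrite <- Lminus. eapply Rle_lt_trans; [apply Lle | apply HN; auto]. }
  assert (HRe := Hpart Re
    (fun x y => eq_trans (re_plus x (- y)) (f_equal (Rplus (Re x)) (re_opp y))) re_le_Cmod).
  assert (HIm := Hpart Im
    (fun x y => eq_trans (im_plus x (- y)) (f_equal (Rplus (Im x)) (im_opp y))) im_le_Cmod).
  intros eps He. assert (He2 : 0 < eps / 2) by lra.
  apply is_lim_seq_spec in HRe. apply is_lim_seq_spec in HIm.
  destruct (HRe (mkposreal _ He2)) as [N1 HN1]. destruct (HIm (mkposreal _ He2)) as [N2 HN2].
  exists (max N1 N2). intros n Hn. specialize (HN1 n ltac:(lia)). specialize (HN2 n ltac:(lia)).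
  rewrite Cmod_minus_comm. eapply Rle_lt_trans; [apply Cmod_pair_le|].
  replace eps with (eps / 2 + eps / 2) by field. exact (Rplus_lt_compat _ _ _ _ HN1 HN2).
Qed.

Lemma Clim_seq_dominated (u : nat -> C) (T : nat -> R) (l : R) : is_lim_seq T l ->
  (forall n, T n <= T (S n)) -> (forall n k, Cmod (u (n + k)%nat - u n) <= T (n + k)%nat - T n) ->
  forall n, Cmod (Clim_seq u - u n) <= l - T n.
Proof.
  intros HT Hinc Hu. assert (Hlim := is_lim_seq_incr_compare T l HT Hinc).
  assert (Hle : forall n m, (n <= m)%nat -> Cmod (u m - u n) <= l - T n).
  { intros n m H. replace m with (n + (m - n))%nat by lia.
    specialize (Hu n (m - n)%nat). specialize (Hlim (n + (m - n))%nat). lra. }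
  assert (HC := Clim_seq_cauchy u). intros n. apply le_epsilon. intros eps He.
  destruct HC with (eps := eps) as [N HN]; auto.
  - intros e He'. apply is_lim_seq_spec in HT.
    assert (He2 : 0 < e / 2) by lra. destruct (HT (mkposreal _ He2)) as [N HN].
    specialize (HN N (Nat.le_refl N)). simpl in HN. apply Rabs_lt_between in HN.
    exists N. intros i j Hi Hj. assert (Bi := Hle N i Hi). assert (Bj := Hle N j Hj).
    assert (Htri := Cmod_minus_triangle (u i) (u N) (u j)). rewrite (Cmod_minus_comm (u N)) in Htri.
    lra.
  - specialize (HN (max n N) ltac:(lia)). specialize (Hle n (max n N) ltac:(lia)).
    assert (Htri := Cmod_minus_triangle (Clim_seq u) (u (max n N)) (u n)). lra.
Qed.

Fixpoint partial_prod (d : nat -> C) (x : C) (N : nat) : C :=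
  match N with O => RtoC 1 | S N => (partial_prod d x N * (1 + d N * x))%C end.

Fixpoint majorant_prod (t : nat -> R) (X : R) (N : nat) : R :=
  match N with O => 1 | S N => majorant_prod t X N * (1 + t N * X) end.

Definition infinite_prod (d : nat -> C) (x : C) : C := Clim_seq (partial_prod d x).

Definition drop_term (d : nat -> C) (n m : nat) : C := if Nat.eq_dec m n then RtoC 0 else d m.

Lemma partial_prod_drop_term (d : nat -> C) (n N : nat) (x : C) : (n < N)%nat ->
  partial_prod d x N = ((1 + d n * x) * partial_prod (drop_term d n) x N)%C.
Proof.
  assert (Hbefore : forall K, (K <= n)%nat ->
    partial_prod d x K = partial_prod (drop_term d n) x K).
  { intros K. induction K as [|K IH]; intros HK; simpl; auto. rewrite IH by lia.
    unfold drop_term at 3. destruct (Nat.eq_dec K n); [lia | reflexivity]. }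
  induction N as [|N IH]; intros HN; [lia|]. simpl. unfold drop_term at 2.
  destruct (Nat.eq_dec N n) as [-> | Hne].
  - rewrite Hbefore by lia. ring.
  - rewrite IH by lia. ring.
Qed.

Lemma cderivable_partial_prod (d : nat -> C) (h : C -> C) (N : nat) (z : C) : cderivable h z ->
  cderivable (fun z => partial_prod d (h z) N) z.
Proof.
  intros Hh. induction N as [|N IH]; simpl; [apply cderivable_const|].
  apply cderivable_mult; [exact IH|]. apply cderivable_plus; [apply cderivable_const|].
  apply cderivable_mult; [apply cderivable_const | exact Hh].
Qed.

Section Majorant.

Variable t : nat -> R.
Hypothesis t_nonneg : forall m, 0 <= t m.
Hypothesis majorant_bounded : forall X, 0 <= X -> exists B, forall N, majorant_prod t X N <= B.

Lemma majorant_prod_ge_1 (X : R) (N : nat) : 0 <= X -> 1 <= majorant_prod t X N.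
Proof.
  intros HX. induction N as [|N IH]; simpl; [lra|].
  assert (0 <= t N * X) by (apply Rmult_le_pos; auto).
  assert (1 * 1 <= majorant_prod t X N * (1 + t N * X)) by (apply Rmult_le_compat; lra). lra.
Qed.

Lemma majorant_prod_incr (X : R) (N : nat) : 0 <= X ->
  majorant_prod t X N <= majorant_prod t X (S N).
Proof.
  intros HX. simpl. assert (Hge1 := majorant_prod_ge_1 X N HX).
  assert (0 <= t N * X) by (apply Rmult_le_pos; auto).
  rewrite <- (Rmult_1_r (majorant_prod t X N)) at 1. apply Rmult_le_compat_l; lra.
Qed.

Definition majorant_limit (X : R) : R := real (Lim_seq (majorant_prod t X)).

Lemma is_lim_seq_majorant (X : R) : 0 <= X -> is_lim_seq (majorant_prod t X) (majorant_limit X).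
Proof.
  intros HX. destruct (majorant_bounded X HX) as [B HB]. apply Lim_seq_correct'.
  apply (ex_finite_lim_seq_incr _ B); auto using majorant_prod_incr.
Qed.

Variable d : nat -> C.
Hypothesis d_le : forall m, Cmod (d m) <= t m.

Lemma Cmod_partial_prod_le (x : C) (X : R) (N : nat) : Cmod x <= X ->
  Cmod (partial_prod d x N) <= majorant_prod t X N.
Proof.
  intros Hx. induction N as [|N IH]; simpl; [rewrite Cmod_1; lra|].
  rewrite Cmod_mult. apply Rmult_le_compat; auto using Cmod_ge_0.
  eapply Rle_trans; [apply Cmod_triangle|]. rewrite Cmod_1, Cmod_mult.
  apply Rplus_le_compat_l, Rmult_le_compat; auto using Cmod_ge_0.
Qed.

Lemma partial_prod_dist_le (x : C) (X : R) (n k : nat) : Cmod x <= X ->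
  Cmod (partial_prod d x (n + k) - partial_prod d x n)
    <= majorant_prod t X (n + k) - majorant_prod t X n.
Proof.
  intros Hx. induction k as [|k IH]; [rewrite Nat.add_0_r, Cmod_minus_diag; lra|].
  rewrite Nat.add_succ_r. simpl. assert (Hp := Cmod_partial_prod_le x X (n + k) Hx).
  set (m := (n + k)%nat) in *.
  replace (partial_prod d x m * (1 + d m * x) - partial_prod d x n)%C
    with ((partial_prod d x m - partial_prod d x n) + partial_prod d x m * (d m * x))%C by ring.
  eapply Rle_trans; [apply Cmod_triangle|]. rewrite !Cmod_mult.
  assert (Cmod (d m) * Cmod x <= t m * X) by (apply Rmult_le_compat; auto using Cmod_ge_0).
  assert (Cmod (partial_prod d x m) * (Cmod (d m) * Cmod x) <= majorant_prod t X m * (t m * X))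
    by (apply Rmult_le_compat; auto using Cmod_ge_0; apply Rmult_le_pos; apply Cmod_ge_0).
  lra.
Qed.

Lemma infinite_prod_dist_le (x : C) (X : R) (N : nat) : Cmod x <= X ->
  Cmod (infinite_prod d x - partial_prod d x N) <= majorant_limit X - majorant_prod t X N.
Proof.
  intros Hx. assert (HX : 0 <= X) by (eapply Rle_trans; [apply Cmod_ge_0 | exact Hx]).
  apply (Clim_seq_dominated _ (majorant_prod t X)).
  - apply is_lim_seq_majorant, HX.
  - intros n. apply majorant_prod_incr, HX.
  - intros n k. apply partial_prod_dist_le, Hx.
Qed.

Lemma infinite_prod_minus_1_le (x : C) (X : R) : Cmod x <= X ->
  Cmod (infinite_prod d x - 1) <= majorant_limit X - 1.
Proof. apply (infinite_prod_dist_le x X 0). Qed.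

Lemma Cmod_infinite_prod_le (x : C) (X : R) : Cmod x <= X ->
  Cmod (infinite_prod d x) <= majorant_limit X.
Proof.
  intros Hx. assert (Hnear1 := infinite_prod_minus_1_le x X Hx).
  assert (Htri := Cmod_minus_ge (infinite_prod d x) 1). rewrite Cmod_1 in Htri. lra.
Qed.

Lemma majorant_eventually (X eps : R) : 0 <= X -> 0 < eps ->
  exists N, forall n, (N <= n)%nat -> majorant_limit X - majorant_prod t X n < eps.
Proof.
  intros HX He. assert (Hlim := is_lim_seq_majorant X HX). apply is_lim_seq_spec in Hlim.
  destruct (Hlim (mkposreal eps He)) as [N HN]. exists N. intros n Hn.
  specialize (HN n Hn). simpl in HN. apply Rabs_lt_between in HN. lra.
Qed.

Lemma holomorphic_infinite_prod (h : C -> C) : holomorphic_on_disk h ->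
  holomorphic_on_disk (fun z => infinite_prod d (h z)).
Proof.
  intros Hh. apply holomorphic_of_uniform_approx. intros r eps Hr He.
  destruct (holomorphic_bounded h r Hh Hr) as (X & HX & HhX).
  destruct (majorant_eventually X eps HX He) as [N HN].
  exists (fun z => partial_prod d (h z) N). split.
  - apply holomorphic_on_disk_cderivable. intros z Hz.
    apply cderivable_partial_prod, holomorphic_on_disk_cderivable; auto.
  - intros z Hz. left.
    eapply Rle_lt_trans; [apply (infinite_prod_dist_le _ X), HhX, Hz | apply HN; auto].
Qed.

End Majorant.

Lemma Cmod_drop_term_le (d : nat -> C) (t : nat -> R) (n : nat) : (forall m, Cmod (d m) <= t m) ->
  forall m, Cmod (drop_term d n m) <= t m.
Proof.
  intros H m. unfold drop_term. destruct (Nat.eq_dec m n); auto. rewrite Cmod_0.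
  eapply Rle_trans; [apply Cmod_ge_0 | apply H].
Qed.

Lemma infinite_prod_drop_term (t : nat -> R) (d : nat -> C) (n : nat) (x : C) :
  (forall X, 0 <= X -> exists B, forall N, majorant_prod t X N <= B) ->
  (forall m, Cmod (d m) <= t m) ->
  infinite_prod d x = ((1 + d n * x) * infinite_prod (drop_term d n) x)%C.
Proof.
  intros HB Hd.
  assert (Ht : forall m, 0 <= t m) by (intros m; eapply Rle_trans; [apply Cmod_ge_0 | apply Hd]).
  assert (Hx := Cmod_ge_0 x). set (k := (1 + d n * x)%C). assert (Hk := Cmod_ge_0 k).
  apply Ceq_of_dist_le_eps. intros eps He.
  destruct (majorant_eventually t Ht HB (Cmod x) (eps / (1 + Cmod k)) Hx) as [N HN];
    [apply Rdiv_lt_0_compat; lra|].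
  set (K := max (S n) N). specialize (HN K ltac:(lia)). apply Rlt_div_r in HN; [|lra].
  assert (Hdist := infinite_prod_dist_le t Ht HB d Hd x (Cmod x) K ltac:(lra)).
  assert (Hdist_drop :=
    infinite_prod_dist_le t Ht HB _ (Cmod_drop_term_le d t n Hd) x (Cmod x) K ltac:(lra)).
  set (delta := majorant_limit t (Cmod x) - majorant_prod t (Cmod x) K) in *.
  replace (infinite_prod d x - k * infinite_prod (drop_term d n) x)%C
    with ((infinite_prod d x - partial_prod d x K)
          - k * (infinite_prod (drop_term d n) x - partial_prod (drop_term d n) x K))%C
    by (rewrite (partial_prod_drop_term d n K) by lia; fold k; ring).
  eapply Rle_trans; [apply Cmod_minus_le|]. rewrite Cmod_mult.
  assert (Cmod k * Cmod (infinite_prod (drop_term d n) x - partial_prod (drop_term d n) x K)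
    <= Cmod k * delta)
    by (apply Rmult_le_compat_l; lra).
  lra.
Qed.

Lemma Rpower_1_plus_le (y s : R) : 0 < y -> s <= 1 -> Rpower (1 + y) s <= 1 + Rpower y s.
Proof.
  intros Hy Hs. assert (Hsplit : forall x, 0 < x -> Rpower x s = x * / Rpower x (1 - s)).
  { intros x Hx. rewrite <- Rpower_Ropp. rewrite <- (Rpower_1 x) at 2 by auto.
    rewrite <- Rpower_plus. f_equal. ring. }
  rewrite !Hsplit by lra.
  assert (Hinv1 : / Rpower (1 + y) (1 - s) <= 1).
  { apply Rle_trans with (/ 1); [apply Rinv_le_contravar; [lra|] | rewrite Rinv_1; lra].
    apply Rle_trans with (Rpower (1 + y) 0); [rewrite Rpower_O; lra | apply Rle_Rpower; lra]. }
  assert (Hinvy : / Rpower (1 + y) (1 - s) <= / Rpower y (1 - s)).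
  { apply Rinv_le_contravar; [apply exp_pos | apply Rle_Rpower_l; lra]. }
  rewrite Rmult_plus_distr_r, Rmult_1_l. apply Rplus_le_compat; auto. apply Rmult_le_compat_l; lra.
Qed.

Lemma one_plus_le_exp_Rpower (y s : R) : 0 < y -> 0 < s <= 1 -> 1 + y <= exp (Rpower y s / s).
Proof.
  intros Hy [Hs Hs1]. rewrite <- (exp_ln (1 + y)) by lra. apply exp_le_compat.
  apply Rle_div_r; [lra|].
  rewrite Rmult_comm, <- (ln_exp (s * ln (1 + y))), <- (ln_exp (Rpower y s)).
  apply ln_le; [apply exp_pos|].
  apply Rle_trans with (1 + Rpower y s); [apply Rpower_1_plus_le; auto|].
  left. apply exp_ineq1, Rgt_not_eq, exp_pos.
Qed.

Definition fast_decay (s eta : R) (m : nat) : R := Rpower (eta * (/ 2) ^ S m) (/ s).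

Lemma fast_decay_pos (s eta : R) (m : nat) : 0 < fast_decay s eta m.
Proof. apply exp_pos. Qed.

Lemma majorant_prod_fast_decay_le (s eta X : R) (N : nat) : 0 < s <= 1 -> 0 < eta -> 0 < X ->
  majorant_prod (fast_decay s eta) X N <= exp (eta * (1 - (/ 2) ^ N) * (Rpower X s / s)).
Proof.
  intros Hs Heta HX. induction N as [|N IH].
  - simpl. rewrite Rminus_diag, Rmult_0_r, Rmult_0_l, exp_0. lra.
  - assert (Ht := fast_decay_pos s eta N).
    assert (Hfactor : Rpower (fast_decay s eta N * X) s = eta * (/ 2) ^ S N * Rpower X s).
    { assert (Hhalf := half_pow_pos (S N)).
      rewrite <- Rpower_mult_distr by auto. unfold fast_decay.
      rewrite Rpower_mult, Rinv_l, Rpower_1 by (lra || (apply Rmult_lt_0_compat; auto)). ring. }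
    replace (eta * (1 - (/ 2) ^ S N) * (Rpower X s / s))
      with (eta * (1 - (/ 2) ^ N) * (Rpower X s / s) + Rpower (fast_decay s eta N * X) s / s)
      by (rewrite Hfactor; simpl; field; lra).
    rewrite exp_plus. simpl majorant_prod.
    assert (Hge1 := majorant_prod_ge_1 (fast_decay s eta)
      (fun m => Rlt_le _ _ (fast_decay_pos s eta m)) X N ltac:(lra)).
    assert (0 < fast_decay s eta N * X) by (apply Rmult_lt_0_compat; auto).
    apply Rmult_le_compat; auto; try lra. apply one_plus_le_exp_Rpower; auto.
Qed.

Lemma majorant_prod_fast_decay_le_exp (s eta X : R) (N : nat) : 0 < s <= 1 -> 0 < eta -> 0 < X ->
  majorant_prod (fast_decay s eta) X N <= exp (eta * (Rpower X s / s)).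
Proof.
  intros Hs Heta HX. eapply Rle_trans; [apply majorant_prod_fast_decay_le; auto|].
  apply exp_le_compat.
  apply Rmult_le_compat_r; [left; apply Rdiv_lt_0_compat; [apply exp_pos | lra]|].
  assert (0 < eta * (/ 2) ^ N) by (apply Rmult_lt_0_compat; auto using half_pow_pos). lra.
Qed.

Lemma majorant_prod_monotone (t : nat -> R) (X Y : R) (N : nat) : (forall m, 0 <= t m) -> 0 <= X ->
  X <= Y -> majorant_prod t X N <= majorant_prod t Y N.
Proof.
  intros Ht HX HXY. induction N as [|N IH]; simpl; [lra|].
  assert (Hge1 := majorant_prod_ge_1 t Ht X N HX).
  assert (0 <= t N * X) by (apply Rmult_le_pos; auto).
  apply Rmult_le_compat; auto; try lra. apply Rplus_le_compat_l, Rmult_le_compat_l; auto.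
Qed.

Lemma majorant_fast_decay_bounded (s eta : R) : 0 < s <= 1 -> 0 < eta ->
  forall X, 0 <= X -> exists B, forall N, majorant_prod (fast_decay s eta) X N <= B.
Proof.
  intros Hs Heta X HX. exists (exp (eta * (Rpower (X + 1) s / s))). intros N.
  apply Rle_trans with (majorant_prod (fast_decay s eta) (X + 1) N).
  - apply majorant_prod_monotone; try lra. intros m. left. apply fast_decay_pos.
  - apply majorant_prod_fast_decay_le_exp; auto. lra.
Qed.

Lemma majorant_limit_fast_decay_le (s eta X : R) : 0 < s <= 1 -> 0 < eta -> 0 < X ->
  majorant_limit (fast_decay s eta) X <= exp (eta * (Rpower X s / s)).
Proof.
  intros Hs Heta HX.
  apply (is_lim_seq_le (majorant_prod (fast_decay s eta) X) (fun _ => exp (eta * (Rpower X s / s)))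
           (majorant_limit (fast_decay s eta) X) (exp (eta * (Rpower X s / s)))).
  - intros N. apply majorant_prod_fast_decay_le_exp; auto.
  - apply is_lim_seq_majorant; [| apply majorant_fast_decay_bounded | lra]; auto.
    intros m. left. apply fast_decay_pos.
  - apply is_lim_seq_const.
Qed.

(** * Division and inversion in F^p *)

Definition lin (a : C) : C -> C := restr (fun z => z - a)%C.

Definition inv_lin (a : C) : C -> C := restr (fun z => / (z - a))%C.

Ltac disk_ring := apply functional_extensionality; intros z;
  unfold fsub, fadd, fmul, fscal, fzero, fone, lin, inv_lin;
  destruct (classic (disk z)) as [Hz | Hz];
  [ rewrite ?restr_in by exact Hz; ring
  | rewrite ?restr_out by exact Hz;
    repeat match goal with H : Fp _ ?f |- _ => rewrite (proj1 H z Hz); clear H end; ring ].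

Lemma Cmod_le_of_punctured (q : C -> C) (a : C) (L d : R) : 0 < d -> ccontinuous q a ->
  (forall z, z <> a -> Cmod (z - a) < d -> Cmod (q z) <= L) -> Cmod (q a) <= L.
Proof.
  intros Hd Hq HL. apply le_epsilon. intros eps He.
  destruct (proj1 (ccontinuous_eps q a) Hq eps He) as (e & He' & Hqe).
  set (h := Rmin d e / 2). assert (Hh : 0 < h) by (apply Rdiv_lt_0_compat; [apply Rmin_pos|]; lra).
  assert (Hhd : h < d) by (assert (Hmin := Rmin_l d e); unfold h in *; lra).
  assert (Hhe : h < e) by (assert (Hmin := Rmin_r d e); unfold h in *; lra).
  set (y := (a + RtoC h)%C).
  assert (My : Cmod (y - a) = h).
  { replace (y - a)%C with (RtoC h) by (unfold y; ring). rewrite Cmod_R, Rabs_pos_eq; lra. }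
  assert (Hy : y <> a) by (intros E; rewrite E, Cmod_minus_diag in My; lra).
  specialize (HL y Hy ltac:(lra)). specialize (Hqe y ltac:(lra)).
  assert (Htri := Cmod_minus_ge (q a) (q y)). rewrite Cmod_minus_comm in Htri. lra.
Qed.

Lemma exp_minus_1_le (x : R) : exp x - 1 <= x * exp x.
Proof.
  assert (Hlower : 1 - x <= exp (- x)).
  { destruct (Req_dec x 0) as [-> | N]; [rewrite Ropp_0, exp_0; lra|].
    assert (Hexp := exp_ineq1 (- x) ltac:(lra)). lra. }
  assert (Hexp_opp : exp x * exp (- x) = 1) by (rewrite <- exp_plus, Rplus_opp_r; apply exp_0).
  assert (exp x * (1 - x) <= exp x * exp (- x)); [|lra].
  apply Rmult_le_compat_l; [left; apply exp_pos | exact Hlower].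
Qed.

Section Division.

Variable p : R.
Hypothesis p_pos : 0 < p.

Lemma quotient_growth_le (f : C -> C) (r eps : R) : Fp p f -> r < 1 -> 0 < eps ->
  exists K, 0 <= K /\ forall a q, Cmod a <= r -> holomorphic_on_disk q ->
    (forall z, disk z -> (f z - f a = (z - a) * q z)%C) -> growth_le p eps K q.
Proof.
  intros Hf Hr He. assert (Hh := proj1 (proj2 Hf)).
  set (s := (1 + r) / 2). assert (Hs : r < s < 1) by (unfold s; lra).
  destruct (holomorphic_lipschitz f s Hh) as (L & HL & HfL); [lra|].
  destruct (holomorphic_bounded f r Hh Hr) as (m & Hm & Hfm).
  destruct (Fp_slow_growth p f Hf eps He) as (A & HA & HfA).
  set (K := (A + m) / (s - r)).
  assert (HK : 0 <= K) by (apply Rmult_le_pos; [lra | left; apply Rinv_0_lt_compat; lra]).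
  exists (L + K). split; [lra|]. intros a q Ha Hq Eq z Hz.
  assert (Hexp := exp_growth_rate_ge_1 p eps (Cmod z) ltac:(lra)). set (X := exp _) in *.
  assert (Near : Cmod z < s -> Cmod (q z) <= L).
  { assert (Hpunct : forall y, y <> a -> Cmod y <= s -> Cmod (q y) <= L).
    { intros y Hya Hy. assert (Hpos := Cmod_minus_pos _ _ Hya).
      apply Rmult_le_reg_l with (Cmod (y - a)); auto.
      rewrite <- Cmod_mult, <- Eq, (Rmult_comm _ L) by (unfold disk; lra). apply HfL; lra. }
    intros Hzs. destruct (Ceq_dec z a) as [-> | Hza]; [|apply Hpunct; lra || auto].
    apply (Cmod_le_of_punctured q a L (s - Cmod a)); [lra | apply holomorphic_ccontinuous; auto|].
    intros y Hya Hy. apply Hpunct; auto. assert (Htri := Cmod_minus_ge y a). lra. }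
  assert (Far : s <= Cmod z -> Cmod (q z) <= K * X).
  { intros Hzs. assert (Hdist : s - r <= Cmod (z - a)) by (assert (Htri := Cmod_minus_ge z a); lra).
    apply Rmult_le_reg_l with (s - r); [lra|].
    replace ((s - r) * (K * X)) with (A * X + m * X) by (unfold K; field; lra).
    apply Rle_trans with (Cmod (z - a) * Cmod (q z));
      [apply Rmult_le_compat_r; auto; apply Cmod_ge_0|].
    rewrite <- Cmod_mult, <- Eq by auto. eapply Rle_trans; [apply Cmod_minus_le|].
    apply Rplus_le_compat; [apply HfA, Hz|]. specialize (Hfm a Ha).
    apply Rle_trans with (m * 1); [lra | apply Rmult_le_compat_l; lra]. }
  assert (HLX : L * 1 <= L * X) by (apply Rmult_le_compat_l; lra).
  assert (HKX : 0 <= K * X) by (apply Rmult_le_pos; lra).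
  destruct (Rlt_le_dec (Cmod z) s) as [H | H]; [specialize (Near H) | specialize (Far H)]; lra.
Qed.

Lemma Fp_division (f : C -> C) (a : C) : Fp p f -> disk a ->
  exists q, Fp p q /\ forall z, disk z -> (f z - f a = (z - a) * q z)%C.
Proof.
  intros Hf Ha. destruct (holomorphic_slope f a (proj1 (proj2 Hf)) Ha) as [l Hl].
  assert (Eq : forall z, disk z -> (f z - f a = (z - a) * restr (slope f a l) z)%C)
    by (intros z Hz; rewrite restr_in by auto; apply slope_spec).
  assert (Hq : holomorphic_on_disk (restr (slope f a l)))
    by (apply holomorphic_restr, holomorphic_on_disk_cderivable, Hl).
  exists (restr (slope f a l)). split; [|exact Eq]. apply Fp_of_slow_growth; auto.
  - intros z. apply restr_out.
  - intros eps He. destruct (quotient_growth_le f (Cmod a) eps Hf Ha He) as (K & HK & H).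
    exists K. split; auto. apply (H a); auto. lra.
Qed.

Lemma cderivable_lin (a z : C) : cderivable (fun z => z - a)%C z.
Proof. apply cderivable_minus; [apply cderivable_id | apply cderivable_const]. Qed.

Lemma Fp_lin (a : C) : Fp p (lin a).
Proof.
  apply Fp_bounded with (1 + Cmod a); auto; intros z Hz; [apply cderivable_lin|].
  assert (Htri := Cmod_minus_le z a). unfold disk in Hz. lra.
Qed.

Lemma disk_dist_ge (a z : C) : 1 <= Cmod a -> 1 - Cmod z <= Cmod (z - a).
Proof. intros Ha. assert (Htri := Cmod_minus_ge a z). rewrite Cmod_minus_comm in Htri. lra. Qed.

Lemma disk_minus_neq_0 (a z : C) : 1 <= Cmod a -> disk z -> (z - a)%C <> RtoC 0.
Proof.
  intros Ha Hz. apply Cmod_gt_0. assert (Htri := disk_dist_ge a z Ha). unfold disk in Hz. lra.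
Qed.

Lemma cderivable_inv_lin (a z : C) : 1 <= Cmod a -> disk z -> cderivable (fun z => / (z - a))%C z.
Proof.
  intros Ha Hz. apply (cderivable_comp Cinv (fun y => y - a)%C); [|apply cderivable_lin].
  apply cderivable_inv, disk_minus_neq_0; auto.
Qed.

Lemma Cmod_inv_lin_le (a z : C) : 1 <= Cmod a -> disk z -> Cmod (/ (z - a))%C <= / (1 - Cmod z).
Proof.
  intros Ha Hz. rewrite Cmod_inv by (apply disk_minus_neq_0; auto).
  unfold disk in Hz. apply Rinv_le_contravar; [lra | apply disk_dist_ge, Ha].
Qed.

Lemma inv_dist_le_growth (eps : R) : 0 < eps ->
  exists K, 0 <= K /\ forall r, r < 1 -> / (1 - r) <= K * exp (eps * growth_rate p r).
Proof.
  intros He. assert (Hep : 0 < eps / p) by (apply Rdiv_lt_0_compat; auto).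
  assert (HR : 0 < Rpower (eps / p) p) by apply exp_pos.
  exists (/ Rpower (eps / p) p). split; [left; apply Rinv_0_lt_compat; auto|].
  intros r Hr. assert (Hrate := growth_rate_pos p r).
  assert (Hexp :=
    exp_ge_Rpower (eps * growth_rate p r) p ltac:(apply Rmult_lt_0_compat; auto) p_pos).
  replace (eps * growth_rate p r / p) with (eps / p * growth_rate p r) in Hexp by (field; lra).
  rewrite <- Rpower_mult_distr in Hexp by auto.
  assert (Hrate_pow : Rpower (growth_rate p r) p = / (1 - r)).
  { unfold growth_rate. rewrite Rpower_mult. replace (- (1 / p) * p) with (- (1)) by (field; lra).
    rewrite Rpower_Ropp, Rpower_1; lra. }
  rewrite Hrate_pow in Hexp. apply Rmult_le_reg_l with (Rpower (eps / p) p); auto.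
  rewrite <- Rmult_assoc, Rinv_r, Rmult_1_l by lra. exact Hexp.
Qed.

Lemma Fp_inv_lin (a : C) : 1 <= Cmod a -> Fp p (inv_lin a).
Proof.
  intros Ha. apply Fp_restr; auto.
  - intros z Hz. apply cderivable_inv_lin; auto.
  - intros eps He. destruct (inv_dist_le_growth eps He) as (K & HK & H).
    exists K. split; auto. intros z Hz.
    eapply Rle_trans; [apply Cmod_inv_lin_le; auto | apply H, Hz].
Qed.

Lemma lin_inv_lin (a : C) : 1 <= Cmod a -> fmul (lin a) (inv_lin a) = fone.
Proof.
  intros Ha. apply functional_extensionality. intros z. unfold fmul, lin, inv_lin, fone.
  destruct (classic (disk z)) as [Hz | Hz].
  - rewrite !restr_in by auto. field. apply disk_minus_neq_0; auto.
  - rewrite !restr_out by auto. ring.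
Qed.

(** * Products of the functions (z - b_n) / (z - a) with b_n tending rapidly to a *)

Definition pole_exponent : R := Rmin 1 (/ (2 * p)).

Definition pole_product (d : nat -> C) (a : C) : C -> C :=
  restr (fun z => infinite_prod d (/ (z - a))%C).

Lemma pole_exponent_bounds : 0 < pole_exponent <= 1.
Proof. split; [apply Rmin_pos; [lra | apply Rinv_0_lt_compat; lra] | apply Rmin_l]. Qed.

(* AM-GM: the growth rate is the square of [Rpower (/ (1 - r)) (/ (2 * p))]. *)
Lemma exp_pole_exponent_le (eps c r : R) : 0 < eps -> 0 <= c -> 0 <= r < 1 ->
  exp (c * Rpower (/ (1 - r)) pole_exponent)
    <= exp (c * c / (4 * eps)) * exp (eps * growth_rate p r).
Proof.
  intros He Hc Hr. rewrite <- exp_plus. apply exp_le_compat.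
  set (X := Rpower (/ (1 - r)) (/ (2 * p))).
  assert (HX : Rpower (/ (1 - r)) pole_exponent <= X).
  { apply Rle_Rpower; [|apply Rmin_r]. rewrite <- Rinv_1. apply Rinv_le_contravar; lra. }
  assert (Hrate_sqr : growth_rate p r = X * X).
  { unfold X, growth_rate. rewrite <- Rpower_plus. unfold Rpower. rewrite ln_Rinv by lra. f_equal.
    field. lra. }
  assert (Hsqr : 0 <= eps * ((X - c / (2 * eps)) * (X - c / (2 * eps))))
    by (apply Rmult_le_pos; [lra | apply Rle_0_sqr]).
  replace (eps * ((X - c / (2 * eps)) * (X - c / (2 * eps))))
    with (eps * (X * X) - c * X + c * c / (4 * eps)) in Hsqr
    by (field; lra).
  rewrite Hrate_sqr.
  assert (c * Rpower (/ (1 - r)) pole_exponent <= c * X) by (apply Rmult_le_compat_l; auto). lra.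
Qed.

Variables (a : C) (eta : R) (d : nat -> C).
Hypothesis a_outside : 1 <= Cmod a.
Hypothesis eta_bounds : 0 < eta <= 1.
Hypothesis d_le : forall m, Cmod (d m) <= fast_decay pole_exponent eta m.

Let decay_nonneg (m : nat) : 0 <= fast_decay pole_exponent eta m :=
  Rlt_le _ _ (fast_decay_pos _ _ m).
Let decay_bounded :=
  majorant_fast_decay_bounded pole_exponent eta pole_exponent_bounds (proj1 eta_bounds).

Lemma pole_majorant_le (z : C) : disk z ->
  majorant_limit (fast_decay pole_exponent eta) (/ (1 - Cmod z))
    <= exp (eta * (Rpower (/ (1 - Cmod z)) pole_exponent / pole_exponent)).
Proof.
  intros Hz. unfold disk in Hz.
  apply majorant_limit_fast_decay_le;
    [apply pole_exponent_bounds | lra | apply Rinv_0_lt_compat; lra].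
Qed.

Lemma pole_product_growth_le (eps : R) : 0 < eps ->
  growth_le p eps (exp (/ pole_exponent * / pole_exponent / (4 * eps))) (pole_product d a).
Proof.
  intros He z Hz. assert (Hs := pole_exponent_bounds). unfold pole_product.
  rewrite restr_in by auto.
  eapply Rle_trans;
    [apply (Cmod_infinite_prod_le _ decay_nonneg decay_bounded d d_le _ _
      (Cmod_inv_lin_le a z a_outside Hz))|].
  eapply Rle_trans; [apply pole_majorant_le, Hz|].
  eapply Rle_trans;
    [|apply exp_pole_exponent_le;
      [exact He | left; apply Rinv_0_lt_compat; lra | split; [apply Cmod_ge_0 | exact Hz]]].
  apply exp_le_compat. set (Y := Rpower _ _). assert (HY : 0 < Y) by apply exp_pos.
  apply Rle_trans with (1 * (Y / pole_exponent)); [|right; field; lra].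
  apply Rmult_le_compat_r; [left; apply Rdiv_lt_0_compat; lra | lra].
Qed.

Lemma pole_product_minus_one_growth_le (eps : R) : 0 < eps ->
  growth_le p eps (eta * exp (2 / pole_exponent * (2 / pole_exponent) / (4 * eps)))
    (fsub (pole_product d a) fone).
Proof.
  intros He z Hz. assert (Hs := pole_exponent_bounds). unfold fsub, pole_product, fone.
  rewrite !restr_in by auto.
  eapply Rle_trans;
    [apply (infinite_prod_minus_1_le _ decay_nonneg decay_bounded d d_le _ _
      (Cmod_inv_lin_le a z a_outside Hz))|].
  assert (Hmaj := pole_majorant_le z Hz). set (Y := Rpower _ _ / _) in *.
  assert (HY : 0 < Y) by (apply Rdiv_lt_0_compat; [apply exp_pos | lra]).
  assert (HeY : eta * Y <= Y) by (rewrite <- (Rmult_1_l Y) at 2; apply Rmult_le_compat_r; lra).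
  apply Rle_trans with (eta * exp (2 / pole_exponent * Rpower (/ (1 - Cmod z)) pole_exponent)).
  - eapply Rle_trans; [apply Rplus_le_compat_r, Hmaj|]. eapply Rle_trans; [apply exp_minus_1_le|].
    rewrite Rmult_assoc. apply Rmult_le_compat_l; [lra|].
    replace (2 / pole_exponent * Rpower (/ (1 - Cmod z)) pole_exponent) with (Y + Y)
      by (unfold Y; field; lra).
    rewrite exp_plus.
    apply Rmult_le_compat; [lra | left; apply exp_pos | | apply exp_le_compat, HeY].
    assert (Hexp := exp_ineq1 Y ltac:(lra)). lra.
  - rewrite Rmult_assoc. apply Rmult_le_compat_l; [lra|].
    apply exp_pole_exponent_le;
      [exact He | left; apply Rdiv_lt_0_compat; lra | split; [apply Cmod_ge_0 | exact Hz]].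
Qed.

Lemma Fp_pole_product : Fp p (pole_product d a).
Proof.
  apply Fp_of_slow_growth; auto.
  - intros z. apply restr_out.
  - apply holomorphic_restr.
    apply (holomorphic_on_disk_cderivable (fun z => infinite_prod d (/ (z - a))%C)).
    apply (holomorphic_infinite_prod _ decay_nonneg decay_bounded d d_le (fun z => / (z - a))%C).
    apply holomorphic_on_disk_cderivable. intros z Hz. apply cderivable_inv_lin; auto.
  - intros eps He. eexists. split; [|apply pole_product_growth_le, He]. left. apply exp_pos.
Qed.

Lemma pole_product_drop_term (n : nat) :
  fmul (lin (a - d n)) (fmul (pole_product (drop_term d n) a) (inv_lin a)) = pole_product d a.
Proof.
  apply functional_extensionality. intros z. unfold fmul, pole_product, lin, inv_lin.
  destruct (classic (disk z)) as [Hz | Hz].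
  - rewrite !restr_in by auto. rewrite (infinite_prod_drop_term _ d n _ decay_bounded d_le).
    field. apply disk_minus_neq_0; auto.
  - rewrite !restr_out by auto. ring.
Qed.

End Division.

(** * The resolvent of the coordinate function modulo a maximal ideal *)

Definition inverse_mod (M : (C -> C) -> Prop) (u v : C -> C) : Prop := M (fsub fone (fmul u v)).

Definition locally_bounded_at (R : C -> C) (a : C) : Prop :=
  exists d K, 0 < d /\ forall b, Cmod (b - a) < d -> Cmod (R b) <= K.

Section Resolvent.

Variables (p : R) (M : (C -> C) -> Prop).
Hypothesis p_pos : 0 < p.
Hypothesis M_maximal : Fp_maximal_ideal p M.

Let M_ideal : Fp_ideal p M := proj1 (proj1 M_maximal).

Lemma ideal_Fp (f : C -> C) : M f -> Fp p f.
Proof. apply M_ideal. Qed.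

Lemma ideal_mul (f g : C -> C) : Fp p f -> M g -> M (fmul f g).
Proof. apply M_ideal. Qed.

Lemma ideal_sub (f g : C -> C) : M f -> M g -> M (fsub f g).
Proof.
  intros Hf Hg. rewrite fsub_fadd_fscal. apply M_ideal; auto. apply (ideal_fscal p); auto.
Qed.

Lemma one_not_in_ideal : ~ M fone.
Proof.
  intros Hone. destruct (proj2 (proj1 M_maximal)) as (f & Hf & Nf). apply Nf.
  rewrite <- (fmul_one f (proj1 Hf)). apply ideal_mul; auto.
Qed.

Lemma inverse_mod_of_nonzero_value (f q : C -> C) (b : C) : M f -> f b <> RtoC 0 ->
  (forall z, disk z -> (f z - f b = (z - b) * q z)%C) ->
  inverse_mod M (lin b) (fscal (- / f b) q).
Proof.
  intros Mf Nfb Eq. unfold inverse_mod.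
  replace (fsub fone (fmul (lin b) (fscal (- / f b) q))) with (fscal (/ f b) f);
    [apply (ideal_fscal p); auto|].
  apply functional_extensionality. intros z. unfold fsub, fmul, fscal, fone, lin.
  destruct (classic (disk z)) as [Hz | Hz].
  - rewrite !restr_in by auto.
    replace (f z) with (f b + (z - b) * q z)%C by (rewrite <- Eq by auto; ring).
    field. exact Nfb.
  - rewrite !restr_out, (proj1 (ideal_Fp f Mf) z Hz) by auto. ring.
Qed.

Lemma exists_inverse_mod (u : C -> C) : Fp p u -> ~ M u -> exists v, Fp p v /\ inverse_mod M u v.
Proof.
  intros Hu Nu. assert (Hmax := proj2 M_maximal). assert (HI := proj1 (proj1 M_maximal)).
  destruct HI as (HF & H0 & Hadd & Hmul).
  assert (Fzero : Fp p fzero) by auto. assert (Fone := Fp_one p p_pos).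
  set (J := fun f => exists m v, M m /\ Fp p v /\ f = fadd m (fmul u v)).
  destruct (classic (J fone)) as [(m & v & Hm & Hv & E) | NJ].
  { exists v. split; auto. unfold inverse_mod. rewrite E.
    replace (fsub (fadd m (fmul u v)) (fmul u v)) with m by fun_ring. exact Hm. }
  exfalso. apply Nu.
  assert (HMJ : forall f, M f -> J f).
  { intros f Hf. exists f, fzero. split; [exact Hf|]. split; [exact Fzero | fun_ring]. }
  apply (Hmax J); auto.
  - split; [|exists fone; auto]. split; [|split; [|split]].
    + intros f (m & v & Hm & Hv & ->). apply Fp_add; auto. apply Fp_mul; auto.
    + apply HMJ, H0.
    + intros f g (m & v & Hm & Hv & ->) (m' & v' & Hm' & Hv' & ->).
      exists (fadd m m'), (fadd v v'). split; [auto|]. split; [apply Fp_add; auto | fun_ring].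
    + intros f g Hf (m & v & Hm & Hv & ->).
      exists (fmul f m), (fmul f v). split; [auto|]. split; [apply Fp_mul; auto | fun_ring].
  - exists fzero, fone. split; [auto|]. split; [auto|]. rewrite fmul_one by apply Hu. fun_ring.
Qed.

Variable phi : (C -> C) -> C.
Hypothesis phi_annihilating : annihilating_functional p M phi.

Let phi_add := functional_add p M phi phi_annihilating.
Let phi_scal := functional_scal p M phi phi_annihilating.

Lemma functional_congr (f g : C -> C) : Fp p f -> Fp p g -> M (fsub f g) -> phi f = phi g.
Proof.
  intros Hf Hg H. replace f with (fadd g (fsub f g)) by fun_ring.
  rewrite phi_add, (functional_annihilates p M phi phi_annihilating _ H)
    by (auto; apply ideal_Fp; auto). ring.
Qed.

Variable g : C -> C -> C.
Hypothesis g_Fp : forall a, Fp p (g a).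
Hypothesis g_inverse : forall a, inverse_mod M (lin a) (g a).

Lemma functional_inverse_mod (w h : C -> C) (a : C) : Fp p w -> Fp p h -> inverse_mod M (lin a) h ->
  phi (fmul w (g a)) = phi (fmul w h).
Proof.
  intros Hw Hh Hinv. apply functional_congr; try apply Fp_mul; auto.
  replace (fsub (fmul w (g a)) (fmul w h))
    with (fmul w
      (fsub (fmul (g a) (fsub fone (fmul (lin a) h))) (fmul h (fsub fone (fmul (lin a) (g a)))))).
  - apply ideal_mul, ideal_sub; auto; apply ideal_mul; auto. apply g_inverse.
  - disk_ring.
Qed.

Lemma resolvent_identity (w : C -> C) (a b : C) : Fp p w ->
  (phi (fmul w (g a)) - phi (fmul w (g b)) = (a - b) * phi (fmul (fmul w (g b)) (g a)))%C.
Proof.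
  intros Hw. assert (Ha := g_Fp a). assert (Hb := g_Fp b).
  assert (Hwb := Fp_mul p p_pos w (g b) Hw Hb). assert (Hwba := Fp_mul p p_pos _ (g a) Hwb Ha).
  assert (Hcongr :
    phi (fmul w (g a)) = phi (fadd (fmul w (g b)) (fscal (a - b) (fmul (fmul w (g b)) (g a))))).
  { apply functional_congr; [apply Fp_mul; auto | apply Fp_add; auto; apply Fp_scal; auto |].
    replace (fsub (fmul w (g a)) (fadd (fmul w (g b)) (fscal (a - b) (fmul (fmul w (g b)) (g a)))))
      with (fmul w
        (fsub (fmul (g a) (fsub fone (fmul (lin b) (g b))))
          (fmul (g b) (fsub fone (fmul (lin a) (g a)))))).
    - apply ideal_mul, ideal_sub; auto; apply ideal_mul; auto; apply g_inverse.
    - clear Hwb Hwba. disk_ring. }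
  rewrite Hcongr, phi_add, phi_scal by (auto; apply Fp_scal; auto). ring.
Qed.

(* The function [f = 1 - (z - a) g_a] of [M] is [1] at [a], hence does not vanish near [a]. *)
Lemma resolvent_bounded_inside (w : C -> C) (a : C) : Fp p w -> disk a ->
  locally_bounded_at (fun b => phi (fmul w (g b))) a.
Proof.
  intros Hw Ha.
  destruct (functional_bounded p M phi phi_annihilating) as (eps & K & He & HK & Hphi).
  set (f := fsub fone (fmul (lin a) (g a))).
  assert (Mf : M f) by apply g_inverse. assert (Ff := ideal_Fp f Mf).
  assert (Efa : f a = RtoC 1).
  { unfold f, fsub, fmul, fone, lin. rewrite !restr_in by auto. ring. }
  destruct (proj1 (ccontinuous_eps f a) (holomorphic_ccontinuous f a (proj1 (proj2 Ff)) Ha)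
    (1 / 2)) as (d & Hd & Hfd); [lra|].
  unfold disk in Ha. set (r := (1 + Cmod a) / 2). assert (Hr : Cmod a < r < 1) by (unfold r; lra).
  destruct (Fp_slow_growth p w Hw (eps / 2)) as (A & HA & HwA); [lra|].
  destruct (quotient_growth_le p f r (eps / 2) Ff) as (L & HL & HfL); [lra | lra |].
  exists (Rmin d (r - Cmod a)), (2 * (K * (A * L))). split; [apply Rmin_pos; lra|].
  intros b Hb. destruct (Rmin_Rgt_l _ _ _ Hb) as [Hbd Hba].
  assert (Hbr : Cmod b <= r) by (assert (Htri := Cmod_minus_ge b a); lra).
  assert (Db : disk b) by (unfold disk; lra).
  destruct (Fp_division p p_pos f b Ff Db) as (q & Fq & Eq).
  assert (Hfb : 1 / 2 <= Cmod (f b)).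
  { specialize (Hfd b Hbd). rewrite Efa in Hfd. assert (Htri := Cmod_minus_ge 1 (f b)).
    rewrite Cmod_1, Cmod_minus_comm in Htri. lra. }
  assert (Nfb : f b <> RtoC 0) by (apply Cmod_gt_0; lra).
  assert (Fwq := Fp_mul p p_pos w q Hw Fq).
  rewrite (functional_inverse_mod w (fscal (- / f b) q)); auto; [| apply Fp_scal; auto |].
  - replace (fmul w (fscal (- / f b) q)) with (fscal (- / f b) (fmul w q)) by fun_ring.
    rewrite phi_scal, Cmod_mult, Cmod_opp, Cmod_inv by auto.
    apply Rmult_le_compat; auto using Cmod_ge_0.
    + left. apply Rinv_0_lt_compat. lra.
    + replace 2 with (/ (1 / 2)) by field. apply Rinv_le_contravar; lra.
    + apply Hphi; auto; [apply Rmult_le_pos; auto|]. replace eps with (eps / 2 + eps / 2) by field.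
      apply growth_le_mul; auto. apply (HfL b); auto. apply Fq.
  - apply inverse_mod_of_nonzero_value; auto.
Qed.

Lemma pole_product_not_in_ideal : exists eta, 0 < eta <= 1 /\ forall d a, 1 <= Cmod a ->
  (forall m, Cmod (d m) <= fast_decay (pole_exponent p) eta m) -> ~ M (pole_product d a).
Proof.
  destruct (functional_bounded p M phi phi_annihilating) as (eps & K & He & HK & Hphi).
  assert (Hphi1 := proj1 (Cmod_gt_0 _) (functional_one p M phi phi_annihilating)).
  set (s := pole_exponent p). set (B := exp (2 / s * (2 / s) / (4 * eps))).
  assert (HB : 0 < B) by apply exp_pos.
  assert (HKB : 0 < 2 * (K + 1) * B) by (repeat apply Rmult_lt_0_compat; lra).
  set (eta := Rmin 1 (Cmod (phi fone) / (2 * (K + 1) * B))).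
  assert (Heta : 0 < eta <= 1)
    by (split; [apply Rmin_pos; [lra | apply Rdiv_lt_0_compat; auto] | apply Rmin_l]).
  assert (Hsmall : K * (eta * B) < Cmod (phi fone)).
  { assert (Hmin := Rmin_r 1 (Cmod (phi fone) / (2 * (K + 1) * B))). fold eta in Hmin.
    apply Rle_div_r in Hmin; [|lra].
    assert (0 < eta * B) by (apply Rmult_lt_0_compat; lra). lra. }
  exists eta. split; auto. intros d a Ha Hd MU. set (U := pole_product d a) in *.
  assert (Fone := Fp_one p p_pos). assert (FU := ideal_Fp U MU).
  assert (FU1 := Fp_sub p p_pos U fone FU Fone).
  assert (Hphi_sub : phi (fsub U fone) = (- phi fone)%C).
  { rewrite fsub_fadd_fscal, phi_add, phi_scal by (auto; apply Fp_scal; auto).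
    rewrite (functional_annihilates p M phi phi_annihilating U MU). ring. }
  assert (Hle : Cmod (phi (fsub U fone)) <= K * (eta * B)).
  { apply Hphi; auto; [apply Rmult_le_pos; lra|]. apply pole_product_minus_one_growth_le; auto. }
  rewrite Hphi_sub, Cmod_opp in Hle. lra.
Qed.

(* Modulo [M], the inverse of [z - b_n] is the inverse of the product times the other factors. *)
Lemma resolvent_bounded_on_product_zeros (w : C -> C) (a : C) (eta : R) (d : nat -> C) :
  Fp p w -> 1 <= Cmod a -> 0 < eta <= 1 ->
    (forall m, Cmod (d m) <= fast_decay (pole_exponent p) eta m) ->
  ~ M (pole_product d a) -> exists B, forall n, Cmod (phi (fmul w (g (a - d n)%C))) <= B.
Proof.
  intros Hw Ha Heta Hd NU. set (U := pole_product d a) in *.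
  assert (FU := Fp_pole_product p p_pos a eta d Ha Heta Hd). fold U in FU.
  destruct (exists_inverse_mod U FU NU) as (v & Fv & Hv).
  destruct (functional_bounded p M phi phi_annihilating) as (eps & K & He & HK & Hphi).
  assert (Fwv := Fp_mul p p_pos w v Hw Fv). assert (Fa := Fp_inv_lin p p_pos a Ha).
  destruct (Fp_slow_growth p _ Fwv (eps / 3)) as (A1 & HA1 & Hwv); [lra|].
  destruct (Fp_slow_growth p _ Fa (eps / 3)) as (A3 & HA3 & HaA); [lra|].
  set (A2 := exp (/ pole_exponent p * / pole_exponent p / (4 * (eps / 3)))).
  assert (HA2 : 0 < A2) by apply exp_pos.
  exists (K * (A1 * A2 * A3)). intros n.
  assert (Hdn := Cmod_drop_term_le d _ n Hd). set (Un := pole_product (drop_term d n) a).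
  assert (FUn := Fp_pole_product p p_pos a eta _ Ha Heta Hdn). fold Un in FUn.
  assert (Fh : Fp p (fmul (fmul Un (inv_lin a)) v)) by (apply Fp_mul; auto; apply Fp_mul; auto).
  rewrite (functional_inverse_mod w _ (a - d n)%C Hw Fh).
  - replace (fmul w (fmul (fmul Un (inv_lin a)) v)) with (fmul (fmul (fmul w v) Un) (inv_lin a))
      by fun_ring.
    apply Hphi; [repeat (apply Fp_mul; auto) | repeat apply Rmult_le_pos; lra|].
    replace eps with (eps / 3 + eps / 3 + eps / 3) by field.
    repeat apply growth_le_mul; auto. apply (pole_product_growth_le p p_pos a eta); auto. lra.
  - unfold inverse_mod.
    replace (fmul (lin (a - d n)) (fmul (fmul Un (inv_lin a)) v)) with (fmul U v); [exact Hv|].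
    unfold U. rewrite <- (pole_product_drop_term p p_pos a eta d Ha Heta Hd n). fold Un. fun_ring.
Qed.

Lemma resolvent_bounded_outside (w : C -> C) (a : C) : Fp p w -> 1 <= Cmod a ->
  locally_bounded_at (fun b => phi (fmul w (g b))) a.
Proof.
  intros Hw Ha. destruct pole_product_not_in_ideal as (eta & Heta & HNU).
  set (s := pole_exponent p) in *. apply NNPP. intros HN.
  assert (Hb : forall n, exists b,
    Cmod (b - a) < fast_decay s eta n /\ INR n < Cmod (phi (fmul w (g b)))).
  { intros n. apply NNPP. intros Nb. apply HN. exists (fast_decay s eta n), (INR n).
    split; [apply fast_decay_pos|]. intros b Hb. apply Rnot_lt_le. intros Hlt. apply Nb. exists b.
    auto. }
  set (b := fun n => proj1_sig (constructive_indefinite_description _ (Hb n))).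
  assert (Hbn : forall n,
    Cmod (b n - a) < fast_decay s eta n /\ INR n < Cmod (phi (fmul w (g (b n)))))
    by (intros n; exact (proj2_sig (constructive_indefinite_description _ (Hb n)))).
  set (d := fun n => (a - b n)%C).
  assert (Hd : forall m, Cmod (d m) <= fast_decay s eta m).
  { intros m. unfold d. rewrite Cmod_minus_comm. left. apply Hbn. }
  destruct (resolvent_bounded_on_product_zeros w a eta d Hw Ha Heta Hd (HNU d a Ha Hd)) as [B HB].
  destruct (nfloor_ex (Rmax B 0)) as [n Hn]; [apply Rmax_r|].
  assert (HBn := HB (S n)). replace (a - d (S n))%C with (b (S n)) in HBn by (unfold d; ring).
  assert (Hlt := proj2 (Hbn (S n))). rewrite S_INR in Hlt. assert (Hmax := Rmax_l B 0). lra.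
Qed.

Lemma cderivable_resolvent (w : C -> C) (a : C) : Fp p w ->
  cderivable (fun b => phi (fmul w (g b))) a.
Proof.
  intros Hw. set (w1 := fmul w (g a)). assert (Fw1 : Fp p w1) by (apply Fp_mul; auto).
  set (w2 := fmul w1 (g a)). assert (Fw2 : Fp p w2) by (apply Fp_mul; auto).
  assert (Hbd : locally_bounded_at (fun b => phi (fmul w2 (g b))) a).
  { destruct (Rlt_le_dec (Cmod a) 1);
      [apply resolvent_bounded_inside | apply resolvent_bounded_outside]; auto. }
  destruct Hbd as (d & K & Hd & HK).
  apply cderivable_of_quadratic_remainder with (l := phi w2) (K := K) (d := d); auto. intros b Hb.
  assert (Hid1 := resolvent_identity w b a Hw). fold w1 in Hid1.
  assert (Hid2 := resolvent_identity w1 b a Fw1). fold w2 in Hid2.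
  fold w1. replace (phi (fmul w (g b)) - phi w1 - (b - a) * phi w2)%C
    with ((b - a) * ((b - a) * phi (fmul w2 (g b))))%C by (rewrite Hid1, <- Hid2; ring).
  rewrite !Cmod_mult, <- Rmult_assoc, Rmult_comm.
  apply Rmult_le_compat_r; [apply Rmult_le_pos; apply Cmod_ge_0 | apply HK, Hb].
Qed.

Lemma inverse_mod_inv_lin (a : C) : 1 <= Cmod a -> inverse_mod M (lin a) (inv_lin a).
Proof.
  intros Ha. unfold inverse_mod. rewrite lin_inv_lin by auto.
  replace (fsub fone fone) with fzero by fun_ring. apply M_ideal.
Qed.

Lemma resolvent_at_infinity : exists K, 0 <= K /\ forall a, 1 < Cmod a ->
  Cmod (a * phi (fmul fone (g a)) - - phi fone) <= K * / (Cmod a - 1).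
Proof.
  destruct (functional_bounded p M phi phi_annihilating) as (eps & K & He & HK & Hphi).
  exists K. split; auto. intros a Ha. assert (Fone := Fp_one p p_pos).
  assert (Fa := Fp_inv_lin p p_pos a ltac:(lra)). assert (F1a := Fp_mul p p_pos fone _ Fone Fa).
  rewrite (functional_inverse_mod fone (inv_lin a)) by (auto; apply inverse_mod_inv_lin; lra).
  replace (a * phi (fmul fone (inv_lin a)) - - phi fone)%C
    with (phi (fadd (fscal a (fmul fone (inv_lin a))) fone))
    by (rewrite phi_add, phi_scal by (auto; apply Fp_scal; auto); ring).
  assert (Pa : 0 < / (Cmod a - 1)) by (apply Rinv_0_lt_compat; lra).
  apply Hphi; [apply Fp_add; auto; apply Fp_scal; auto | lra|].
  apply growth_le_bounded; [lra | lra |]. intros z Hz.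
  unfold fadd, fscal, fmul, fone, inv_lin. rewrite !restr_in by auto.
  assert (Hneq := disk_minus_neq_0 a z ltac:(lra) Hz). unfold disk in Hz.
  replace (a * (1 * / (z - a)) + 1)%C with (z / (z - a))%C by (field; auto).
  replace (/ (Cmod a - 1)) with (1 / (Cmod a - 1)) by (field; lra).
  assert (Htri := Cmod_minus_ge a z). rewrite Cmod_minus_comm in Htri. apply Cmod_div_le; lra.
Qed.

(* [a * phi (g_a)] is entire, vanishes at [0] and tends to [- phi 1] at infinity. *)
Lemma resolvent_not_everywhere_defined : False.
Proof.
  apply (functional_one p M phi phi_annihilating).
  destruct resolvent_at_infinity as (K & HK & Hinf).
  assert (Hvalue : (0 * phi (fmul fone (g 0)))%C = (- phi fone)%C).
  { apply (entire_limit_at_infinity (fun a => a * phi (fmul fone (g a)))%C).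
    - intros a.
      apply cderivable_mult; [apply cderivable_id | apply cderivable_resolvent, Fp_one, p_pos].
    - intros eps He. exists (2 + K / eps). intros a Ha.
      assert (Hq : 0 <= K / eps) by (apply Rmult_le_pos; [auto | left; apply Rinv_0_lt_compat, He]).
      eapply Rle_trans; [apply Hinf; lra|]. apply Rle_div_l; [lra|].
      replace K with (eps * (K / eps)) at 1 by (field; lra). apply Rmult_le_compat_l; lra. }
  replace (phi fone) with (- - phi fone)%C by ring. rewrite <- Hvalue. ring.
Qed.

End Resolvent.

Lemma closed_maximal_ideal_contains_lin (p : R) (M : (C -> C) -> Prop) : 0 < p ->
  Fp_maximal_ideal p M -> Fp_closed p M -> exists a, disk a /\ M (lin a).
Proof.
  intros Hp Hmax Hcl. apply NNPP. intros HN.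
  assert (Hone := one_not_in_ideal p M Hmax).
  assert (Hlin : forall a, ~ M (lin a)).
  { intros a Ma. destruct (Rlt_le_dec (Cmod a) 1) as [Ha | Ha]; [apply HN; exists a; auto|].
    apply Hone. rewrite <- (lin_inv_lin a Ha).
    replace (fmul (lin a) (inv_lin a)) with (fmul (inv_lin a) (lin a)) by fun_ring.
    apply (ideal_mul p); auto. apply Fp_inv_lin; auto. }
  assert (Hinv := fun a => exists_inverse_mod p M Hp Hmax (lin a) (Fp_lin p Hp a) (Hlin a)).
  destruct (exists_annihilating_functional p Hp M (proj1 (proj1 Hmax)) Hcl Hone) as (phi & Hphi).
  set (g := fun a => proj1_sig (constructive_indefinite_description _ (Hinv a))).
  assert (Hg := fun a => proj2_sig (constructive_indefinite_description _ (Hinv a))).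
  apply (resolvent_not_everywhere_defined p M Hp Hmax phi Hphi g); intros a; apply Hg.
Qed.

Lemma sub_value_in_ideal (p : R) (M : (C -> C) -> Prop) (a : C) (f : C -> C) : 0 < p ->
  Fp_ideal p M -> disk a -> M (lin a) -> Fp p f -> M (fsub f (fscal (f a) fone)).
Proof.
  intros Hp HI Ha Ma Hf. destruct (Fp_division p Hp f a Hf Ha) as (q & Fq & Eq).
  replace (fsub f (fscal (f a) fone)) with (fmul q (lin a)); [apply HI; auto|].
  apply functional_extensionality. intros z. unfold fsub, fmul, fscal, lin, fone.
  destruct (classic (disk z)) as [Hz | Hz].
  - rewrite !restr_in by auto.
    replace (f z) with (f a + (z - a) * q z)%C by (rewrite <- Eq by auto; ring). ring.
  - rewrite !restr_out, (proj1 Hf z Hz), (proj1 Fq z Hz) by auto. ring.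
Qed.

Theorem theorem8 (p : R) (hp : 1 < p) (M : (C -> C) -> Prop)
  (hM : Fp_maximal_ideal p M) (hclosed : Fp_closed p M) :
  exists lambda : C, disk lambda /\ forall f : C -> C, M f <-> M_at p lambda f.
Proof.
  assert (Hp : 0 < p) by lra. assert (HI := proj1 (proj1 hM)).
  destruct (closed_maximal_ideal_contains_lin p M Hp hM hclosed) as (a & Ha & Ma).
  assert (Hvalue := fun f => sub_value_in_ideal p M a f Hp HI Ha Ma).
  exists a. split; auto. intros f. split.
  - intros Mf. assert (Hf := ideal_Fp p M hM f Mf). split; auto.
    apply NNPP. intros Nfa. apply (one_not_in_ideal p M hM).
    replace fone with (fscal (/ f a) (fsub f (fsub f (fscal (f a) fone)))).
    + apply (ideal_fscal p); auto. apply (ideal_sub p M Hp hM); auto.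
    + apply functional_extensionality. intros z. unfold fscal, fsub. field. exact Nfa.
  - intros [Hf Hfa]. replace f with (fsub f (fscal (f a) fone)); [apply Hvalue, Hf|].
    rewrite Hfa. fun_ring.
Qed.
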